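(* Let $d \geq 2$. As $n\to\infty$, $$\sup_{x\in\mathbb{Z}^d} \mathsf{P}_{\mathsf{SAW}_n}(\Gamma_n = x) \to 0 .$$
   Context: A walk of length $n$ is a map $\gamma:\{0,\dots,n\}\to\mathbb{Z}^d$ such that $\gamma_i$ and $\gamma_{i+1}$ are nearest neighbours in $\mathbb{Z}^d$ for each $0\le i\le n-1$; it is self-avoiding if it is injective. $\mathrm{SAW}_n$ is the (finite) set of self-avoiding walks of length $n$ with $\gamma_0=0$, $\mathsf{P}_{\mathsf{SAW}_n}$ is the uniform probability measure on $\mathrm{SAW}_n$, and $\Gamma$ denotes the random walk with law $\mathsf{P}_{\mathsf{SAW}_n}$. *)

(* Defs.v *)
From mathcomp Require Import all_boot all_order all_algebra finmap.
From mathcomp Require Import zify.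
From mathcomp Require Import all_classical all_reals all_analysis.

Set Implicit Arguments.
Unset Strict Implicit.
Unset Printing Implicit Defensive.

Import Order.TTheory GRing.Theory Num.Theory.
Import numFieldNormedType.Exports.

Local Open Scope classical_set_scope.
Local Open Scope ring_scope.

Definition Zd (d : nat) := 'rV[int]_d.

Definition neighbours (d : nat) (x y : Zd d) : Prop :=
  \sum_(j < d) `|x 0 j - y 0 j| = 1.

Definition Zd_map (d n : nat) := {ffun 'I_n.+1 -> Zd d}.

Definition is_walk (d n : nat) (g : Zd_map d n) : Prop :=
  forall i j : 'I_n.+1, j = i.+1 :> nat -> neighbours (g i) (g j).

Definition self_avoiding (d n : nat) (g : Zd_map d n) : Prop :=
  is_walk g /\ injective g.

Definition SAW (d n : nat) : set (Zd_map d n) :=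
  [set g | self_avoiding g /\ g ord0 = 0].

Arguments SAW : clear implicits.

(* [fset_set] sends infinite sets to the empty one, so the counting in [P_SAW]
   below is meaningful only thanks to the finiteness of [SAW d n]. *)
Lemma finite_SAW (d n : nat) : finite_set (SAW d n).
Proof.
pose dec (f : {ffun 'I_n.+1 * 'I_d -> 'I_(n + n).+1}) : Zd_map d n :=
  [ffun i => \row_j ((f (i, j))%:Z - n%:Z)].
apply: (@sub_finite_set _ _ (range dec)); last first.
  by apply: finite_image; exact: finite_finset.
move=> g [[gw _] g0].
have gb (j : 'I_d) (k : nat) (i : 'I_n.+1) : i = k :> nat ->
    `|g i 0 j| <= k%:Z.
  elim: k i => [|k IHk] i ik.
    by rewrite (_ : i = ord0) ?g0 ?mxE ?normr0//; apply: val_inj.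
  have kn : (k < n.+1)%N by rewrite ltnW// -ik ltn_ord.
  have := gw (Ordinal kn) i ik; rewrite /neighbours (bigD1 j)//= => step.
  have rest : 0 <= \sum_(l < d | l != j) `|g (Ordinal kn) 0 l - g i 0 l|.
    by apply: sumr_ge0.
  have := IHk (Ordinal kn) erefl.
  move: step rest; move: (\sum_(_ | _) _) => s.
  by lia.
exists [ffun p : 'I_n.+1 * 'I_d => inord `|(g p.1 0 p.2 + n%:Z)%R|%N] => //.
apply/ffunP => i; apply/rowP => j; rewrite ffunE mxE ffunE /=.
have := gb j i i erefl; have := ltn_ord i => lin lei.
by rewrite inordK; lia.
Qed.

Definition P_SAW (R : realType) (d n : nat) (A : set (Zd_map d n)) : R :=
  #|` fset_set (SAW d n `&` A)|%:R / #|` fset_set (SAW d n)|%:R.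

(* Main.v *)
Require Import Defs.
From mathcomp Require Import all_boot all_order all_algebra.
From mathcomp Require Import all_classical all_reals all_analysis.
From mathcomp Require Import zify ring lra.

(** Call the first coordinate of a point its level and the second its latitude,
    let c n be the number of self-avoiding walks of length n, and call a point of
    a walk a cut if all earlier points are weakly below it and all later ones
    strictly above it. Reflecting a walk after its last maximum is injective on
    the walks that end at x, keeps the final latitude and creates a cut. So it is
    enough to bound the number of walks that have a cut and end at a given
    latitude. Fix K and consider blocks: segments between cuts, made of one step
    up, r lateral steps and K - r steps up. Changing r in the first block moves
    the end to K different latitudes, so that at most c n / K walks with a block
    end at a given latitude. It remains to see that the number w n of walks with
    a cut but no block is o(c n).

    Inserting a bridge of length 2i and then a block at the first cut of such a
    walk is injective, hence the sum over i of b(2i) w(n - 2i - K - 1) is at most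
    c n. By the Hammersley-Welsh decomposition of walks into bridges, the sum of
    b(2i) mu^(-2i) diverges, mu being the connective constant. The two facts are
    contradictory unless w n = o(c n), because w(n - 2i) is at least about
    mu^(-2i) w n. This last estimate is a form of Kesten's ratio theorem, proved
    by double counting: a local flip that replaces one downward step by three
    steps lengthens the walk by 2, and affects neither cuts nor blocks since it
    takes place along a descent. Kesten's pattern theorem makes flips of both
    directions available linearly many times on typical walks. *)

Import Order.TTheory GRing.Theory Num.Theory.
Import numFieldNormedType.Exports.

Set Implicit Arguments.
Unset Strict Implicit.
Unset Printing Implicit Defensive.

Local Open Scope ring_scope.

(** * Finite sums and lists *)

(** The obstacle is the ratio estimate: submultiplicativity says nothing about the class of walks
    with a cut and no block, so that its sizes at lengths n and n + 2i can be compared only through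
    a local move that preserves the class. Flips take place in a fixed tiling by disjoint 2 x 2
    squares. Different flips therefore never interact, the total number T of slots is conserved, and
    the numbers of walks with j of the T slots in the longer state satisfy an exact identity between
    lengths n and n + 2, with ratio (T - j) / (j + 1). Where this ratio is too large, repeated flips
    would produce more walks than mu allows. An error of order e c n is harmless because only o(c n)
    is wanted, and a loss (1 + delta)^i costs a bounded factor because finitely many i are used.
    Flips preserve parity: hence bridges of even length, and an odd K, for which the inserted block
    has even length K + 1. The pattern theorem is an induction on the number of visits to a cell of
    a tiling by boxes: a cell visited the maximal number of times within a short stretch is visited
    nowhere else, so that it can be emptied and crossed by a path with a slot. *)

Lemma sum_subseq_le (R : numDomainType) (T : eqType) (l t : seq T) (G : T -> R) :
  uniq l -> {subset l <= t} -> {in t, forall y, 0 <= G y} ->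
  \sum_(y <- l) G y <= \sum_(y <- t) G y.
Proof.
elim: l t => [|y l IHl] t /=.
  by move=> _ _ G0; rewrite big_nil big_seq sumr_ge0.
case/andP=> yl ul st G0; rewrite big_cons.
have yt : y \in t by apply: st; rewrite mem_head.
rewrite (perm_big _ (perm_to_rem yt)) big_cons lerD2l; apply: IHl => //.
  move=> u ul'; have /= := st u; rewrite inE ul' orbT => /(_ isT).
  rewrite (perm_mem (perm_to_rem yt)) inE => /orP[/eqP uy|//].
  by move: yl; rewrite -uy ul'.
by move=> u /mem_rem; apply: G0.
Qed.

Lemma ler_sum_inj (R : numDomainType) (T U : eqType) (s : seq T) (t : seq U)
    (f : T -> U) (F : T -> R) (G : U -> R) :
  uniq s -> {in s &, injective f} -> {in s, forall x, f x \in t} ->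
  {in s, forall x, F x <= G (f x)} -> {in t, forall y, 0 <= G y} ->
  \sum_(x <- s) F x <= \sum_(y <- t) G y.
Proof.
move=> us fI st FG G0.
apply: (@le_trans _ _ (\sum_(x <- s) G (f x))).
  by rewrite big_seq [leRHS]big_seq; apply: ler_sum.
rewrite -(big_map f xpredT); apply: sum_subseq_le => //.
  by rewrite map_inj_in_uniq.
by move=> _ /mapP[x xs ->]; apply: st.
Qed.

Lemma ler_count_inj (T U : eqType) (s : seq T) (t : seq U)
    (P : pred T) (Q : pred U) (f : T -> U) :
  uniq s -> {in [pred x in s | P x] &, injective f} ->
  {in s, forall x, P x -> (f x \in t) && Q (f x)} ->
  (count P s <= count Q t)%N.
Proof.
move=> us fI st; rewrite -!size_filter -(size_map f); apply: uniq_leq_size.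
  rewrite map_inj_in_uniq ?filter_uniq// => x y.
  by rewrite !mem_filter => /andP[Px xs] /andP[Py ys]; apply: fI; rewrite inE /= ?xs ?ys.
by move=> _ /mapP[x + ->]; rewrite !mem_filter => /andP[Px xs]; rewrite andbC st.
Qed.

Lemma natr_countE (R : pzSemiRingType) (T : Type) (P : pred T) (s : seq T) :
  (count P s)%:R = \sum_(x <- s | P x) 1 :> R.
Proof. by rewrite -sum1_count natr_sum. Qed.

Lemma sumr_const_seq (V : nmodType) (T : Type) (s : seq T) (a : V) :
  \sum_(x <- s) a = a *+ size s.
Proof. by rewrite big_const_seq count_predT iter_addr_0. Qed.

Lemma cat_split (T : Type) (s1 s2 t1 t2 : seq T) : s1 ++ s2 = t1 ++ t2 ->
  (exists r, s1 = t1 ++ r /\ t2 = r ++ s2) \/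
  (exists r, t1 = s1 ++ r /\ s2 = r ++ t2).
Proof.
elim: s1 t1 => [|x s1 IH] [|y t1] /=.
- by move=> ->; left; exists [::].
- by move=> ->; right; exists (y :: t1).
- by move=> <-; left; exists (x :: s1).
- by case=> -> /IH[] [r [-> ->]]; [left|right]; exists r.
Qed.

Lemma sorted_cat_cons (T : Type) (e : rel T) (s t : seq T) (y : T) :
  sorted e (s ++ y :: t) = sorted e (rcons s y) && path e y t.
Proof. by case: s => [|x s] //=; rewrite -cat_rcons cat_path last_rcons. Qed.

Lemma rev_cat_cons (T : Type) (s t : seq T) (y : T) :
  rev (s ++ y :: t) = rev t ++ y :: rev s.
Proof. by rewrite rev_cat rev_cons cat_rcons. Qed.

(** * Self-avoiding walks as lists of points *)

Section Walks.
Variable d : nat.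
Notation pt := 'rV[int]_d.+2.
Implicit Types (x y z t : pt) (w p q : seq pt).

(** The dimension is written [d.+2], so that the two distinguished coordinates exist by
    construction. *)
Definition i0 : 'I_d.+2 := ord0.
Definition i1 : 'I_d.+2 := lift ord0 ord0.

Lemma i01 : (i1 == i0) = false. Proof. by []. Qed.

Definition lev x : int := x 0 i0.
Definition lat x : int := x 0 i1.
Definition e0 : pt := delta_mx 0 i0.
Definition e1 : pt := delta_mx 0 i1.

Lemma levD x y : lev (x + y) = lev x + lev y. Proof. by rewrite /lev mxE. Qed.
Lemma levN x : lev (- x) = - lev x. Proof. by rewrite /lev mxE. Qed.
Lemma latD x y : lat (x + y) = lat x + lat y. Proof. by rewrite /lat mxE. Qed.
Lemma latN x : lat (- x) = - lat x. Proof. by rewrite /lat mxE. Qed.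
Lemma lev0 : lev 0 = 0. Proof. by rewrite /lev mxE. Qed.
Lemma lat0 : lat 0 = 0. Proof. by rewrite /lat mxE. Qed.
Lemma lev_e0 : lev e0 = 1. Proof. by rewrite /lev mxE !eqxx. Qed.
Lemma lat_e0 : lat e0 = 0. Proof. by rewrite /lat mxE. Qed.
Lemma lev_e1 : lev e1 = 0. Proof. by rewrite /lev mxE. Qed.
Lemma lat_e1 : lat e1 = 1. Proof. by rewrite /lat mxE !eqxx. Qed.
Definition levlatE :=
  (levD, levN, latD, latN, lev0, lat0, lev_e0, lat_e0, lev_e1, lat_e1).

Definition adj x y : bool := \sum_j `|x 0 j - y 0 j| == 1.

Lemma adjC x y : adj x y = adj y x.
Proof. by rewrite /adj; under eq_bigr do rewrite distrC. Qed.

Lemma adjD t x y : adj (x + t) (y + t) = adj x y.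
Proof.
by rewrite /adj; under eq_bigr => j _ do rewrite !mxE opprD addrACA subrr addr0.
Qed.

Definition dirs : seq pt :=
  [seq (if b then delta_mx 0 j else - delta_mx 0 j)
     | j <- enum 'I_d.+2, b <- [:: true; false]].

Lemma adj_dirs x y : adj x y = (y - x \in dirs).
Proof.
rewrite -(adjD (- x)) subrr; move: (y - x) => v {x y}.
apply/idP/idP => [|/allpairsP[[j b] /= [_ _ ->]]].
  rewrite /adj => /eqP s1.
  have [j vj] : exists j, v 0 j != 0.
    apply/existsP; apply/contraT; rewrite negb_exists => /forallP v0.
    move: s1; rewrite big1// => j _; move: (v0 j); rewrite negbK => /eqP ->.
    by rewrite !mxE subrr normr0.
  move: s1; rewrite (bigD1 j)//= => s1.
  have sge0 : 0 <= \sum_(l < d.+2 | l != j) `|(0 : pt) 0 l - v 0 l|.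
    by apply: sumr_ge0.
  have vj1 : `|v 0 j| = 1 /\ \sum_(l < d.+2 | l != j) `|(0 : pt) 0 l - v 0 l| = 0.
    move: s1 sge0 vj; rewrite [in `|_ - _|]mxE sub0r normrN.
    by set s := \sum_(_ | _) _; move: (v 0 j) s => a s; lia.
  case: vj1 => vj1 /eqP; rewrite psumr_eq0// => /allP vl.
  apply/allpairsP; exists (j, 0 < v 0 j); rewrite /= mem_enum; split=> //.
    by case: (0 < _).
  apply/rowP => l; have := vl l; rewrite mem_index_enum => /(_ isT).
  case: (eqVneq l j) => [->|lj] /=.
    by move=> _; have := vj1; case: ltP; rewrite !mxE !eqxx; move: (v 0 j) vj => a; lia.
  by rewrite normr_eq0 [X in X - _]mxE sub0r oppr_eq0 => /eqP ->; case: ifP;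
    rewrite !mxE (negPf lj) ?oppr0.
have h (w : pt) : w 0 j = 1 \/ w 0 j = - 1 -> (forall l, l != j -> w 0 l = 0) -> adj 0 w.
  move=> wj wl; rewrite /adj (bigD1 j)//= big1 ?addr0 => [|l lj].
    by rewrite mxE; case: wj => ->.
  by rewrite mxE wl// subrr normr0.
apply: h; first by case: b; rewrite !mxE !eqxx; [left|right].
by move=> l lj; case: b; rewrite !mxE (negPf lj) andbF ?oppr0.
Qed.

Lemma adj_e0 x : adj x (x + e0).
Proof.
rewrite adj_dirs [x + _]addrC addrK; apply/allpairsP.
by exists (i0, true); rewrite /= mem_enum.
Qed.

Lemma adj_e1 x : adj x (x + e1).
Proof.
rewrite adj_dirs [x + _]addrC addrK; apply/allpairsP.
by exists (i1, true); rewrite /= mem_enum.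
Qed.

Fixpoint walks n x : seq (seq pt) :=
  if n is n'.+1 then
    [seq x :: w | y <- [seq x + e | e <- dirs], w <- walks n' y]
  else [:: [:: x]].

Lemma mem_walks n x w :
  (w \in walks n x) = [&& size w == n.+1, head x w == x & sorted adj w].
Proof.
elim: n x w => [|n IH] x w /=.
  rewrite inE; case: w => [|y [|z w]] //=; rewrite ?andbF//.
  by apply/negP => /eqP.
apply/allpairsPdep/idP => [[y [p [/mapP[e ed ->]]]]|].
  rewrite IH => /and3P[/eqP sp hp ap] ->; rewrite /= sp !eqxx /=.
  case: p sp hp ap => [|z p] //= _ /eqP -> ->.
  by rewrite andbT adj_dirs [x + e]addrC addrK.
case: w => [|y [|z p]] /=; rewrite ?andbF//.
case/and4P=> sp /eqP -> xz zp; exists z, (z :: p); split=> //.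
  by apply/mapP; exists (z - x); [rewrite -adj_dirs|rewrite addrC subrK].
by rewrite IH /= eqxx zp !andbT -eqSS.
Qed.

(** Thanks to [undup] the enumeration is free of duplicates without a study of [dirs]. *)
Definition saws n x := [seq w <- undup (walks n x) | uniq w].

Definition issaw n x w := [&& size w == n.+1, head x w == x, sorted adj w & uniq w].

Lemma mem_saws n x w : (w \in saws n x) = issaw n x w.
Proof.
by rewrite mem_filter mem_undup mem_walks /issaw andbC -!andbA.
Qed.

Lemma saws_uniq n x : uniq (saws n x).
Proof. by rewrite filter_uniq ?undup_uniq. Qed.

Definition shift t w := [seq y + t | y <- w].

Lemma shiftK t : cancel (shift t) (shift (- t)).
Proof. by move=> w; rewrite /shift -map_comp -[RHS]map_id; apply: eq_map => y /=;
  rewrite addrK. Qed.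

Lemma sorted_shift t w : sorted adj (shift t w) = sorted adj w.
Proof. by rewrite sorted_map; apply: eq_sorted => x y /=; rewrite adjD. Qed.

Lemma uniq_shift t w : uniq (shift t w) = uniq w.
Proof. by rewrite map_inj_uniq //; apply: addIr. Qed.

Lemma mem_shift t w y : (y \in shift t w) = (y - t \in w).
Proof. by rewrite -{1}(subrK t y) /shift (mem_map (addIr t)). Qed.

Lemma last_shift t x w : last (x + t) (shift t w) = last x w + t.
Proof. by rewrite (last_map (fun y => y + t)). Qed.

Lemma issaw_shift n t x w : issaw n (x + t) (shift t w) = issaw n x w.
Proof.
rewrite /issaw size_map sorted_shift uniq_shift; case: w => [|y w] //=.
by rewrite (inj_eq (addIr t)).
Qed.

Definition c n := size (saws n 0).

Lemma size_saws n x : size (saws n x) = c n.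
Proof.
have h y z : (size (saws n y) <= size (saws n z))%N.
  rewrite -!count_predT; apply: (ler_count_inj (f := shift (z - y))).
  - exact: saws_uniq.
  - by move=> u v _ _; apply: (can_inj (shiftK _)).
  - move=> w; rewrite !mem_saws => ws _.
    by rewrite -{1}[z](subrK y) addrC issaw_shift ws.
by apply/eqP; rewrite eqn_leq !h.
Qed.

Lemma size_walks n x : size (walks n x) = (size dirs ^ n)%N.
Proof.
elim: n x => [|n IH] x //=; rewrite size_allpairs_dep.
rewrite (eq_map (g := fun=> (size dirs ^ n)%N)) => [|y] //.
by rewrite -map_comp sumnE big_map big_const_seq count_predT iter_addn_0 mulnC -expnS.
Qed.

Lemma dirs_gt0 : (0 < size dirs)%N.
Proof. by rewrite size_allpairs size_enum_ord. Qed.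

Lemma issaw_cat n m x w1 y w2 :
  issaw (n + m) x (w1 ++ y :: w2) -> size w1 = n ->
  issaw n x (rcons w1 y) /\ issaw m y (y :: w2).
Proof.
case/and4P; rewrite size_cat /= addnS eqSS => /eqP sz hd so un s1.
have s2 : size w2 = m by move: sz; rewrite s1 => /eqP; rewrite eqn_add2l => /eqP.
move: so un hd; rewrite -cat_rcons => so un hd.
rewrite /issaw size_rcons s1 /= s2 !eqxx /=; split.
  have := un; rewrite cat_uniq => /andP[-> _]; rewrite andbT.
  move: so; rewrite cat_rcons sorted_cat_cons => /andP[-> _]; rewrite andbT.
  by case: (w1) hd.
have := un; rewrite cat_rcons cat_uniq => /and3P[_ _ /= ->].
by move: so; rewrite cat_rcons sorted_cat_cons => /andP[_ ->].
Qed.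

End Walks.

(** * Submultiplicativity and the connective constant *)

Section Growth.
Variables (R : realType) (d : nat).
Notation pt := 'rV[int]_d.+2.
Notation c := (c d).

Lemma saws_split n m (x : pt) (w : seq pt) : issaw (n + m) x w ->
  w = take n w ++ nth 0 w n :: drop n.+1 w /\ size (take n w) = n.
Proof.
case/andP=> /eqP sw _; have nw : (n < size w)%N by rewrite sw ltnS leq_addr.
by rewrite -drop_nth// cat_take_drop size_takel// ltnW.
Qed.

(** Cutting a walk at time n is injective into pairs of walks that share the cut point. This is the
    common source of the submultiplicative bounds, weighted or not. *)
Lemma sum_saws_cat (F : seq pt -> R) (G : seq pt -> seq pt -> R) n m (x : pt) :
  (forall u v, 0 <= G u v) ->
  (forall w1 y w2, issaw (n + m) x (w1 ++ y :: w2) -> size w1 = n ->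
     F (w1 ++ y :: w2) <= G (rcons w1 y) (y :: w2)) ->
  \sum_(w <- saws (n + m) x) F w <=
  \sum_(u <- saws n x) \sum_(v <- saws m (last x u)) G u v.
Proof.
move=> G0 FG.
have <- : \sum_(p <- [seq (u, v) | u <- saws n x, v <- saws m (last x u)]) G p.1 p.2 =
    \sum_(u <- saws n x) \sum_(v <- saws m (last x u)) G u v.
  by rewrite big_allpairs_dep.
pose f (w : seq pt) := (rcons (take n w) (nth 0 w n), nth 0 w n :: drop n.+1 w).
apply: (ler_sum_inj (f := f)) => //; first exact: saws_uniq.
- move=> w w'; rewrite !mem_saws => /saws_split[ew _] /saws_split[ew' _].
  rewrite /f => -[/eqP]; rewrite eqseq_rcons => /andP[/eqP h1 /eqP h2] _ h3.
  by rewrite ew ew' h1 h2 h3.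
- move=> w; rewrite mem_saws => ws; have [ew sw] := saws_split ws.
  rewrite ew in ws; have [s1 s2] := issaw_cat ws sw.
  apply/allpairsPdep; exists (rcons (take n w) (nth 0 w n)).
  by exists (nth 0 w n :: drop n.+1 w); rewrite last_rcons !mem_saws.
- move=> w; rewrite mem_saws => ws; have [ew sw] := saws_split ws.
  by rewrite {1}ew; apply: FG => //; rewrite -ew.
Qed.

Lemma c_submul n m : (c (n + m) <= c n * c m)%N.
Proof.
rewrite -(ler_nat R) natrM.
have -> : (c (n + m))%:R = \sum_(w <- saws (n + m) (0 : pt)) 1 :> R.
  by rewrite sumr_const_seq.
apply: (le_trans (@sum_saws_cat (fun=> 1) (fun _ _ => 1) n m 0 _ _)) => //.
under eq_bigr => u _ do rewrite sumr_const_seq size_saws.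
by rewrite sumr_const_seq -[X in _ *+ X]/(c n) mulr_natl.
Qed.

Lemma straight_saw n : issaw n 0 [seq (e0 d) *+ i | i <- iota 0 n.+1].
Proof.
apply/and4P; split; rewrite ?size_map ?size_iota//=.
- have : forall k m, path (@adj d) ((e0 d) *+ k) [seq (e0 d) *+ i | i <- iota k.+1 m].
    move=> k m; elim: m k => //= m IH k; rewrite IH andbT.
    by rewrite mulrSr adj_e0.
  by move=> /(_ 0%N).
- rewrite -[X in is_true X]/(uniq [seq (e0 d) *+ i | i <- iota 0 n.+1]).
  rewrite map_inj_uniq ?iota_uniq// => i j.
  move/(congr1 (@lev d)); rewrite /lev !mulmxnE !mxE /= => h.
  by move/eqP: h; rewrite eqr_nat => /eqP.
Qed.

Lemma c_gt0 n : (0 < c n)%N.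
Proof.
have := straight_saw n; rewrite -mem_saws /c.
by case: saws.
Qed.

Lemma c_leM k q r : (c (q * k + r) <= c k ^ q * c r)%N.
Proof.
elim: q => [|q IH]; first by rewrite mul0n add0n expn0 mul1n.
by rewrite mulSn -addnA expnS -mulnA (leq_trans (c_submul _ _))// leq_mul2l IH orbT.
Qed.

(** The connective constant as an infimum: [mu ^+ n <= c n] is then immediate, and [c_growth]
    supplies the other half of Fekete's lemma. *)
Definition mu : R := inf [set (c n)%:R `^ (n%:R^-1) | n in [set n | (0 < n)%N]]%classic.

Lemma mu_ge1 : 1 <= mu.
Proof.
apply: lb_le_inf; first by exists ((c 1)%:R `^ (1%:R^-1)), 1%N.
move=> _ [n n0 <-]; apply: (@le_trans _ _ (1 `^ (n%:R^-1))); first by rewrite powR1.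
by apply: ge0_ler_powR; rewrite ?nnegrE ?invr_ge0// ler1n c_gt0.
Qed.

Lemma mu_gt0 : 0 < mu. Proof. exact: lt_le_trans mu_ge1. Qed.

Lemma mu_exp_le n : mu ^+ n <= (c n)%:R.
Proof.
case: n => [|n]; first by rewrite expr0 ler1n c_gt0.
have h : mu <= (c n.+1)%:R `^ (n.+1%:R^-1).
  apply: ge_inf; last by exists n.+1.
  by exists 0 => _ [k _ <-]; rewrite powR_ge0.
rewrite (le_trans (lerXn2r n.+1 _ _ h)) ?nnegrE ?powR_ge0//; first exact: ltW mu_gt0.
by rewrite -powR_mulrn ?powR_ge0// -powRrM mulVf ?powRr1.
Qed.

(** Some k satisfies [c k <= theta ^+ k]; divide n by k and let the constant absorb the
    remainder. *)
Lemma c_growth (theta : R) : mu < theta ->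
  exists2 C : R, 0 < C & forall n, (c n)%:R <= C * theta ^+ n.
Proof.
move=> mt; have t1 : 1 <= theta by rewrite (le_trans mu_ge1)// ltW.
have t0 : 0 < theta by exact: lt_le_trans t1.
have /inf_lt[] : inf [set (c n)%:R `^ (n%:R^-1) | n in [set n | (0 < n)%N]]%classic < theta := mt.
  by exists ((c 1)%:R `^ (1%:R^-1)); exists 1%N.
move=> _ [k /= k0 <-] kt.
have ck : (c k)%:R <= theta ^+ k.
  have := lerXn2r k _ _ (ltW kt); rewrite !nnegrE powR_ge0 => /(_ isT (ltW t0)).
  apply: le_trans.
  by rewrite -powR_mulrn ?powR_ge0// -powRrM mulVf ?powRr1// pnatr_eq0 -lt0n.
exists (1 + \sum_(r < k) (c r)%:R); first by rewrite ltr_pwDl// sumr_ge0.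
move=> n; rewrite {1}(divn_eq n k).
apply: (@le_trans _ _ ((c k)%:R ^+ (n %/ k) * (c (n %% k))%:R)).
  by rewrite -natrX -natrM ler_nat c_leM.
rewrite mulrC ler_pM ?exprn_ge0//.
  rewrite (bigD1 (Ordinal (ltn_pmod n k0)))//= addrCA lerDl addr_ge0//.
  by rewrite sumr_ge0.
apply: (le_trans (lerXn2r (n %/ k) _ _ ck)); rewrite ?nnegrE ?ler0n ?exprn_ge0 ?(ltW t0)//.
by rewrite -exprM mulnC ler_weXn2l// leq_divM.
Qed.

End Growth.

(** * Slots and flips *)

(** A pattern without letters of the nonempty word m can neither meet nor straddle m. As a flip
    exchanges one such m for another, patterns in other squares are unaffected. *)
Lemma infix_mid (T : eqType) (P m u v : seq T) :
  P != [::] -> m != [::] -> {in P, forall a, a \notin m} ->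
  infix P (u ++ m ++ v) = infix P u || infix P v.
Proof.
move=> P0 m0 Pm.
apply/infixP/orP => [[s [s' e]]|[/infixP[s [s' ->]]|/infixP[s [s' ->]]]]; last 2 first.
- by exists s, (s' ++ m ++ v); rewrite -!catA.
- by exists (u ++ m ++ s), s'; rewrite -!catA.
case: (cat_split e) => -[r [e1 e2]].
  case: (cat_split e2) => -[r2 [e3 e4]]; last first.
    by left; apply/infixP; exists s, r2; rewrite e1 e3.
  case: r2 e3 e4 => [|a r2] e3 e4.
    by left; apply/infixP; exists s, [::]; rewrite e1 e3 !cats0.
  case: m m0 Pm {e e2} e4 => // b m _ Pm [eb _].
  by have := Pm a; rewrite e3 eb mem_cat !mem_head orbT => /(_ isT).
case: (cat_split e2) => -[r2 [e3 e4]]; last first.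
  by right; apply/infixP; exists r2, s'; rewrite e4.
case: r2 e3 e4 => [|a r2] e3 e4.
  by right; apply/infixP; exists [::], s'; rewrite /= e4.
case: P P0 Pm {e e2} e4 => // b P _ Pm [eb _].
by have := Pm b; rewrite e3 eb mem_cat !mem_head orbT => /(_ isT).
Qed.

Lemma count_pairs (T U : Type) (s : seq T) (g : T -> seq U) (P : T -> U -> bool) :
  count (fun o => P o.1 o.2) [seq (x, y) | x <- s, y <- g x] =
  (\sum_(x <- s) count (P x) (g x))%N.
Proof.
rewrite -sum1_count big_mkcond big_allpairs_dep; apply: eq_bigr => x _.
by rewrite -big_mkcond sum1_count.
Qed.

Section Slots.
Variable d : nat.
Notation pt := 'rV[int]_d.+2.
Notation e0 := (@e0 d).
Notation e1 := (@e1 d).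
Notation lev := (@lev d).
Notation lat := (@lat d).
Notation adj := (@adj d).
Implicit Types (x y z t a b : pt) (w p q u v : seq pt).

Lemma pt_ext x y : lev x = lev y -> lat x = lat y ->
  (forall j, j != i0 d -> j != i1 d -> x 0 j = y 0 j) -> x = y.
Proof.
move=> hl ht h; apply/rowP => j.
have [->|j0] := eqVneq j (i0 d); first exact: hl.
have [->|j1] := eqVneq j (i1 d); first exact: ht.
exact: h.
Qed.

(** In each plane spanned by level and latitude, every 2 x 2 square whose lower corner has even
    level and even latitude contains exactly one aligned point, in its upper row. The period 4 of
    the latitude alternates the side to which the square extends. Squares of both handedness thus
    occur, and a cycle run in either direction can traverse some of them in the right sense. *)
Definition aligned z : bool :=
  ((lev z %% 2)%Z == 1) && (((lat z %% 4)%Z == 1) || ((lat z %% 4)%Z == 2)).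

Definition bump z : pt := if (lat z %% 4)%Z == 1 then - e1 else e1.
Definition s1 z := z + bump z.
Definition s2 z := z + bump z - e0.
Definition s3 z := z - e0.

Definition square z := [:: z; s1 z; s2 z; s3 z].

(** The two states between which a flip switches: a downward step whose detour is free, and the
    detour itself. *)
Definition slot1 w z :=
  [&& aligned z, infix [:: z; s3 z] w, s1 z \notin w & s2 z \notin w].
Definition slot2 w z := aligned z && infix (square z) w.

Lemma lev_bump z : lev (bump z) = 0.
Proof. by rewrite /bump; case: ifP; rewrite ?levlatE ?oppr0. Qed.
Lemma lat_bump z : lat (bump z) = if (lat z %% 4)%Z == 1 then - 1 else 1.
Proof. by rewrite /bump; case: ifP; rewrite ?levlatE. Qed.
Lemma bump_other z j : j != i1 d -> bump z 0 j = 0.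
Proof. by move=> j1; rewrite /bump; case: ifP; rewrite ?mxE (negPf j1) ?oppr0. Qed.

Lemma lev_s1 z : lev (s1 z) = lev z. Proof. by rewrite levlatE lev_bump addr0. Qed.
Lemma lev_s2 z : lev (s2 z) = lev z - 1. Proof. by rewrite !levlatE lev_bump addr0. Qed.
Lemma lev_s3 z : lev (s3 z) = lev z - 1. Proof. by rewrite !levlatE. Qed.
Lemma lat_s1 z : lat (s1 z) = lat z + lat (bump z). Proof. by rewrite levlatE. Qed.
Lemma lat_s2 z : lat (s2 z) = lat z + lat (bump z).
Proof. by rewrite !levlatE oppr0 addr0. Qed.
Lemma lat_s3 z : lat (s3 z) = lat z. Proof. by rewrite !levlatE oppr0 addr0. Qed.
Definition slotE := (lev_s1, lev_s2, lev_s3, lat_s1, lat_s2, lat_s3).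

(** The aligned corner is obtained from any point of its square by rounding, which makes the squares
    of distinct aligned points disjoint. *)
Lemma square_coord z a : aligned z -> a \in square z ->
  [/\ lev z = (lev a %/ 2)%Z * 2 + 1,
      lat z = (lat a %/ 2)%Z * 2 + (if (lat a %% 4)%Z < 2 then 1 else 0) &
      forall j, j != i0 d -> j != i1 d -> a 0 j = z 0 j].
Proof.
rewrite /aligned !inE => /andP[l0 l1].
have other (j : 'I_d.+2) : j != i0 d -> j != i1 d ->
    [/\ s1 z 0 j = z 0 j, s2 z 0 j = z 0 j & s3 z 0 j = z 0 j].
  move=> j0 j1; rewrite /s1 /s2 /s3 !mxE bump_other// (negPf j0) !andbF.
  by rewrite oppr0 !addr0.
case/or4P => /eqP ->; rewrite ?(slotE, lat_bump); split;
  try (by move=> j j0 j1; have [] := other j j0 j1); move: l0 l1;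
  move: (lev z) (lat z) => {other} l t; try lia; do ? case: ifP; lia.
Qed.

Lemma square_inj z z' a : aligned z -> aligned z' ->
  a \in square z -> a \in square z' -> z = z'.
Proof.
move=> az az' /(square_coord az)[h1 h2 h3] /(square_coord az')[h1' h2' h3'].
by apply: pt_ext => [||j j0 j1]; rewrite ?h1 ?h2 // -h3// h3'.
Qed.

Lemma square_uniq z : uniq (square z).
Proof.
have h (x y : pt) : lev x != lev y \/ lat x != lat y -> x != y.
  by case=> /eqP n; apply/eqP => exy; apply: n; rewrite exy.
rewrite /= !inE !negb_or !h //; rewrite ?(slotE, lat_bump);
 by [left; lia|right; case: ifP; lia].
Qed.

Lemma not_aligned_square z a : aligned z -> a \in square z -> a != z -> ~~ aligned a.
Proof.
by move=> az ha; apply: contraNN => aa; rewrite (square_inj az aa ha)// mem_head.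
Qed.

Lemma adj_s1 z : adj z (s1 z).
Proof.
rewrite /s1 /bump; case: ifP => _; last exact: adj_e1.
by rewrite adjC -{2}[z](subrK e1) adj_e1.
Qed.
Lemma adj_s3 z : adj z (s3 z).
Proof. by rewrite /s3 adjC -{2}[z](subrK e0) adj_e0. Qed.
Lemma adj_s12 z : adj (s1 z) (s2 z).
Proof. by rewrite /s2 -/(s1 z) -/(s3 (s1 z)) adj_s3. Qed.
Lemma adj_s23 z : adj (s2 z) (s3 z).
Proof. by rewrite /s2 /s3 adjD adjC adj_s1. Qed.

Definition wI u z v := u ++ [:: z; s3 z] ++ v.
Definition wII u z v := u ++ square z ++ v.

Lemma perm_wII u z v : perm_eq (wII u z v) [:: s1 z, s2 z & wI u z v].
Proof.
rewrite perm_sym -[[:: _, _ & _]]/([:: s1 z; s2 z] ++ wI u z v) /wI /wII.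
rewrite perm_catCA perm_cat2l catA perm_cat2r.
by apply/permP => P /=; lia.
Qed.

Lemma uniq_wII u z v :
  uniq (wII u z v) = [&& s1 z \notin wI u z v, s2 z \notin wI u z v & uniq (wI u z v)].
Proof.
rewrite (perm_uniq (perm_wII u z v)) /= inE negb_or.
have := square_uniq z; rewrite /= !inE !negb_or => /and4P[_ /andP[-> _] _ _].
by [].
Qed.

Lemma slot1E w z : uniq w -> slot1 w z ->
  exists u v, w = wI u z v /\ uniq (wII u z v).
Proof.
move=> un /and4P[az /infixP[u [v e]] h1 h2]; exists u, v.
by rewrite uniq_wII /wI -e h1 h2 un.
Qed.

Lemma slot2E w z : slot2 w z -> exists u v, w = wII u z v.
Proof. by case/andP => az /infixP[u [v e]]; exists u, v. Qed.

Section Flip.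
Variables (u v : seq pt) (z : pt).
Hypotheses (az : aligned z) (un : uniq (wII u z v)).

Lemma slot1_wI : slot1 (wI u z v) z.
Proof.
move: un; rewrite uniq_wII => /and3P[h1 h2 _]; rewrite /slot1 az h1 h2 !andbT.
by apply/infixP; exists u, v.
Qed.

Lemma slot2_wII : slot2 (wII u z v) z.
Proof. by rewrite /slot2 az; apply/infixP; exists u, v. Qed.

Lemma slot1_wII : slot1 (wII u z v) z = false.
Proof. by rewrite /slot1 /wII !mem_cat !inE !eqxx !orbT !andbF. Qed.

Lemma slot2_wI : slot2 (wI u z v) z = false.
Proof.
apply/negP => /slot2E[u' [v' e]]; move: un; rewrite uniq_wII => /and3P[+ _ _].
by rewrite e /wII !mem_cat !inE eqxx !orbT.
Qed.

(** Squares are disjoint, so that a flip neither creates nor destroys a slot elsewhere. *)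
Lemma slot_other z' : aligned z' -> z' != z ->
  (slot1 (wII u z v) z' = slot1 (wI u z v) z') *
  (slot2 (wII u z v) z' = slot2 (wI u z v) z').
Proof.
move=> az' zz'.
have dj a : a \in square z' -> a \notin square z.
  move=> ha; apply: contraNN zz' => ha'.
  by rewrite (square_inj az' az ha ha').
have dI a : a \in square z' -> a \notin [:: z; s3 z].
  by move/dj; apply: contraNN; rewrite !inE => /orP[] ->; rewrite ?orbT.
have dP a : a \in [:: z'; s3 z'] -> a \in square z'.
  by rewrite !inE => /orP[] ->; rewrite ?orbT.
have dm a : a \in square z' -> (a \in wII u z v) = (a \in wI u z v).
  by move=> ha; rewrite /wII /wI !mem_cat (negPf (dj a ha)) (negPf (dI a ha)).
split; rewrite /slot1 /slot2 /wII /wI.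
  rewrite !infix_mid//; last 2 first.
  - by move=> a /dP; apply: dI.
  - by move=> a /dP; apply: dj.
  by rewrite -/(wII u z v) -/(wI u z v) !dm// !inE eqxx ?orbT.
by rewrite !infix_mid.
Qed.

(** Of the four corners of a square only z is aligned. The two points that a flip adds are therefore
    never counted, and the counts differ at z alone. *)
Lemma count_flip (P Q : pred pt) :
  (forall z', aligned z' -> z' != z -> P z' = Q z') ->
  (forall z', P z' -> aligned z') -> (forall z', Q z' -> aligned z') ->
  (count P (wII u z v) + Q z = count Q (wI u z v) + P z)%N.
Proof.
move=> PQ Pa Qa.
have zu : z \notin u /\ z \notin v.
  move: un; rewrite /wII cat_uniq => /and3P[_ h]; rewrite cat_uniq => /and3P[_ h2 _].
  move/hasPn: h => /(_ z); rewrite mem_cat mem_head => /(_ isT) /= hu.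
  split=> //; apply/negP => hv; move/hasPn: h2 => /(_ z hv).
  by rewrite /= mem_head.
have hc s : z \notin s -> count P s = count Q s.
  move=> zs; apply: eq_in_count => a as_.
  have az' : a != z by apply: contraNneq zs => <-.
  have [aa|na] := boolP (aligned a); first exact: PQ.
  by apply/idP/idP => [/Pa|/Qa] h; rewrite h in na.
have hn (T : pred pt) : (forall z', T z' -> aligned z') ->
    (T (s1 z) = false) * (T (s2 z) = false) * (T (s3 z) = false).
  move=> Ta; have h a : a \in square z -> a != z -> T a = false.
    by move=> ha az'; apply/negP => /Ta; apply/negP/(not_aligned_square az).
  have := square_uniq z; rewrite /= !inE !negb_or => /and4P[/and3P[z1 z2 z3] _ _ _].
  by rewrite !h ?inE ?eqxx ?orbT// eq_sym.
rewrite /wII /wI !count_cat /= !hn// !hc ?(zu.1, zu.2)//.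
by case: zu => ? ?; lia.
Qed.

Definition nslot1 w := count (slot1 w) w.
Definition nslot2 w := count (slot2 w) w.

Lemma nslot1_flip : nslot1 (wI u z v) = (nslot1 (wII u z v)).+1.
Proof.
have := @count_flip (slot1 (wII u z v)) (slot1 (wI u z v)).
rewrite slot1_wI slot1_wII addn1 addn0 => ->//; first by move=> z' a n; rewrite slot_other.
all: by move=> z' /andP[].
Qed.

Lemma nslot2_flip : nslot2 (wII u z v) = (nslot2 (wI u z v)).+1.
Proof.
have := @count_flip (slot2 (wII u z v)) (slot2 (wI u z v)).
rewrite slot2_wI slot2_wII addn1 addn0 /nslot2 => ->//; first by move=> z' a n; rewrite slot_other.
all: by move=> z' /andP[].
Qed.

Lemma issaw_flip n x : issaw n.+2 x (wII u z v) = issaw n x (wI u z v).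
Proof.
rewrite /issaw un; move: un; rewrite uniq_wII => /and3P[_ _ ->].
rewrite /wII /wI !size_cat /= !addnS !eqSS; congr [&& _, _ & _ && _].
  by case: u.
by rewrite !sorted_cat_cons /= adj_s1 adj_s3 adj_s12 adj_s23.
Qed.

(** On a self-avoiding walk z has one position and the added corners can be erased by value, so that
    neither map needs to know the decomposition of the walk around the slot. *)
Definition up z w := take (index z w).+1 w ++ [:: s1 z; s2 z] ++ drop (index z w).+1 w.
Definition down z w := [seq y <- w | y \notin [:: s1 z; s2 z]].

Lemma up_wI : up z (wI u z v) = wII u z v.
Proof.
have zu : z \notin u.
  move: un; rewrite /wII cat_uniq => /and3P[_ /hasPn/(_ z) h _].
  by apply: h; rewrite mem_cat mem_head.
rewrite /up /wI index_cat (negPf zu) /= eqxx addn0 -cat1s catA.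
rewrite take_size_cat ?drop_size_cat ?size_cat ?addn1//.
by rewrite /wII -!catA.
Qed.

Lemma down_wII : down z (wII u z v) = wI u z v.
Proof.
have := un; rewrite uniq_wII => /and3P[h1 h2 _].
have fl s : {subset s <= wI u z v} -> down z s = s.
  move=> sw; apply/all_filterP/allP => y /sw ys; rewrite !inE negb_or.
  by apply/andP; split; [apply: contraNneq h1|apply: contraNneq h2] => <-.
rewrite /down /wII !filter_cat -/(down z u) -/(down z v) !fl.
- rewrite /wI /= !inE !eqxx ?orbT /=.
  have := square_uniq z; rewrite /= !inE !negb_or => /and4P[].
  move=> /and3P[/negPf -> /negPf -> _] /andP[_ +] + _.
  by rewrite !(eq_sym (s3 z)) => /negPf -> /negPf ->.
- by move=> y; rewrite /wI !mem_cat => ->; rewrite ?orbT.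
- by move=> y; rewrite /wI !mem_cat => ->; rewrite ?orbT.
Qed.
End Flip.

(** * Double counting of flips *)

Section Flow.
Variable W : pred (seq pt).
Hypothesis W_flip : forall u z v, aligned z -> uniq (wII u z v) ->
  sorted adj (wI u z v) -> W (wII u z v) = W (wI u z v).

(** A flip keeps T and moves j by one: for fixed T the shells form a chain along which the ratios of
    consecutive sizes are explicit. *)
Definition shell T j w := [&& W w, (nslot1 w + nslot2 w == T)%N & nslot2 w == j].
Definition nshell n T j := count (shell T j) (saws n 0).

Lemma sum_shell n T j (g : seq pt -> nat) k :
  (forall w, shell T j w -> g w = k) ->
  (\sum_(w <- saws n (0 : pt)) (if shell T j w then g w else 0) = k * nshell n T j)%N.
Proof.
move=> gk; rewrite -big_mkcond /= (eq_bigr (fun=> k))//.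
by rewrite big_const_seq iter_addn_0.
Qed.

Lemma shell_flip u z v T j : aligned z -> uniq (wII u z v) -> sorted adj (wI u z v) ->
  shell T j.+1 (wII u z v) = shell T j (wI u z v).
Proof.
move=> az un so; rewrite /shell W_flip// nslot1_flip// nslot2_flip// addnS addSn.
by rewrite eqSS.
Qed.

(** Both sides count pairs of a walk and a slot to be flipped: [T - j] slots of the first type
    before the flip, [j.+1] of the second type after it. *)
Lemma nshell_flip n T j : ((T - j) * nshell n T j = j.+1 * nshell n.+2 T j.+1)%N.
Proof.
rewrite -(@sum_shell n T j nslot1) => [|w /and3P[_ /eqP <- /eqP <-]]; last first.
  by rewrite addnK.
rewrite -(@sum_shell n.+2 T j.+1 nslot2) => [|w /and3P[_ _ /eqP]] //.
pose P1 w z := shell T j w && slot1 w z.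
pose P2 w z := shell T j.+1 w && slot2 w z.
have e (m : nat) (S : pred (seq pt)) (Q : seq pt -> pred pt) :
   (\sum_(w <- saws m (0 : pt)) (if S w then count (Q w) w else 0))%N =
   count (fun o => S o.1 && Q o.1 o.2) [seq (w, z) | w <- saws m (0 : pt), z <- w].
  rewrite (count_pairs _ _ (fun w z => S w && Q w z)); apply: eq_bigr => w _.
  by case: (S w); rewrite ?count_pred0.
rewrite (e n (shell T j) slot1) (e n.+2 (shell T j.+1) slot2) {e}.
have unp m : uniq [seq (w, z) | w <- saws m (0 : pt), z <- w].
  apply: allpairs_uniq_dep; first exact: saws_uniq.
  - by move=> w; rewrite mem_saws => /and4P[].
  - by move=> [w z] [w' z'] _ _ /= [-> ->].
have in1 m w z : ((w, z) \in [seq (w, z) | w <- saws m (0 : pt), z <- w]) =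
    issaw m 0 w && (z \in w).
  apply/allpairsPdep/andP => [[w' [z' [+ h [-> ->]]]]|[h1 h2]].
    by rewrite mem_saws.
  by exists w, z; rewrite mem_saws.
have mid (u s v : seq pt) (z : pt) : z \in s -> z \in u ++ s ++ v.
  by rewrite !mem_cat => ->; rewrite orbT.
apply/eqP; rewrite eqn_leq; apply/andP; split.
  apply: (ler_count_inj (f := fun o => (up o.2 o.1, o.2))) => //.
  - move=> [w z] [w' z']; rewrite !inE /= !in1.
    move=> /andP[/andP[sw _] /andP[_ z1]] /andP[/andP[sw' _] /andP[_ z1']] [].
    have [u [v [ew un]]] := slot1E (proj2 (andP (proj2 (andP (proj2 (andP sw))))) ) z1.
    have [u' [v' [ew' un']]] := slot1E (proj2 (andP (proj2 (andP (proj2 (andP sw'))))) ) z1'.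
    rewrite ew ew' !up_wI// => h zz; rewrite -zz in h un' *.
    by rewrite -(down_wII un) h down_wII.
  - move=> [w z]; rewrite !in1 /= => /andP[sw zw] /andP[sh z1].
    have /and4P[_ _ so un0] := sw.
    have [u [v [ew un]]] := slot1E un0 z1; have /andP[az _] := z1.
    rewrite ew in sw sh so *; rewrite up_wI// issaw_flip// sw shell_flip// sh slot2_wII// !andbT.
    by apply: mid; rewrite mem_head.
apply: (ler_count_inj (f := fun o => (down o.2 o.1, o.2))) => //.
- move=> [w z] [w' z']; rewrite !inE /= !in1.
  move=> /andP[/andP[/and4P[_ _ _ un] _] /andP[_ z1]].
  move=> /andP[/andP[/and4P[_ _ _ un'] _] /andP[_ z1']] [].
  have [u [v ew]] := slot2E z1; have [u' [v' ew']] := slot2E z1'.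
  rewrite ew ew' in un un' *.
  rewrite !down_wII// => h zz; rewrite -zz in h un' *.
  by rewrite -(up_wI un) h up_wI.
- move=> [w z]; rewrite !in1 /= => /andP[sw zw] /andP[sh z1].
  have /and4P[_ _ so un] := sw.
  have [u [v ew]] := slot2E z1; have /andP[az _] := z1.
  rewrite ew in sw sh un *; rewrite issaw_flip// in sw; have /and4P[_ _ so' _] := sw.
  rewrite down_wII// sw -shell_flip// sh slot1_wI// !andbT.
  by apply: mid; rewrite mem_head.
Qed.
End Flow.
End Slots.

(** * Paths inside a cell *)

(** A Hamiltonian cycle of the 4 x 8 grid: two distinct vertices cut it into two
    arcs, and one of the arcs, run from the first vertex to the second, contains
    a slot of the second type. *)
Definition grid_cycle : seq (nat * nat) :=
  [:: (0,0);(1,0);(1,1);(2,1);(2,0);(3,0);(3,1);(3,2);(3,3);(3,4);(3,5);(3,6);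
      (3,7);(2,7);(2,6);(1,6);(1,7);(0,7);(0,6);(0,5);(0,4);(1,4);(1,5);(2,5);
      (2,4);(2,3);(2,2);(1,2);(1,3);(0,3);(0,2);(0,1)]%N.

Definition grid : seq (nat * nat) := [seq (a, b) | a <- iota 0 4, b <- iota 0 8].

Definition grid_adj (p q : nat * nat) : bool :=
  ((p.1 - q.1) + (q.1 - p.1) + ((p.2 - q.2) + (q.2 - p.2)) == 1)%N.

Definition grid_aligned (z : nat * nat) : bool :=
  (z.1 %% 2 == 1)%N && ((z.2 %% 4 == 1)%N || (z.2 %% 4 == 2)%N).

Definition grid_square (z : nat * nat) : seq (nat * nat) :=
  let b := (if z.2 %% 4 == 1 then z.2.-1 else z.2.+1)%N in
  [:: z; (z.1, b); (z.1.-1, b); (z.1.-1, z.2)].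

Definition arc (s : seq (nat * nat)) p q :=
  let r := rot (index p s) s in take (index q r).+1 r.

Definition good_arc p q (s : seq (nat * nat)) : bool :=
  [&& head q s == p, last p s == q, sorted grid_adj s, uniq s,
      all (mem grid) s & has (fun z => grid_aligned z && infix (grid_square z) s) s].

Lemma grid_cycle_arcs :
  all (fun p => all (fun q => [|| p == q, good_arc p q (arc grid_cycle p q) |
    good_arc p q (arc (rev grid_cycle) p q)]) grid) grid.
Proof. by vm_compute. Qed.

Lemma grid_path p q : p \in grid -> q \in grid -> p != q ->
  exists s, good_arc p q s.
Proof.
move=> pg qg pq; have /allP/(_ p pg)/allP/(_ q qg) := grid_cycle_arcs.
by rewrite (negPf pq) /= => /orP[] ?; eexists; eassumption.
Qed.

Section Cells.
Variable d : nat.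
Notation pt := 'rV[int]_d.+2.
Notation e0 := (@e0 d).
Notation e1 := (@e1 d).
Notation lev := (@lev d).
Notation lat := (@lat d).
Notation adj := (@adj d).
Implicit Types (x y z t : pt) (w u v : seq pt) (p q : nat * nat).

(** The first two coordinates of a cell form the grid of [grid_cycle]. The sides are multiples of
    the periods 2 and 4 of the aligned points, so that no square crosses the border of a cell. *)
Definition side (j : 'I_d.+2) : int := if j == i0 d then 4 else 8.
Definition cell x : pt := \row_j divz (x 0 j) (side j).

Lemma cellP x y : cell x = cell y <-> forall j, divz (x 0 j) (side j) = divz (y 0 j) (side j).
Proof.
split=> [/rowP h j|h]; last by apply/rowP => j; rewrite !mxE.
by have := h j; rewrite !mxE.
Qed.

Lemma size_cell k w : uniq w -> {in w, forall x, cell x = k} -> (size w <= 8 ^ d.+2)%N.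
Proof.
move=> un wk.
pose f x : {ffun 'I_d.+2 -> 'I_8} := [ffun j => inord (absz (modz (x 0 j) (side j)))].
have fi : {in w &, injective f}.
  move=> x y xw yw /ffunP fxy; apply/rowP => j.
  have /cellP/(_ j) : cell x = cell y by rewrite !wk.
  have := fxy j; rewrite !ffunE => /(congr1 val).
  by rewrite /= !inordK /side; case: ifP => _; lia.
have un' : uniq [seq f x | x <- w] by rewrite map_inj_in_uniq.
rewrite -(size_map f) -(card_uniqP un') (leq_trans (max_card _))//.
by rewrite card_ffun !card_ord.
Qed.

Definition has_slot w := has (slot2 w) w.

Lemma slot2_cat u w v z : slot2 w z -> slot2 (u ++ w ++ v) z.
Proof. by rewrite /slot2 => /andP[-> /= ?]; rewrite infix_catl ?infix_catr. Qed.

Lemma slot2_mem w z : slot2 w z -> z \in w.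
Proof. by case/andP=> _ /infixP[s [s' ->]]; rewrite !mem_cat mem_head orbT. Qed.

Lemma has_slotP w z : slot2 w z -> has_slot w.
Proof. by move=> zs; apply/hasP; exists z => //; apply: slot2_mem. Qed.

Lemma has_slot_cat u w v : has_slot w -> has_slot (u ++ w ++ v).
Proof.
by case/hasP => z zw zs; apply/hasP; exists z; rewrite ?mem_cat ?zw ?orbT// slot2_cat.
Qed.

Lemma square_cell z a : aligned z -> a \in square z -> cell a = cell z.
Proof.
move=> az ha; have [h1 h2 h3] := square_coord az ha; move: az.
rewrite /aligned => /andP[l0 l1]; apply/cellP => j.
have [->|j0] := eqVneq j (i0 d).
  by move: h1 l0; rewrite /side eqxx -!/(lev _); move: (lev a) (lev z) => la lz; lia.
have [->|j1] := eqVneq j (i1 d).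
  rewrite /side i01 -!/(lat _); move: h2 l1; move: (lat a) (lat z) => la lz.
  by case: ifP; lia.
by rewrite h3.
Qed.

(** The planar section through x of the cell of x is a copy of [grid], parametrised by [emb x];
    [res x] is the position of x in it. *)
Definition emb x p : pt := \row_j (if j == i0 d then (lev x %/ 4)%Z * 4 + p.1%:Z else
  if j == i1 d then (lat x %/ 8)%Z * 8 + p.2%:Z else x 0 j).
Definition res x : nat * nat := (`|(lev x %% 4)%Z|%N, `|(lat x %% 8)%Z|%N).

Lemma lev_emb x p : lev (emb x p) = (lev x %/ 4)%Z * 4 + p.1%:Z.
Proof. by rewrite {1}/lev mxE eqxx. Qed.
Lemma lat_emb x p : lat (emb x p) = (lat x %/ 8)%Z * 8 + p.2%:Z.
Proof. by rewrite {1}/lat mxE i01 eqxx. Qed.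
Lemma emb_other x p j : j != i0 d -> j != i1 d -> emb x p 0 j = x 0 j.
Proof. by move=> /negPf j0 /negPf j1; rewrite mxE j0 j1. Qed.

Lemma mem_grid p : (p \in grid) = (p.1 < 4)%N && (p.2 < 8)%N.
Proof.
case: p => a b; apply/allpairsP/andP => [[[a' b']]|[ha hb]].
  by rewrite !mem_iota => -[/= ha hb [-> ->]].
by exists (a, b); rewrite !mem_iota.
Qed.

Lemma res_grid x : res x \in grid.
Proof. by rewrite mem_grid /res /=; lia. Qed.

Lemma emb_res x : emb x (res x) = x.
Proof.
apply: pt_ext => [||j j0 j1]; rewrite ?emb_other// ?lev_emb ?lat_emb /res /=; lia.
Qed.

Lemma emb_inj x : injective (emb x).
Proof.
move=> [a b] [a' b'] h.
have := congr1 lev h; have := congr1 lat h; rewrite !lev_emb !lat_emb /= => h1 h2.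
by congr pair; lia.
Qed.

Lemma cell_emb x p : p \in grid -> cell (emb x p) = cell x.
Proof.
rewrite mem_grid => /andP[h1 h2]; apply/cellP => j.
have [->|j0] := eqVneq j (i0 d).
  by rewrite /side eqxx -!/(lev _) lev_emb; lia.
have [->|j1] := eqVneq j (i1 d).
  by rewrite /side i01 -!/(lat _) lat_emb; lia.
by rewrite emb_other.
Qed.

Lemma adj_sum x y : adj x y = (`|lev x - lev y| + (`|lat x - lat y| +
  \sum_(j | (j != i0 d) && (j != i1 d)) `|x 0 j - y 0 j|) == 1).
Proof. by rewrite /adj (bigD1 (i0 d))//= (bigD1 (i1 d)). Qed.

Lemma adj_emb x p q : adj (emb x p) (emb x q) = grid_adj p q.
Proof.
rewrite adj_sum big1 => [|j /andP[j0 j1]]; last by rewrite !emb_other// subrr normr0.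
by rewrite !lev_emb !lat_emb /grid_adj; lia.
Qed.

Lemma aligned_emb x p : aligned (emb x p) = grid_aligned p.
Proof. by rewrite /aligned /grid_aligned lev_emb lat_emb; lia. Qed.

Lemma square_emb x p : grid_aligned p -> square (emb x p) = map (emb x) (grid_square p).
Proof.
move=> ap; have h y y' : lev y = lev y' -> lat y = lat y' ->
    (forall j, j != i0 d -> j != i1 d -> y 0 j = y' 0 j) -> y = y' by exact: pt_ext.
case: p ap => a b; rewrite /grid_aligned /square /grid_square /= => ap.
congr [:: _; _; _; _]; apply: h => [||j j0 j1].
all: rewrite ?(slotE, lev_emb, lat_emb, lat_bump).
all: rewrite /=.
all: try lia.
all: try by do 2 case: ifP; lia.
all: rewrite /s1 /s2 /s3 ?(emb_other, mxE, bump_other)//.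
all: by rewrite ?(negPf j0) ?(negPf j1) ?andbF ?oppr0 ?addr0.
Qed.

(** Each step lowers the l1 distance to y, whence self-avoidance, and moves one coordinate towards
    that of y, which cannot leave the cell. *)
Lemma cell_geodesic x y : lev x = lev y -> lat x = lat y -> cell x = cell y ->
  exists s, [/\ path adj x s, last x s = y, uniq (x :: s) &
    {in s, forall z, [/\ lev z = lev y, lat z = lat y & cell z = cell y]}].
Proof.
pose dist x : nat := (\sum_j absz (x 0%R j - y 0%R j)%R)%N.
suff h : forall N x, dist x = N -> lev x = lev y -> lat x = lat y -> cell x = cell y ->
  exists s, [/\ path adj x s, last x s = y, {in s, forall z, (dist z < N)%N}, uniq s &
    {in s, forall z, [/\ lev z = lev y, lat z = lat y & cell z = cell y]}].
  move=> hl ht hc; have [s [ps ls ds us cs]] := h _ x erefl hl ht hc.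
  by exists s; split=> //=; rewrite us andbT; apply/negP => /ds; rewrite ltnn.
elim=> [|N IH] {}x dN hl ht hc.
  exists [::]; split=> //=; apply/rowP => j; apply/eqP; rewrite -subr_eq0 -absz_eq0.
  by move/eqP: dN; rewrite sum_nat_eq0 => /forallP/(_ j).
have [j xj] : exists j, x 0 j != y 0 j.
  apply/existsP; apply/contraT; rewrite negb_exists => /forallP xy.
  move: dN; rewrite /dist big1// => j _; move: (xy j); rewrite negbK => /eqP ->.
  by rewrite subrr.
have j0 : j != i0 d by apply: contraNneq xj => ->; rewrite -!/(lev _) hl.
have j1 : j != i1 d by apply: contraNneq xj => ->; rewrite -!/(lat _) ht.
pose x' : pt := \row_l (if l == j then (if x 0 j < y 0 j then x 0 j + 1 else x 0 j - 1)
                        else x 0 l).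
have x'l l : l != j -> x' 0 l = x 0 l by move=> lj; rewrite mxE (negPf lj).
have x'j : x' 0 j = if x 0 j < y 0 j then x 0 j + 1 else x 0 j - 1.
  by rewrite mxE eqxx.
have dx : dist x = (dist x').+1.
  rewrite /dist (bigD1 j)//= [in RHS](bigD1 j)//= -addSn x'j; congr addn.
    by move: xj; move: (x 0 j) (y 0 j) => a b; case: ltP; lia.
  by apply: eq_bigr => l lj; rewrite x'l.
have dN' : dist x' = N by move: dN; rewrite dx => -[].
have hl' : lev x' = lev y by rewrite /lev x'l// eq_sym.
have ht' : lat x' = lat y by rewrite /lat x'l// eq_sym.
have hc' : cell x' = cell y.
  apply/cellP => l; have := proj1 (cellP _ _) hc l.
  have [->|lj] := eqVneq l j; last by rewrite x'l.
  rewrite x'j; move: xj; move: (x 0 j) (y 0 j) => a b.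
  by rewrite /side; case: (j == _); case: ltP; lia.
have [s [ps ls ds us cs]] := IH _ dN' hl' ht' hc'.
exists (x' :: s); split=> //=.
- rewrite ps andbT /adj (bigD1 j)//= big1 ?addr0 => [|l lj].
    by rewrite x'j; move: (x 0 j) (y 0 j) => a b; case: ltP; lia.
  by rewrite x'l// subrr normr0.
- by move=> z; rewrite inE => /orP[/eqP ->|/ds]; [rewrite dN'|move/ltnW].
- by rewrite us andbT; apply/negP => /ds; rewrite dN' ltnn.
- by move=> z; rewrite inE => /orP[/eqP ->|/cs].
Qed.

Lemma res_emb x p : p \in grid -> res (emb x p) = p.
Proof.
rewrite mem_grid /res lev_emb lat_emb => /andP[h1 h2].
by case: p h1 h2 => a b /= h1 h2; congr pair; lia.
Qed.

(** An arc of the grid cycle in the plane of x is followed by a geodesic to the plane of y. All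
    points of the geodesic have grid position r, which the arc takes only at its end, so that the
    two are disjoint. *)
Lemma cell_path x y : x != y -> cell x = cell y ->
  exists s, [/\ path adj x s, last x s = y, uniq (x :: s),
    {in x :: s, forall z, cell z = cell x} & has_slot (x :: s)].
Proof.
move=> xy cxy.
(* Normally r is the position of y. If x and y have the same position, no arc joins it to itself: r
   is then a neighbouring position, and one more step in the plane of y reaches y. *)
have [r [rg rx ry]] : exists r, [/\ r \in grid, res x != r &
    (r == res y) || grid_adj r (res y) && (res x == res y)].
  have [rxy|] := eqVneq (res x) (res y); last first.
    by exists (res y); rewrite res_grid eqxx.
  have := res_grid y; rewrite rxy mem_grid; case: (res y) => a b /= /andP[ha hb].
  exists (if a == 0%N then (1%N, b) else (a.-1, b)).
  rewrite mem_grid /grid_adj andbT; case: (eqVneq a 0%N) => [->|a0] /=.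
    by split=> //; rewrite subnn.
  split; rewrite ?hb ?andbT; first by lia.
    by apply/eqP => -[]; lia.
  by apply/orP; right; lia.
have [[|p s]] := grid_path (res_grid x) rg rx; first by rewrite /good_arc /= !andbF.
case/and5P => /= /eqP -> /eqP ls ps /andP[us us'] /andP[/andP[_ sg] hs].
have hl : lev (emb x r) = lev (emb y r).
  by rewrite !lev_emb; have := proj1 (cellP _ _) cxy (i0 d); rewrite /side eqxx => ->.
have ht : lat (emb x r) = lat (emb y r).
  by rewrite !lat_emb; have := proj1 (cellP _ _) cxy (i1 d); rewrite /side i01 => ->.
have hc : cell (emb x r) = cell (emb y r) by rewrite !cell_emb.
have [g [pg lg ug cg]] := cell_geodesic hl ht hc.
pose A := map (emb x) s; pose t := if r == res y then [::] else [:: y].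
have lA : last x A = emb x r by rewrite -{1}[x]emb_res last_map ls.
have pA : path adj x A.
  rewrite -[x]emb_res path_map; apply: sub_path ps => u v /=.
  by rewrite adj_emb.
have EA a : a \in x :: A -> exists2 p', p' \in res x :: s & a = emb x p'.
  by move=> aA; apply/mapP; rewrite /= emb_res.
have gl a : a \in g -> res a = r.
  move=> /cg[h1 h2 h3]; rewrite -(res_emb y rg) /res h1 h2.
  by [].
have Ag a : a \in x :: A -> a \notin g.
  move=> /EA[p' p's ->]; apply/negP => pg'.
  have p'g : p' \in grid.
    by move: p's; rewrite inE => /orP[/eqP ->|/(allP sg)//]; rewrite res_grid.
  have := gl _ pg'; rewrite res_emb// => p'r.
  by move: ug pg'; rewrite p'r /= => /andP[/negPf ->].
have un0 : uniq (x :: A).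
  have -> : x :: A = map (emb x) (res x :: s) by rewrite /= emb_res.
  by rewrite map_inj_uniq; [rewrite /= us us'|apply: emb_inj].
have tP : r != res y -> y \notin x :: A ++ g.
  move=> ry'; move: ry; rewrite (negPf ry') /= => /andP[_ /eqP rxy].
  rewrite -cat_cons mem_cat negb_or; apply/andP; split; last first.
    by apply/negP => /gl /eqP; rewrite eq_sym (negPf ry').
  apply/negP => /EA[p' p's yp].
  have p'g : p' \in grid.
    by move: p's; rewrite inE => /orP[/eqP ->|/(allP sg)//]; rewrite res_grid.
  by move: xy; rewrite {1}yp -{1}[x]emb_res rxy yp res_emb// eqxx.
exists (A ++ g ++ t); split.
- rewrite !cat_path pA lA pg lg /= /t; case: ifP => [//|ry'] /=; rewrite andbT.
  move: ry; rewrite ry' /= => /andP[ra _].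
  by rewrite -{2}[y]emb_res adj_emb.
- rewrite !last_cat lA lg /t; case: ifP => [/eqP ->|//] /=.
  by rewrite emb_res.
- suff : uniq ((x :: A) ++ g ++ t) by [].
  rewrite catA cat_uniq; apply/and3P; split.
  + rewrite cat_uniq un0; move: ug => /= /andP[_ ->]; rewrite andbT /=.
    by apply/hasPn => a ag; apply: contraL ag => /Ag.
  + rewrite /t; case: eqVneq => //= ry'; rewrite orbF.
    exact: tP.
  + by rewrite /t; case: ifP.
- move=> a; rewrite -cat_cons !mem_cat => /or3P[/EA[p' p's ->]|/cg[_ _ ->]|].
  + rewrite cell_emb//.
    by move: p's; rewrite inE => /orP[/eqP ->|/(allP sg)//]; rewrite res_grid.
  + by rewrite cell_emb// cxy.
  + by rewrite /t; case: ifP => // _; rewrite inE => /eqP ->.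
- rewrite -[x :: _]/([::] ++ (x :: A) ++ g ++ t); apply: has_slot_cat.
  have -> : x :: A = map (emb x) (res x :: s) by rewrite /= emb_res.
  have [z zs /andP[za zi]] : exists2 z, z \in res x :: s &
      grid_aligned z && infix (grid_square z) (res x :: s) by apply/hasP.
  apply/hasP; exists (emb x z); first exact: map_f.
  rewrite /slot2 aligned_emb za square_emb//.
  case/infixP: zi => a [b ->]; rewrite !map_cat.
  by apply/infixP; exists (map (emb x) a), (map (emb x) b).
Qed.

End Cells.

(** * Surgery *)

Lemma split_has (T : eqType) (a : pred T) (s : seq T) : has a s ->
  exists s1 s2 y, [/\ s = s1 ++ y :: s2, a y & ~~ has a s1].
Proof.
elim: s => //= z s IH; have [az _|naz /IH[s1 [s2 [y [-> ay h]]]]] := boolP (a z).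
  by exists [::], s, z.
by exists (z :: s1), s2, y; rewrite /= (negPf naz).
Qed.


Lemma split_span (T : eqType) (a : pred T) (s : seq T) : has a s ->
  exists al p be ga, [/\ s = al ++ (p :: be) ++ ga, a p, a (last p be),
    ~~ has a al & ~~ has a ga].
Proof.
move=> /split_has[al [s2 [p [-> ap nal]]]].
have : has a (rev (p :: s2)) by rewrite has_rev /= ap.
move=> /split_has[r1 [r2 [q [e aq nr1]]]].
have e' : p :: s2 = rcons (rev r2) q ++ rev r1.
  by rewrite -[p :: s2]revK e rev_cat_cons cat_rcons.
case e2 : (rcons (rev r2) q) e' => [|p' be] e'; first by move: e2; case: rev.
move: e' => [pp es2]; exists al, p, be, (rev r1).
have lq : last p be = q by rewrite -[LHS]/(last p (p :: be)) pp -e2 last_rcons.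
by rewrite es2 lq has_rev.
Qed.

Lemma clear_bit (b : bitseq) i : nth false b i ->
  let b' := set_nth false b i false in
  [/\ (i < size b)%N, size b' = size b, count id b = (count id b').+1 &
      b = set_nth false b' i true].
Proof.
elim: b i => [|c b IH] [|i] //=; first by case: c.
by move=> /IH /= [h1 h2 h3 h4]; split; rewrite ?h2 ?h3 ?addnS// -h4.
Qed.

Section Surgery.
Variable d : nat.
Notation pt := 'rV[int]_d.+2.
Notation adj := (@adj d).
Implicit Types (x y z t : pt) (w u v al be ga : seq pt) (b : bitseq).

Definition fix_path x y : seq pt :=
  xget [::] [set s | [/\ path adj x s, last x s = y, uniq (x :: s),
    {in x :: s, forall z, cell z = cell x} & has_slot (x :: s)]]%classic.

Lemma fix_pathP x y (s := fix_path x y) : x != y -> cell x = cell y ->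
  [/\ path adj x s, last x s = y, uniq (x :: s),
    {in x :: s, forall z, cell z = cell x} & has_slot (x :: s)].
Proof.
move=> xy cxy; rewrite /s /fix_path; case: xgetP => [_ -> //|h].
by have [t ht] := cell_path xy cxy; have := h t; rewrite /= => /(_ ht).
Qed.

Definition patch be : seq pt := head 0 be :: fix_path (head 0 be) (last 0 be).
Definition key be : pt := cell (head 0 be).

Definition spanning be :=
  [/\ be != [::], head 0 be != last 0 be & cell (head 0 be) = cell (last 0 be)].

Lemma patchP be : spanning be ->
  [/\ head 0 (patch be) = head 0 be, last 0 (patch be) = last 0 be, uniq (patch be),
      sorted adj (patch be) & {in patch be, forall z, cell z = key be}] /\
  has_slot (patch be).
Proof.
by case=> _ h1 h2; have [] := fix_pathP h1 h2.
Qed.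

Lemma sorted_patch al be be' ga : be != [::] -> be' != [::] ->
  head 0 be' = head 0 be -> last 0 be' = last 0 be ->
  sorted adj (al ++ be ++ ga) -> sorted adj be' -> sorted adj (al ++ be' ++ ga).
Proof.
case: be be' => [|p be] [|p' be'] // _ _ /= -> l1.
rewrite !sorted_cat_cons !cat_path l1 => /andP[-> /andP[_ ->]] ->.
by [].
Qed.

(** Since [be] carries all visits to its cell, the cell is empty once [be] is removed and any path
    inside it fits. A square lies in one cell, so that slots elsewhere were there before. *)
Lemma toggle al be ga :
  spanning be -> sorted adj (al ++ be ++ ga) -> uniq (al ++ be ++ ga) ->
  {in al ++ be ++ ga, forall y, cell y = key be -> y \in be} ->
  [/\ sorted adj (al ++ patch be ++ ga), uniq (al ++ patch be ++ ga),
      {in al ++ ga, forall y, cell y != key be} &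
      forall z, slot2 (al ++ patch be ++ ga) z -> cell z = key be \/
        slot2 (al ++ be ++ ga) z].
Proof.
move=> sp so un ky; have [[h1 h2 h3 h4 h5] h6] := patchP sp.
have [be0 _ _] := sp.
have av : {in al ++ ga, forall y, cell y != key be}.
  move=> y yag; apply/negP => /eqP cy.
  have yb : y \in be.
    by apply: ky => //; move: yag; rewrite !mem_cat => /orP[] ->; rewrite ?orbT.
  move: un; rewrite uniq_catCA.
  by rewrite cat_uniq => /and3P[_ /hasPn/(_ y yag)]; rewrite /= yb.
split=> //.
- by apply: sorted_patch so _.
- rewrite uniq_catCA cat_uniq h3 /=.
  move: un; rewrite uniq_catCA.
  rewrite cat_uniq => /and3P[_ _ ->]; rewrite andbT.
  by apply/hasPn => y /av; apply: contraNN => /= /h5 ->.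
- move=> z /andP[az zi]; have [->|cz] := eqVneq (cell z) (key be); first by left.
  right; rewrite /slot2 az /=; move: zi; rewrite infix_mid//.
    by move=> /orP[] zi; rewrite ?(infix_catr _ zi) ?infix_catl ?zi// infix_catl// infix_catl.
  by move=> a /(square_cell az) ca; apply: contraNN cz => /h5 <-; rewrite ca.
Qed.

(** Bit i tells whether segment i is patched. Missing bits count as unset, so that [[::]] gives back
    the original walk. *)
Fixpoint weave (ds : seq (seq pt * seq pt)) b T : seq pt :=
  if ds is (A, be) :: ds' then
    A ++ (if head false b then patch be else be) ++ weave ds' (behead b) T
  else T.

Lemma weave_at ds b T i : (i < size ds)%N ->
  exists al ga, forall c, weave ds (set_nth false b i c) T =
    al ++ (let be := (nth ([::], [::]) ds i).2 in if c then patch be else be) ++ ga.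
Proof.
elim: ds b i => [|[A be] ds IH] b [|i] //= il.
  exists A, (weave ds (behead b) T) => c.
  by case: b => [|b0 b] /=; rewrite ?set_nth_nil //; case: ds {IH il} => [|[? ?] ?].
have [al [ga h]] := IH (behead b) i il.
exists (A ++ (if head false b then patch be else be) ++ al), ga => c.
rewrite -!catA -h; congr (_ ++ _).
by case: b {h} => [|b0 b] //=; rewrite set_nth_nil.
Qed.

Lemma weave_nil ds b T : ~~ has id b -> weave ds b T = weave ds [::] T.
Proof.
elim: ds b => [|[A be] ds IH] [|[] b] //= hb.
by rewrite IH.
Qed.

(** What makes the surgeries independent of one another: every segment owns its cell, and the cells
    are different. *)
Definition tight (W : seq pt) (ds : seq (seq pt * seq pt)) M :=
  [/\ {in ds, forall e, [/\ spanning e.2, (size e.2 <= M)%N &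
         {in W, forall y, cell y = key e.2 -> y \in e.2}]} &
      uniq [seq key e.2 | e <- ds]].

Section Weave.
Variables (P T : seq pt) (ds : seq (seq pt * seq pt)) (M : nat).
Let V b := P ++ weave ds b T.
Hypotheses (so : sorted adj (V [::])) (un : uniq (V [::])) (ti : tight (V [::]) ds M).
Hypothesis ns : ~~ has_slot (V [::]).

Let seg b i := let be := (nth ([::], [::]) ds i).2 in
  if nth false b i then patch be else be.
Let ky i := key (nth ([::], [::]) ds i).2.

Let ky_inj i j : (i < size ds)%N -> (j < size ds)%N -> ky i = ky j -> i = j.
Proof.
move=> il jl; case: ti => _ uk e.
apply/eqP; rewrite -(nth_uniq 0 _ _ uk) ?size_map//.
rewrite !(nth_map ([::], [::]))//; exact/eqP.
Qed.

(** The bits are set one at a time with [toggle]. The invariant carried along is that each cell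
    still belongs to its segment, patched or not, and that slots occur in patched cells only. *)
Lemma weave_inv b : (size b <= size ds)%N ->
  [/\ sorted adj (V b), uniq (V b),
      forall j, (j < size ds)%N -> {in V b, forall y, cell y = ky j -> y \in seg b j} &
      forall z, slot2 (V b) z -> exists2 j, (j < size ds)%N && nth false b j & cell z = ky j].
Proof.
move en : (count id b) => n; elim: n b en => [|n IH] b cb sb.
  have hb : ~~ has id b by rewrite has_count cb.
  have nb j : nth false b j = false.
    apply/negP => bj; move/negP: hb; apply; apply/hasP; exists (nth false b j) => //.
    by rewrite mem_nth// ltnNge; apply/negP => /(nth_default false) h; rewrite h in bj.
  rewrite /V weave_nil//; split=> //.
    move=> j jl y yV cy; rewrite /seg nb; case: ti => h _.
    by have [_ _] := h _ (mem_nth ([::], [::]) jl); apply.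
  by move=> z zs; case/negP: ns; apply: has_slotP zs.
have /hasP[c /(nthP false)[i ib bi] cT] : has id b by rewrite has_count cb.
rewrite {c}cT in bi.
have [_ sb' cb' bE] := clear_bit bi; set b' := set_nth _ _ _ _ in sb' cb' bE.
have il : (i < size ds)%N by exact: leq_trans sb.
rewrite cb in cb'; case: cb' => /esym cb'.
have [] := IH b' cb'; first by rewrite sb'.
have [al [ga h]] := weave_at b' T il.
have hb : weave ds b T = al ++ patch (nth ([::], [::]) ds i).2 ++ ga.
  by have := h true; rewrite -bE.
have hb' : weave ds b' T = al ++ (nth ([::], [::]) ds i).2 ++ ga.
  by have := h false; rewrite /= (_ : set_nth _ _ _ _ = b')// /b' set_set_nth eqxx.
have [/(_ _ (mem_nth ([::], [::]) il))[sp _ _] _] := ti.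
rewrite /V hb hb' !(catA P al); set be := (nth _ ds i).2 in sp hb hb' *.
move=> so' un' in' sl'.
have segj j : j != i -> seg b' j = seg b j.
  by move=> ji; rewrite /seg nth_set_nth /= (negPf ji).
have [] := toggle sp so' un' _.
  by move=> y yV cy; have := in' i il y yV cy; rewrite /seg nth_set_nth /= eqxx.
move=> so2 un2 av sl2; split=> //.
- move=> j jl y; have [[_ _ _ _ h5] _] := patchP sp.
  have [ji|ji] := eqVneq j i.
    rewrite ji => yV cy; rewrite /seg bi -/be; apply: contraT => yp.
    have /av : y \in (P ++ al) ++ ga.
      by move: yV; rewrite !mem_cat (negPf yp).
    by rewrite cy eqxx.
  move=> yV cy; rewrite -segj//; apply: in' => //.
  have yp : y \notin patch be.
    by apply/negP => /h5; rewrite cy => /(ky_inj jl il) ij; rewrite ij eqxx in ji.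
  by move: yV; rewrite !mem_cat (negPf yp) /= => /orP[/orP[]|] ->; rewrite ?orbT.
- move=> z /sl2[cz|/sl'[j /andP[jl jb] cz]]; first by exists i; rewrite ?il ?bi.
  exists j => //; rewrite jl /=; move: jb; rewrite nth_set_nth /=.
  by case: eqP => // _.
Qed.

Lemma weave_slot b i : (i < size ds)%N -> nth false b i ->
  exists2 z, slot2 (V b) z & cell z = ky i.
Proof.
move=> il bi; have [/(_ _ (mem_nth ([::], [::]) il))[sp _ _] _] := ti.
have [[_ _ _ _ h5] /hasP[z zp zs]] := patchP sp.
exists z; last by rewrite h5.
have [al [ga h]] := weave_at b T il.
have := h true; have -> : set_nth false b i true = b.
  have ib : (i < size b)%N.
    by rewrite ltnNge; apply/negP => /(nth_default false) e; rewrite e in bi.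
  apply: (@eq_from_nth _ false); rewrite size_set_nth; first by apply/maxn_idPr.
  by move=> j _; rewrite nth_set_nth /=; case: eqP => [->|].
rewrite /V => ->; rewrite catA; exact: slot2_cat.
Qed.

(** The original walk has no slot, so that the patched cells are those in which the new walk has
    one. *)
Lemma weave_inj b b' : size b = size ds -> size b' = size ds -> V b = V b' -> b = b'.
Proof.
have h b1 b2 i : size b2 = size ds -> V b1 = V b2 -> (i < size ds)%N ->
    nth false b1 i -> nth false b2 i.
  move=> s2 e il /(weave_slot il)[z]; rewrite e => zs cz.
  have [_ _ _ /(_ z zs)[j /andP[jl bj] cz']] := weave_inv (eq_leq s2).
  by rewrite (_ : i = j)//; apply: ky_inj => //; rewrite -cz -cz'.
move=> sb sb' e; apply: (@eq_from_nth _ false); first by rewrite sb.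
by rewrite sb => i il; apply/idP/idP; apply: h.
Qed.

End Weave.

(** [pre M v] lists the walks that the surgery may have turned into [v] at the
    cell of the first slot of [v]; [dec M a v] undoes [a] surgeries. *)
Definition pre M v : seq (seq pt) :=
  let k := cell (nth 0 v (find (slot2 v) v)) in
  let a := fun y => cell y == k in
  [seq take (find a v) v ++ be ++ rev (take (find a (rev v)) (rev v)) |
    be <- flatten [seq walks j (nth 0 v (find a v)) | j <- iota 0 M]].

Fixpoint dec M a v : seq (seq pt) :=
  if a is a'.+1 then flatten [seq dec M a' v0 | v0 <- pre M v] else [:: v].

Definition pre_bound M := (\sum_(j <- iota 0 M) size (dirs d) ^ j)%N.

Lemma size_pre M v : size (pre M v) = pre_bound M.
Proof.
rewrite size_map size_flatten /shape -map_comp sumnE big_map.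
by apply: eq_bigr => j _; rewrite /= size_walks.
Qed.

Lemma size_dec M a v : size (dec M a v) = (pre_bound M ^ a)%N.
Proof.
elim: a v => //= a IH v; rewrite size_flatten /shape -map_comp sumnE big_map.
rewrite (eq_bigr (fun=> (pre_bound M ^ a)%N)) => [|v0 _]; last exact: IH.
by rewrite big_const_seq count_predT iter_addn_0 size_pre mulnC expnS.
Qed.

Lemma mem_pre M v al be be' ga k :
  v = al ++ be' ++ ga -> has (slot2 v) v -> k = cell (nth 0 v (find (slot2 v) v)) ->
  be != [::] -> be' != [::] -> head 0 be' = head 0 be ->
  cell (head 0 be') = k -> cell (last 0 be') = k ->
  {in al ++ ga, forall y, cell y != k} -> sorted adj be -> (size be <= M)%N ->
  al ++ be ++ ga \in pre M v.
Proof.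
case: be be' => [|p be] [|p' be'] // ve hs ke _ _ /= pp ck lk av sob sm.
rewrite /pre -ke.
have nal : ~~ has (fun y => cell y == k) al.
  by apply/hasPn => y yal; apply: av; rewrite mem_cat yal.
have nga : ~~ has (fun y => cell y == k) (rev ga).
  by rewrite has_rev; apply/hasPn => y yal; apply: av; rewrite mem_cat yal orbT.
have f1 : find (fun y => cell y == k) v = size al.
  by rewrite ve find_cat (negPf nal) /= ck eqxx addn0.
have f2 : find (fun y => cell y == k) (rev v) = size ga.
  rewrite ve !rev_cat -catA find_cat (negPf nga) lastI rev_rcons /= lk eqxx addn0.
  by rewrite size_rev.
rewrite f1 f2.
have -> : take (size al) v = al by rewrite ve take_size_cat.
have -> : rev (take (size ga) (rev v)) = ga.
  by rewrite ve !rev_cat -catA take_size_cat ?size_rev// revK.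
have -> : nth 0 v (size al) = p.
  by rewrite ve nth_cat ltnn subnn /= pp.
apply/mapP; exists (p :: be) => //; apply/flattenP; exists (walks (size be) p); last first.
  by rewrite mem_walks /= !eqxx sob.
by apply/mapP; exists (size be) => //; rewrite mem_iota /= add0n.
Qed.

(** The first slot of the new walk reveals a patched cell, and the first and last visits to this
    cell delimit the patch. The patch has the ends of the erased segment, so that only a path of at
    most M points has to be guessed. *)
Lemma weave_dec P T ds M b : sorted adj (P ++ weave ds [::] T) ->
  uniq (P ++ weave ds [::] T) -> tight (P ++ weave ds [::] T) ds M ->
  ~~ has_slot (P ++ weave ds [::] T) -> {in ds, forall e, sorted adj e.2} ->
  (size b <= size ds)%N ->
  P ++ weave ds [::] T \in dec M (count id b) (P ++ weave ds b T).
Proof.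
move=> so un ti ns sd.
move en : (count id b) => n; elim: n b en => [|n IH] b cb sb.
  by rewrite /= inE weave_nil// has_count cb.
have /= [so' un' in' sl'] := weave_inv so un ti ns sb.
set v := P ++ weave ds b T in so' un' in' sl' *.
have hs : has (slot2 v) v.
  have /hasP[c /(nthP false)[i ib bi] cT] : has id b by rewrite has_count cb.
  rewrite {c}cT in bi.
  have [z zs _] := weave_slot ti (leq_trans ib sb) bi.
  exact: has_slotP zs.
have [i /andP[il bi] ci] := sl' _ (nth_find 0 hs).
have [/(_ _ (mem_nth ([::], [::]) il))[sp sm _] _] := ti.
have [[p1 p2 p3 p4 p5] p6] := patchP sp.
have [al [ga h]] := weave_at b T il.
have [ib sb' cb' bE] := clear_bit bi; set b' := set_nth _ _ _ _ in sb' cb' bE.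
rewrite cb in cb'; case: cb' => /esym cb'.
have hb : weave ds b T = al ++ patch (nth ([::], [::]) ds i).2 ++ ga.
  by have := h true; rewrite [X in weave _ X _](_ : _ = b)// {2}bE set_set_nth eqxx.
have hb' := h false; rewrite /= -/b' in hb'.
set be := (nth _ ds i).2 in sp sm hb hb' p1 p2 p3 p4 p5 p6 ci *.
have ve : v = (P ++ al) ++ patch be ++ ga by rewrite /v hb catA.
apply/flattenP; exists (dec M n (P ++ weave ds b' T)); last first.
  by apply: IH => //; rewrite sb'.
apply: map_f; rewrite hb' catA.
have [be0 _ lk] := sp.
apply: (@mem_pre _ _ _ _ (patch be) _ (key be)) => //.
- by rewrite p2 -lk.
- move=> y yag; apply/negP => /eqP cy.
  have yv : y \in v by rewrite ve; move: yag; rewrite !mem_cat => /orP[] ->; rewrite ?orbT.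
  have := in' i il y yv cy; rewrite bi -/be => yp.
  move: un'; rewrite ve uniq_catCA.
  by rewrite cat_uniq => /and3P[_ /hasPn/(_ y yag)]; rewrite /= yp.
- by apply: sd; apply: mem_nth.
Qed.

Lemma size_weave ds b T : {in ds, forall e, spanning e.2} ->
  (size (weave ds b T) <= size (weave ds [::] T) + 8 ^ d.+2 * count id b)%N.
Proof.
elim: ds b => [|[A be] ds IH] b sp /=; first by rewrite leq_addr.
have sb : spanning be by apply: (sp (A, be)); rewrite mem_head.
have [[_ _ h3 _ h5] _] := patchP sb.
have := size_cell h3 h5; have := IH (behead b) (fun e he => sp e (mem_behead (s := _ :: _) he)).
rewrite !size_cat; case: b => [|[] b] /=; lia.
Qed.

Fixpoint masks g : seq bitseq :=
  if g is g'.+1 then [seq c :: b | c <- [:: false; true], b <- masks g'] else [:: [::]].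

Lemma mem_masks g b : (b \in masks g) = (size b == g).
Proof.
elim: g b => [|g IH] b; first by rewrite inE; case: b.
rewrite (_ : masks g.+1 = [seq c :: b | c <- [:: false; true], b <- masks g])//.
apply/allpairsP/idP => [[[c b'] /= [_ h ->]]|]; first by rewrite /= eqSS -IH.
case: b => // c b; rewrite eqSS => h; exists (c, b); split=> //=.
  by case: c.
by rewrite IH.
Qed.

Lemma masks_uniq g : uniq (masks g).
Proof.
elim: g => //= g IH; rewrite cats0 cat_uniq !map_inj_uniq ?IH//=; try by move=> ? ? [].
rewrite andbT; apply/hasPn => _ /mapP[b _ ->]; apply/negP => /mapP[b' _].
by [].
Qed.

Lemma sum_masks (R : comPzRingType) (s : R) g :
  \sum_(b <- masks g) s ^+ count id b = (1 + s) ^+ g.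
Proof.
elim: g => [|g IH]; first by rewrite /= big_seq1.
rewrite exprS mulrDl mul1r -IH mulr_sumr /= cats0 big_cat !big_map /=.
by congr (_ + _); apply: eq_bigr => b _; rewrite ?add0n// add1n exprS.
Qed.

End Surgery.

(** * Occupation of cells and the choice of disjoint surgeries *)

Section Crowded.
Variable d : nat.
Notation pt := 'rV[int]_d.+2.
Notation adj := (@adj d).
Implicit Types (x y z t : pt) (w u v al be ga : seq pt) (b : bitseq).

Definition occ k w := count (fun x => cell x == k) w.
(** The threshold n is the parameter of the induction: at n = 2 every long walk is crowded, and once
    n exceeds the capacity of a cell, crowded means having a slot. *)
Definition crowded n w := has (fun x => (n <= occ (cell x) w)%N) w || has_slot w.
Definition clean n w := ~~ crowded n w.

Lemma occ_cat k u v : occ k (u ++ v) = (occ k u + occ k v)%N.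
Proof. exact: count_cat. Qed.

Lemma occ_le k w : uniq w -> (occ k w <= 8 ^ d.+2)%N.
Proof.
move=> un; rewrite /occ -size_filter; apply: (@size_cell _ k).
  by rewrite filter_uniq.
by move=> x; rewrite mem_filter => /andP[/eqP].
Qed.

Lemma crowded_max w : uniq w -> crowded (8 ^ d.+2).+1 w = has_slot w.
Proof.
move=> un; rewrite /crowded; case: (has_slot w); rewrite ?orbT// orbF.
by apply/hasPn => x _; rewrite -ltnNge ltnS occ_le.
Qed.

(** The step crosses a border between cells, and raising all coordinates by one puts both of its
    ends on the upper side of that border. *)
Lemma adj_cell x y : adj x y -> cell x != cell y ->
  cell (x + const_mx 1) = cell (y + const_mx 1).
Proof.
rewrite adj_dirs => /allpairsP[[j b] /= [_ _ e]].
have yE : y = x + (if b then delta_mx 0 j else - delta_mx 0 j) by rewrite -e addrC subrK.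
have yl l : l != j -> y 0 l = x 0 l.
  by move=> lj; rewrite yE; case: (b); rewrite !mxE (negPf lj) ?oppr0 addr0.
have yj : y 0 j = x 0 j + 1 \/ y 0 j = x 0 j - 1.
  by rewrite yE; case: (b); rewrite !mxE !eqxx; [left|right].
move=> cxy; apply/cellP => l; rewrite ![(_ + const_mx _) _ _]mxE ![const_mx _ _ _]mxE.
have [->|lj] := eqVneq l j; last by rewrite yl.
have : divz (x 0 j) (side j) != divz (y 0 j) (side j).
  apply: contraNneq cxy => h; apply/eqP/cellP => l'.
  by have [->|l'j] := eqVneq l' j; last by rewrite yl.
by move: yj; move: (x 0 j) (y 0 j) => a a'; rewrite /side; case: ifP; lia.
Qed.

(** If every step changed the cell, then by [adj_cell] the translated walk would stay in a single
    cell, which is too small for it. *)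
Lemma crowded2 n x w : issaw n x w -> (8 ^ d.+2 <= n)%N -> crowded 2 w.
Proof.
case/and4P => /eqP sw /eqP hd so un hn; apply: contraT; rewrite negb_or => /andP[nc _].
have cons u v y z : w = u ++ [:: y; z] ++ v -> cell y != cell z.
  move=> e; apply/negP => /eqP cab.
  case/negP: nc; apply/hasP; exists y; first by rewrite e !mem_cat mem_head orbT.
  rewrite e !occ_cat; apply: (@leq_trans (occ (cell y) [:: y; z])).
    by rewrite /occ /= -cab !eqxx.
  by rewrite addnCA leq_addr.
have : {in w, forall y, cell (y + const_mx 1) = cell (x + const_mx 1)}.
  move: w {sw un nc} hd so cons => [|y0 w] //= -> /=.
  clear y0; elim: w x => [|z w IH] t /=; first by move=> _ _ y; rewrite inE => /eqP ->.
  case/andP => az pw cons y; rewrite inE => /orP[/eqP -> //|yw].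
  rewrite (adj_cell az); last by apply: (cons [::] w).
  apply: IH => // u v a1 b1 e; apply: (cons (t :: u) v); by rewrite e.
move=> hc; have := @size_cell _ (cell (x + const_mx 1)) (shift (const_mx 1) w).
rewrite uniq_shift size_map sw => /(_ un) h; suff : (n < 8 ^ d.+2)%N by rewrite ltnNge hn.
by apply: h => y; rewrite mem_shift => /hc; rewrite subrK.
Qed.

(** The blocks counted here are stretches of M consecutive points; they are unrelated to the
    staircases of [block]. *)
Fixpoint nblocks (P : pred (seq pt)) M N w : nat :=
  if N is N'.+1 then (P (take M w) + nblocks P M N' (drop M w))%N else 0%N.

(** A cell visited k times within one stretch, in a walk that visits no cell more than k times, is
    visited nowhere else. The segment from its first to its last visit owns the cell, different
    stretches give different cells, and k > 1 makes the ends of the segment distinct. *)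
Lemma decomposition k M N W u v : (1 < k)%N -> uniq W -> sorted adj W ->
  W = u ++ v -> clean k.+1 W -> (size v = M * N)%N ->
  exists (ds : seq (seq pt * seq pt)) T, [/\ v = weave ds [::] T,
    size ds = nblocks (crowded k) M N v, tight W ds M,
    {in ds, forall e, {subset e.2 <= v}} & {in ds, forall e, sorted adj e.2}].
Proof.
move=> k1 un so + cl; elim: N u v => [|N IH] u v Wuv sv.
  by exists [::], v; split=> //; split.
have sz : size (take M v) = M.
  by rewrite size_takel// sv mulnS leq_addr.
set eta := take M v in sz *; set v' := drop M v.
have vE : v = eta ++ v' by rewrite cat_take_drop.
have sv' : size v' = (M * N)%N by rewrite size_drop sv mulnS addKn.
have [|ds [T [e1 e2 [e3 e3'] e4 e5]]] := IH (u ++ eta) v' _ sv'.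
  by rewrite -catA -vE.
(* A stretch that is not crowded joins the filler in front of the next segment. *)
have [|ncr] := boolP (crowded k eta); last first.
  have ns : nblocks (crowded k) M N.+1 v = size ds by rewrite /= (negPf ncr) e2.
  case: ds e1 e2 e3 e3' e4 e5 ns => [|[A be] ds] e1 e2 e3 e3' e4 e5 ns.
    exists [::], (eta ++ T); rewrite ns; split=> //.
    by rewrite vE e1.
  exists ((eta ++ A, be) :: ds), T; rewrite ns; split=> //.
  - by rewrite vE e1 /= -!catA.
  - split=> // e; rewrite inE => /orP[/eqP ->|eds] /=.
      by apply: (e3 (A, be)); rewrite mem_head.
    by apply: e3; rewrite inE eds orbT.
  - move=> e; rewrite inE => /orP[/eqP ->|eds] y /= ye.
      by rewrite vE mem_cat (e4 (A, be)) ?mem_head ?orbT.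
    by rewrite vE mem_cat (e4 e) ?orbT// inE eds orbT.
  - move=> e; rewrite inE => /orP[/eqP ->|eds] /=.
      by apply: (e5 (A, be)); rewrite mem_head.
    by apply: e5; rewrite inE eds orbT.
move=> cr; have ns : nblocks (crowded k) M N.+1 v = (size ds).+1.
  by rewrite /= cr e2.
have WE : W = u ++ eta ++ v' by rewrite -vE.
move: cr; rewrite /crowded => /orP[|hs]; last first.
  by case/negP: cl; rewrite /crowded WE has_slot_cat ?orbT.
case/hasP => x xe ox.
have ok : (occ (cell x) u = 0 /\ occ (cell x) v' = 0)%N.
  move: cl; rewrite /clean negb_or => /andP[/hasPn/(_ x) + _].
  rewrite WE !mem_cat xe orbT => /(_ isT); rewrite -ltnNge !occ_cat.
  move: ox; move: (occ _ u) (occ _ eta) (occ _ v') => a1 a2 a3 h1 h2.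
  by clear - h1 h2; lia.
have [/split_span[al [p [be [ga [eE ap al' nal nga]]]]] _] :
    has (fun y => cell y == cell x) eta /\ True.
  by split=> //; apply/hasP; exists x.
have occ0 s : ~~ has (fun y => cell y == cell x) s -> occ (cell x) s = 0%N.
  by rewrite has_count -leqNgt leqn0 => /eqP.
have ob : occ (cell x) (p :: be) = occ (cell x) eta.
  by rewrite eE !occ_cat (occ0 al)// (occ0 ga)// addn0.
have une : uniq (p :: be).
  by move: un; rewrite WE eE !cat_uniq => /and3P[_ _ /and3P[/and3P[_ _ /and3P[]]]].
have hm : {in W, forall y, cell y = cell x -> y \in p :: be}.
  move=> y; rewrite WE eE !mem_cat => yW cy.
  have h s : occ (cell x) s = 0%N -> y \notin s.
    move=> /eqP; rewrite /occ -leqn0 leqNgt -has_count => /hasPn h.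
    by apply/negP => /h; rewrite cy eqxx.
  move: yW; rewrite (negPf (h u _)) ?ok.1// (negPf (h v' _)) ?ok.2//.
  by rewrite (negPf (h al _)) ?occ0// (negPf (h ga _)) ?occ0// !orbF.
have sp : spanning (p :: be).
  split=> //=; last by rewrite (eqP ap) (eqP al').
  apply/negP => /eqP pl; move: ox; rewrite -ob.
  case: be pl une {eE al' ob hm} => [|q be] /= pl; first by rewrite /occ /= addn0 => _
    /(leq_trans k1); case: (_ == _).
  by move=> /andP[/negP h _] _; apply: h; rewrite {1}pl mem_last.
have kx : key (p :: be) = cell x by rewrite /key /= (eqP ap).
have sm : (size (p :: be) <= M)%N by rewrite -sz eE !size_cat addnCA leq_addr.
have uk : key (p :: be) \notin [seq key e.2 | e <- ds].
  apply/negP => /mapP[e eds ke].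
  have [[e0 _ _] _ em] := e3 e eds.
  have : head 0 e.2 \in v' by apply: (e4 e eds); case: (e.2) e0 => // *; rewrite mem_head.
  move=> hv; have : (0 < occ (cell x) v')%N; last by rewrite ok.2.
  by rewrite /occ -has_count; apply/hasP; exists (head 0 e.2) => //; rewrite -kx ke.
have e3n : {in ds, forall e, [/\ spanning e.2, (size e.2 <= M)%N &
         {in W, forall y, cell y = key e.2 -> y \in e.2}]} by [].
have sob : sorted adj (p :: be).
  move: so; rewrite WE eE; case/cat_sorted2 => _; case/cat_sorted2 => + _.
  by case/cat_sorted2 => _ /cat_sorted2[].
have fin ds' : ds' = ds \/ (exists A be' ds0, ds = (A, be') :: ds0 /\ ds' = (ga ++ A, be') ::
  ds0) ->
   [/\ tight W ((al, p :: be) :: ds') M,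
    {in (al, p :: be) :: ds', forall e, {subset e.2 <= v}} &
    {in (al, p :: be) :: ds', forall e, sorted adj e.2}].
  move=> hds'.
  have hin e : e \in ds' -> exists2 e', e' \in ds & e.2 = e'.2.
    case: hds' => [->|[A [be' [ds0 [-> ->]]]]]; first by exists e.
    rewrite inE => /orP[/eqP ->|eds]; first by exists (A, be') => //; rewrite mem_head.
    by exists e => //; rewrite inE eds orbT.
  have hk : [seq key e.2 | e <- ds'] = [seq key e.2 | e <- ds].
    by case: hds' => [->|[A [be' [ds0 [-> ->]]]]].
  split.
  - split; last by rewrite /= hk uk.
    move=> e; rewrite inE => /orP[/eqP ->|/hin[e' e'ds ->]]; last exact: e3.
    by split=> //= y yW; rewrite kx; apply: hm.
  - move=> e; rewrite inE => /orP[/eqP -> y|/hin[e' e'ds ->] y ye]; rewrite vE mem_cat.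
      by rewrite eE !mem_cat => ->; rewrite orbT.
    by rewrite (e4 e')// orbT.
  - move=> e; rewrite inE => /orP[/eqP ->|/hin[e' e'ds ->]] //; exact: e5.
case: ds e1 e2 e3 e3' e4 e5 ns uk e3n fin => [|[A be'] ds] e1 e2 e3 e3' e4 e5 ns uk e3n fin.
  have [f1 f2 f3] := fin [::] (or_introl erefl).
  exists [:: (al, p :: be)], (ga ++ T); rewrite ns; split=> //.
  by rewrite vE eE e1 /= -!catA /= -!catA.
have [|f1 f2 f3] := fin ((ga ++ A, be') :: ds); first by right; exists A, be', ds.
exists ((al, p :: be) :: (ga ++ A, be') :: ds), T; rewrite ns; split=> //.
by rewrite vE eE e1 /= -!catA /= -!catA.
Qed.

Lemma nblocks_le P M N w : (nblocks P M N w <= N)%N.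
Proof.
by elim: N w => //= N IH w; rewrite -[N.+1]add1n leq_add//; case: (P _).
Qed.

Lemma nblocks_slots M N u v : uniq (u ++ v) -> (size v = M * N)%N ->
  (nblocks (fun w => has_slot w) M N v <= nslot2 (u ++ v))%N.
Proof.
move=> un sv.
suff h : forall u v, (size v = M * N)%N ->
    (nblocks (fun w => has_slot w) M N v <= count (slot2 (u ++ v)) v)%N.
  by rewrite (leq_trans (h u v sv))// /nslot2 count_cat leq_addl.
move=> {un sv}; elim: N => [|N IH] {}u {}v sv //=.
have vE : v = take M v ++ drop M v by rewrite cat_take_drop.
have sv' : size (drop M v) = (M * N)%N by rewrite size_drop sv mulnS addKn.
have -> : count (slot2 (u ++ v)) v = (count (slot2 (u ++ v)) (take M v) +
    count (slot2 (u ++ v)) (drop M v))%N by rewrite -count_cat -vE.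
rewrite leq_add//.
  case hs : (has_slot _) => //=; case/hasP: hs => z zt zs; rewrite -has_count.
  by apply/hasP; exists z => //; rewrite vE; apply: slot2_cat.
have -> : u ++ v = (u ++ take M v) ++ drop M v by rewrite -catA -vE.
exact: IH.
Qed.

End Crowded.

(** * A pattern theorem for slots *)

Section RealPowers.
Variable R : realType.
Implicit Types (a e q s : R).

Lemma bernoulli a n : 0 <= a -> 1 + a *+ n <= (1 + a) ^+ n.
Proof.
move=> a0; elim: n => [|n IH]; first by rewrite mulr0n addr0.
rewrite exprS (@le_trans _ _ ((1 + a) * (1 + a *+ n)))//; last first.
  by rewrite ler_pM2l// ltr_pwDl.
rewrite mulrSr; have := mulr_ge0 a0 (mulrn_wge0 n a0).
by move: (a *+ n) => t; lra.
Qed.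

Lemma pow_unbounded a B : 1 < a -> exists n0, forall n, (n0 <= n)%N -> B < a ^+ n.
Proof.
move=> a1; have e0 : 0 < a - 1 by rewrite subr_gt0.
exists (Num.bound (B / (a - 1))) => n hn.
apply: (@lt_le_trans _ _ (1 + (a - 1) *+ n)); last first.
  by rewrite (le_trans (bernoulli _ (ltW e0)))// addrC subrK.
have [B0|B0] := leP B 0.
  by rewrite (le_lt_trans B0)// ltr_pwDl// mulrn_wge0// ltW.
have : B / (a - 1) < n%:R.
  apply: lt_le_trans (_ : (Num.bound (B / (a - 1)))%:R <= _); last by rewrite ler_nat.
  by rewrite archi_boundP// divr_ge0 ?ltW.
rewrite ltr_pdivrMr// mulr_natl => /lt_trans; apply.
by rewrite ltrDr.
Qed.

Lemma pow_small a e : 0 <= a < 1 -> 0 < e ->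
  exists n0, forall n, (n0 <= n)%N -> a ^+ n < e.
Proof.
move=> /andP[a0 a1] e0; have [->|an0] := eqVneq a 0.
  by exists 1%N => -[|n] // _; rewrite expr0n.
have {an0 a0}a0 : 0 < a by rewrite lt_neqAle eq_sym an0.
have ai : 1 < a^-1 by rewrite invf_gt1.
have [n0 h] := pow_unbounded e^-1 ai.
by exists n0 => n /h; rewrite exprVn ltf_pV2 ?posrE ?exprn_gt0.
Qed.

Lemma exp1D_le e n : 0 <= e -> e <= 1 -> (1 + e) ^+ n <= 1 + 3 ^+ n * e.
Proof.
move=> e0 e1; elim: n => [|n IH]; first by rewrite expr0 mul1r lerDl.
rewrite exprSr (le_trans (ler_wpM2r _ IH))//; first by rewrite addr_ge0.
have t1 : 1 <= 3 ^+ n :> R by rewrite exprn_ege1// ler1n.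
rewrite exprS; move: (3 ^+ n) t1 => t t1.
have : 0 <= (t - 1) * e by rewrite mulr_ge0 ?subr_ge0.
have : 0 <= t * e * (1 - e) by rewrite !mulr_ge0 ?subr_ge0// (le_trans _ t1).
by nra.
Qed.

Lemma small_root q n : 1 < q -> exists2 s, 1 < s <= 2 & s ^+ n <= q.
Proof.
move=> q1; pose e := Order.min 1 ((q - 1) / 3 ^+ n).
have q10 : 0 < q - 1 by rewrite subr_gt0.
have e0 : 0 < e by rewrite lt_min ltr01 divr_gt0// exprn_gt0.
have e1 : e <= 1 by rewrite ge_min lexx.
exists (1 + e); first by rewrite ltrDl e0 -[2]/(1 + 1) lerD2l.
have h := exp1D_le n (ltW e0) e1.
rewrite (le_trans h)// -lerBrDl mulrC -ler_pdivlMr ?exprn_gt0//.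
by rewrite ge_min lexx orbT.
Qed.

Lemma geometric_le q n : 1 < q -> \sum_(i <- iota 0 n) q ^+ i <= q ^+ n / (q - 1).
Proof.
move=> q1; have q10 : 0 < q - 1 by rewrite subr_gt0.
rewrite ler_pdivlMr//.
have -> : (\sum_(i <- iota 0 n) q ^+ i) * (q - 1) = q ^+ n - 1.
  elim: n => [|n IH]; first by rewrite big_nil mul0r expr0 subrr.
  rewrite -[in iota 0 _]addn1 iotaD big_cat /= big_seq1 mulrDl IH add0n exprSr.
  by rewrite mulrBr mulr1; ring.
by rewrite gerBl.
Qed.

Lemma half_geometric_le n : \sum_(i <- iota 0 n) (2^-1 : R) ^+ i <= 2.
Proof.
have -> : \sum_(i <- iota 0 n) (2^-1 : R) ^+ i = 2 - 2 * 2^-1 ^+ n.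
  elim: n => [|n IH]; first by rewrite big_nil expr0 mulr1 subrr.
  rewrite -[in iota 0 _]addn1 iotaD big_cat /= big_seq1 IH add0n exprSr.
  by field.
by rewrite gerBl mulr_ge0// exprn_ge0// invr_ge0.
Qed.

End RealPowers.

(** * Walks with few slots are exponentially rare *)

Section Pattern.
Variables (R : realType) (d : nat).
Notation pt := 'rV[int]_d.+2.
Notation adj := (@adj d).
Notation mu := (mu R d).
Notation D := ((size (dirs d))%:R : R).
Implicit Types (x y z t : pt) (w u v : seq pt) (P : pred (seq pt)).

Let mu0 : 0 < mu. Proof. exact: mu_gt0. Qed.
Let D0 : 0 < D. Proof. by rewrite ltr0n dirs_gt0. Qed.

Lemma size_saws1 x : (size (saws 1 x) <= size (dirs d))%N.
Proof.
apply: (@leq_trans (size (walks 1 x))); last by rewrite size_walks expn1.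
by rewrite size_filter (leq_trans (count_size _ _))// size_undup.
Qed.

(** Each stretch of m + 1 points is one step, with at most D choices, followed by a walk of length
    m. Forgetting self-avoidance between stretches turns the weighted sum into a product. *)
Lemma block_sum P (s B : R) m N x : 0 <= s ->
  (forall y, \sum_(e <- saws m y) s ^+ P e <= B) ->
  \sum_(w <- saws (m.+1 * N) x) s ^+ nblocks P m.+1 N (behead w) <= (D * B) ^+ N.
Proof.
move=> s0 hB; have B0 : 0 <= B by rewrite (le_trans _ (hB 0))// sumr_ge0// => i _;
  rewrite exprn_ge0.
have h1 y : \sum_(u <- saws m.+1 y) s ^+ P (behead u) <= D * B.
  apply: (@le_trans _ _ (\sum_(u <- saws 1 y) \sum_(v <- saws m (last y u)) s ^+ P v)).
    apply: (@sum_saws_cat _ _ _ (fun _ v => s ^+ P v) 1 m) => [u v|w1 z w2].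
      by rewrite exprn_ge0.
    by case: w1 => [|a [|]].
  apply: (@le_trans _ _ (\sum_(u <- saws 1 y) B)); first exact: ler_sum.
  by rewrite sumr_const_seq -[B *+ _]mulr_natl ler_wpM2r// ler_nat size_saws1.
elim: N x => [|N IH] x.
  rewrite muln0 expr0 /=.
  by rewrite sumr_const_seq size_saws.
rewrite mulnS; apply: (@le_trans _ _ (\sum_(u <- saws m.+1 x) \sum_(v <- saws (m.+1 * N) (last x u))
    s ^+ P (behead u) * s ^+ nblocks P m.+1 N (behead v))).
  apply: sum_saws_cat => [u v|w1 y w2 ws sw1]; first by rewrite mulr_ge0// exprn_ge0.
  rewrite /= exprD; case: w1 sw1 ws => [|a w1] //= [sw1] _.
  rewrite -cat_rcons take_size_cat ?size_rcons ?sw1//.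
  by rewrite drop_size_cat ?size_rcons ?sw1.
under eq_bigr do rewrite -mulr_sumr.
apply: (@le_trans _ _ (\sum_(u <- saws m.+1 x) s ^+ P (behead u) * (D * B) ^+ N)).
  by apply: ler_sum => u _; rewrite ler_wpM2l// exprn_ge0.
by rewrite -mulr_suml exprS ler_wpM2r// exprn_ge0// mulr_ge0// ltW.
Qed.

(** A gain at one length m suffices. The factor D pays for the step between two stretches, and 4
    leaves room for the rate 3/4 of [few_blocks]. *)
Definition sparse k := exists m, forall x,
  4 * D * (count (clean k) (saws m x))%:R <= mu ^+ m.+1.

(** Markov's inequality for s to the number of crowded stretches. With this s, clean and crowded
    walks of length m contribute at most mu^(m+1) / (4 D) each, so that N stretches weigh at most
    (mu^(m+1) / 2)^N. A walk with too few crowded stretches weighs at least (2/3)^N, because (2/3)^K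
    <= s. *)
Lemma few_blocks k : sparse k -> exists m K, (0 < K)%N /\ forall N x,
  (count (fun w => K * nblocks (crowded k) m.+1 N (behead w) < N)%N (saws (m.+1 * N) x))%:R
    <= (3 / 4) ^+ N * mu ^+ (m.+1 * N).
Proof.
case=> m hm; pose s := mu ^+ m.+1 / (4 * D * (c d m)%:R).
have c0 : 0 < (c d m)%:R :> R by rewrite ltr0n c_gt0.
have s0 : 0 < s by rewrite divr_gt0 ?exprn_gt0// !mulr_gt0.
have h231 : 0 <= (2 / 3 : R) < 1 by lra.
have [K0 hK] := pow_small h231 s0.
  exists m, K0.+1; split=> // N x; set T := fun w => _.
  have hs : (2 / 3) ^+ K0.+1 <= s by rewrite ltW// hK.
  have h23 : 0 < (2 / 3 : R) by lra.
  have h : (count T (saws (m.+1 * N) x))%:R * (2 / 3) ^+ N <= (D * (mu ^+ m.+1 / (2 * D))) ^+ N.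
    apply: le_trans (@block_sum (crowded k) s _ m N x (ltW s0) _); last first.
      move=> y; apply: (@le_trans _ _ (\sum_(e <- saws m y) ((clean k e)%:R + s))).
        apply: ler_sum => e _; rewrite /clean; case: (crowded k e) => /=.
          by rewrite expr1 add0r.
        by rewrite expr0 lerDl ltW.
      rewrite big_split /= sumr_const_seq size_saws -[s *+ _]mulr_natr.
      have -> : \sum_(e <- saws m y) (clean k e)%:R = (count (clean k) (saws m y))%:R :> R.
        by rewrite natr_countE [RHS]big_mkcond; apply: eq_bigr => e _; case: clean.
      rewrite /s ler_pdivlMr ?mulr_gt0// mulrDl.
      have -> : mu ^+ m.+1 / (4 * D * (c d m)%:R) * (c d m)%:R * (2 * D) = mu ^+ m.+1 / 2.
        by field; rewrite !gt_eqF.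
      by have := hm y; lra.
    rewrite natr_countE mulr_suml big_mkcond /=; apply: ler_sum => w _.
    case: ifP => [Tw|_]; last by rewrite exprn_ge0// ltW.
    rewrite mul1r (@le_trans _ _ ((2 / 3) ^+ (K0.+1 * nblocks (crowded k) m.+1 N (behead w))))//.
      by apply: ler_wiXn2l; [exact: ltW|lra|exact: ltnW].
    by rewrite exprM; apply: lerXn2r; rewrite ?nnegrE ?exprn_ge0 ?(ltW h23) ?(ltW s0).
  rewrite exprM -exprMn -(ler_pM2r (exprn_gt0 N h23)) (le_trans h)// -exprMn.
  have -> : D * (mu ^+ m.+1 / (2 * D)) = mu ^+ m.+1 / 2 by field; rewrite gt_eqF.
  have mm : 0 < mu ^+ m.+1 by rewrite exprn_gt0.
  by apply: lerXn2r; rewrite ?nnegrE; move: (mu ^+ m.+1) mm => t; lra.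
Qed.

(** Weighting each set of patched segments by s to its size gives at least (1 + s)^N' per walk.
    Conversely a walk with a patches has length at most M N + 8^(d+2) a and at most
    [pre_bound d M ^ a] sources; the condition on s makes the sum over a geometric. *)
Lemma surgery_count k M N N' x (s th C : R) : (1 < k)%N -> 0 <= s -> 1 < th ->
  (forall n, (c d n)%:R <= C * th ^+ n) ->
  s * (pre_bound d M)%:R * th ^+ (8 ^ d.+2) <= 2^-1 ->
  (count (fun w => clean k.+1 w && (N' <= nblocks (crowded k) M N (behead w))%N)
     (saws (M * N) x))%:R * (1 + s) ^+ N' <= 2 * (C * th / (th - 1)) * th ^+ (M * N).
Proof.
move=> k1 s0 t1 hC hs; set T := fun w => _; set De := (8 ^ d.+2)%N in hs *.
have t0 : 0 < th by exact: lt_trans t1.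
pose Tl := [seq w <- saws (M * N) x | T w].
pose prop w (f : seq (seq pt * seq pt) * seq pt) := w \in Tl ->
  let w' := [:: x] ++ weave f.1 [::] f.2 in
  [/\ w = w', (N' <= size f.1 <= N)%N, tight w' f.1 M,
   {in f.1, forall e, sorted adj e.2} & [/\ sorted adj w', uniq w' & ~~ has_slot w']].
have /choice[f hf] : forall w, exists f, prop w f.
  move=> w; have [wT|] := boolP (w \in Tl); last by move=> /negP n; exists ([::], [::]) => /n.
  have := wT; rewrite mem_filter mem_saws => /andP[/andP[cl nb]] /and4P[/eqP sw /eqP hd so un].
  have wE : w = [:: x] ++ behead w by case: (w) sw hd => //= a p _ ->.
  have sv : size (behead w) = (M * N)%N by rewrite size_behead sw.
  have [ds [T' [e1 e2 e3 _ e5]]] := decomposition k1 un so wE cl sv.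
  have wE' : w = [:: x] ++ weave ds [::] T' by rewrite -e1.
  exists (ds, T') => _ w'; have -> : w' = w by rewrite /w' wE'.
  split=> //; first by rewrite e2 nb nblocks_le.
  by split=> //; move: cl; rewrite /clean negb_or => /andP[].
rewrite natr_countE mulr_suml -big_filter -/Tl.
apply: (@le_trans _ _ (\sum_(w <- Tl) \sum_(b <- masks (size (f w).1)) s ^+ count id b)).
  rewrite big_seq [leRHS]big_seq; apply: ler_sum => w /hf[_ /andP[h _] _ _ _].
  by rewrite mul1r sum_masks ler_weXn2l// lerDl.
have -> : \sum_(w <- Tl) \sum_(b <- masks (size (f w).1)) s ^+ count id b =
    \sum_(p <- [seq (w, b) | w <- Tl, b <- masks (size (f w).1)]) s ^+ count id p.2.
  by rewrite big_allpairs_dep.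
(* The target keeps the source beside the patched walk, which determines only the list [dec] of
   possible sources. *)
pose B := [seq (a, vw) | a <- iota 0 N.+1, vw <- [seq (v, w) |
  v <- flatten [seq saws l x | l <- iota 0 (M * N + De * a).+1], w <- dec M a v]].
pose V w b := [:: x] ++ weave (f w).1 b (f w).2.
apply: (@le_trans _ _ (\sum_(p <- B) s ^+ p.1)).
  apply: (ler_sum_inj (f := fun p => (count id p.2, (V p.1 p.2, p.1)))) => //; last 1 first.
  - by move=> p _; rewrite exprn_ge0.
  - apply: allpairs_uniq_dep => [||[w b] [w' b'] _ _ /= [-> ->]//].
      by rewrite filter_uniq ?saws_uniq.
    by move=> w _; apply: masks_uniq.
  - move=> [w b] [w' b'] /allpairsPdep[w1 [b1 [h1 h2 [e1 e2]]]].
    move=> /allpairsPdep[w2 [b2 [h3 h4 [e3 e4]]]] /= [_ eV eww].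
    subst w1 b1 w2 b2; rewrite -eww in h4 eV *; congr pair.
    have [wE _ ti sd [so un ns]] := hf _ h1.
    move: h2 h4; rewrite !mem_masks => /eqP h2 /eqP h4.
    by apply: (weave_inj so un ti ns h2 h4); rewrite /= eV.
  - move=> [w b] /allpairsPdep[w1 [b1 [h1 h2 [e1 e2]]]]; subst w1 b1 => /=.
    have [wE /andP[_ dN] ti sd [so un ns]] := hf _ h1.
    have := h1; rewrite mem_filter mem_saws => /andP[_ /and4P[/eqP sw _ _ _]].
    move: h2; rewrite mem_masks => /eqP h2.
    have [so2 un2 _ _] := weave_inv so un ti ns (eq_leq h2).
    apply/allpairsPdep; exists (count id b), (V w b, w); split=> //.
      by rewrite mem_iota add0n ltnS (leq_trans (count_size _ _))// h2.
    apply/allpairsPdep; exists (V w b), w; split=> //; last first.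
      by rewrite [X in X \in _]wE; apply: weave_dec => //; rewrite h2.
    apply/flattenP; exists (saws (size (V w b)).-1 x); last first.
      by rewrite mem_saws; apply/and4P; split=> //=.
    apply/mapP; exists (size (V w b)).-1 => //; rewrite mem_iota add0n ltnS /V /=.
    have sp : {in (f w).1, forall e, spanning e.2} by move=> e /(proj1 ti)[].
    apply: leq_trans (size_weave b _ sp) _.
    by rewrite leq_add2r; move: sw; rewrite {1}wE => -[->].
have -> : \sum_(p <- B) s ^+ p.1 = \sum_(a <- iota 0 N.+1)
    \sum_(l <- iota 0 (M * N + De * a).+1) \sum_(v <- saws l x) s ^+ a *+ pre_bound d M ^ a.
  rewrite /B big_allpairs_dep; apply: eq_bigr => a _.
  rewrite big_allpairs_dep big_flatten big_map; apply: eq_bigr => l _.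
  apply: eq_bigr => v _; apply: (etrans (sumr_const_seq _ (s ^+ a))).
  by rewrite size_dec.
set Cp := (pre_bound d M)%:R in hs.
apply: (@le_trans _ _ (\sum_(a <- iota 0 N.+1) (2^-1) ^+ a * (C * th / (th - 1) * th ^+ (M * N)))).
  apply: ler_sum => a _.
  under eq_bigr => l _ do rewrite sumr_const_seq size_saws.
  have e l : s ^+ a *+ pre_bound d M ^ a *+ c d l = (s * Cp) ^+ a * (c d l)%:R.
    by rewrite -mulr_natr -[_ *+ (_ ^ _)]mulr_natr natrX -exprMn.
  under eq_bigr => l _ do rewrite e.
  rewrite -mulr_sumr.
  apply: (@le_trans _ _ ((s * Cp) ^+ a * (C * (th ^+ (M * N + De * a).+1 / (th - 1))))).
    rewrite ler_wpM2l ?exprn_ge0 ?mulr_ge0//.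
    have C0 : 0 <= C.
      by have := hC 0%N; rewrite expr0 mulr1; apply: le_trans.
    apply: (@le_trans _ _ (\sum_(l <- iota 0 (M * N + De * a).+1) C * th ^+ l)).
      exact: ler_sum.
    by rewrite -mulr_sumr ler_wpM2l// geometric_le.
  have C0 : 0 <= C by have := hC 0%N; rewrite expr0 mulr1; apply: le_trans.
  have -> : (s * Cp) ^+ a * (C * (th ^+ (M * N + De * a).+1 / (th - 1))) =
      (s * Cp * th ^+ De) ^+ a * (C * th / (th - 1) * th ^+ (M * N)).
    rewrite exprS exprD (exprM th De a) [(s * Cp * _) ^+ a]exprMn.
    move: ((th - 1)^-1) ((s * Cp) ^+ a) (th ^+ (M * N)) (th ^+ De ^+ a) => *.
    by ring.
  rewrite ler_wpM2r//.
    by rewrite !mulr_ge0 ?invr_ge0 ?exprn_ge0 ?subr_ge0// ?ltW.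
  by rewrite lerXn2r ?nnegrE ?mulr_ge0 ?exprn_ge0 ?(ltW t0)// invr_ge0.
rewrite -mulr_suml -!mulrA ler_wpM2r ?half_geometric_le//.
have C0 : 0 <= C by have := hC 0%N; rewrite expr0 mulr1; apply: le_trans.
by rewrite !mulr_ge0 ?invr_ge0 ?exprn_ge0 ?subr_ge0// ?ltW.
Qed.

(** Otherwise the clean walks of every length n are of order at least mu^n, and by [few_blocks] most
    of them have linearly many stretches open to surgery. Surgery would multiply their number by an
    exponential factor, which the growth rate of [c] forbids. *)
Lemma sparse_step k : (1 < k)%N -> sparse k -> sparse k.+1.
Proof.
move=> k1 /few_blocks[m [K [K0 few]]]; apply: contrapT => nsp.
have dense n : exists x, mu ^+ n.+1 < 4 * D * (count (clean k.+1) (saws n x))%:R.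
  apply: contrapT => h; apply: nsp; exists n => x; rewrite leNgt; apply/negP => hx.
  by apply: h; exists x.
set M := m.+1 in few; pose De := (8 ^ d.+2)%N.
pose Cp : R := (pre_bound d M)%:R.
have m20 : 0 < (2 * mu) ^+ De by rewrite exprn_gt0// mulr_gt0.
(* The rate [th] is chosen after s but will not exceed [2 * mu]; this s therefore already meets the
   condition of [surgery_count]. *)
pose s := (2 * (Cp + 1) * (2 * mu) ^+ De)^-1.
have Cp1 : 0 < Cp + 1 by rewrite ltr_wpDl.
have s0 : 0 < s by rewrite invr_gt0 !mulr_gt0.
have s1 : 1 < 1 + s by rewrite ltrDl.
(* The exponent gives r = sg^(M K) with r^2 <= 1 + s: one factor r per K stretches pays for [th] in
   place of [mu], the other is the gain. *)
have [sg /andP[sg1 sg2] sgE] := small_root (2 * (M * K)) s1.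
have sg0 : 0 < sg by exact: lt_trans sg1.
pose th := mu * sg.
have th1 : 1 < th by rewrite (lt_le_trans sg1)// ler_peMl ?(ltW sg0)// mu_ge1.
have [|C C0 hC] := @c_growth R d th; first by rewrite ltr_pMr.
have hs : s * Cp * th ^+ De <= 2^-1.
  have h : th ^+ De <= (2 * mu) ^+ De.
    apply: lerXn2r; rewrite ?nnegrE ?mulr_ge0 ?(ltW mu0) ?(ltW sg0)//.
    by rewrite /th mulrC ler_wpM2r ?(ltW mu0).
  apply: (@le_trans _ _ (s * (Cp + 1) * (2 * mu) ^+ De)).
    rewrite -!mulrA ler_wpM2l ?(ltW s0)//.
    by rewrite ler_pM ?exprn_ge0 ?(ltW (lt_trans ltr01 th1)) ?lerDl.
  rewrite /s; move: ((2 * mu) ^+ De) (Cp + 1) m20 Cp1 => a b a0 b0.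
  by rewrite le_eqVlt; apply/orP; left; apply/eqP; field; rewrite !gt_eqF.
pose A := 2 * (C * th / (th - 1)); pose r := sg ^+ (M * K).
have r1 : 1 < r by rewrite exprn_egt1// muln_eq0 negb_or /= -lt0n.
have r0 : 0 < r by exact: lt_trans r1.
have rs : r ^+ 2 <= 1 + s by rewrite -exprM mulnC.
have e0 : 0 < mu / (16 * D) by rewrite divr_gt0// mulr_gt0.
have h34 : 0 <= (3 / 4 : R) < 1 by lra.
have [n1 hn1] := pow_small h34 e0.
have A0 : 0 < A.
  by rewrite !mulr_gt0 ?invr_gt0 ?subr_gt0// (lt_trans ltr01 th1).
have [n2 hn2] := pow_unbounded (A / (mu / (16 * D))) r1.
pose N' := maxn n1 n2; pose N := (K * N')%N.
have [x hx] := dense (M * N)%N.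
have := few N x; have := @surgery_count k M N N' x s th C k1 (ltW s0) th1 hC hs.
rewrite -/A; set cT := count _ _; set cF := count _ _ => hT hF.
have hle : (count (clean k.+1) (saws (M * N) x) <= cF + cT)%N.
  rewrite -count_predUI (leq_trans _ (leq_addr _ _))//; apply: sub_count => w /= ->.
  by rewrite /N ltn_pmul2l// andTb ltnNge; case: (N' <= _)%N.
have cTle : cT%:R <= A / r ^+ N' * mu ^+ (M * N).
  have rN : 0 < r ^+ N' by rewrite exprn_gt0.
  rewrite mulrAC ler_pdivlMr// -(ler_pM2r rN).
  have -> : A * mu ^+ (M * N) * r ^+ N' = A * th ^+ (M * N).
    by rewrite /th exprMn /r -exprM -mulnA -/N mulrA.
  apply: le_trans hT; rewrite -mulrA ler_wpM2l// -exprMn -expr2.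
  have s10 : 0 <= 1 + s by exact: ltW (lt_trans ltr01 s1).
  by apply: lerXn2r => //; rewrite nnegrE sqr_ge0.
have hF' : (3 / 4) ^+ N < mu / (16 * D).
  by apply: hn1; rewrite /N (leq_trans (leq_maxl n1 n2))// leq_pmull.
have hT' : A / r ^+ N' < mu / (16 * D).
  rewrite ltr_pdivrMr ?exprn_gt0// mulrC -ltr_pdivrMr//.
  by apply: hn2; rewrite leq_maxr.
have mMN : 0 < mu ^+ (M * N) by rewrite exprn_gt0.
have : mu ^+ (M * N).+1 < mu ^+ (M * N).+1; last by rewrite ltxx.
apply: (lt_trans hx).
have hle' : (count (clean k.+1) (saws (M * N) x))%:R <=
    mu / (8 * D) * mu ^+ (M * N).
  apply: (@le_trans _ _ (cF%:R + cT%:R)); first by rewrite -natrD ler_nat.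
  apply: le_trans (lerD hF cTle) _; rewrite -mulrDl ler_wpM2r ?(ltW mMN)//.
  apply: le_trans (lerD (ltW hF') (ltW hT')) _.
  by rewrite le_eqVlt; apply/orP; left; apply/eqP; field; rewrite gt_eqF.
apply: (@le_lt_trans _ _ (4 * D * (mu / (8 * D) * mu ^+ (M * N)))).
  by rewrite ler_wpM2l// mulr_ge0// ltW.
rewrite mulrA exprS ltr_pM2r//.
have -> : 4 * D * (mu / (8 * D)) = mu / 2 by field; rewrite gt_eqF.
by move: mu0; lra.
Qed.

Lemma sparse_all k : sparse k.+2.
Proof.
elim: k => [|k IH]; last exact: sparse_step.
exists (8 ^ d.+2)%N => x.
have -> : count (clean 2) (saws (8 ^ d.+2) x) = 0%N.
  apply/eqP; rewrite -leqn0 leqNgt -has_count; apply/hasPn => w.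
  by rewrite mem_saws => /crowded2/(_ (leqnn _)) h; rewrite /clean h.
by rewrite mulr0 exprn_ge0// ltW.
Qed.

(** At a threshold above the capacity of a cell, crowded stretches are stretches with a slot, and
    different stretches have different slots. *)
Lemma few_slots : exists M K, [/\ (0 < M)%N, (0 < K)%N & forall N,
  (count (fun w => K * nslot2 w < N)%N (saws (M * N) (0 : pt)))%:R
    <= (3 / 4 : R) ^+ N * mu ^+ (M * N)].
Proof.
have e : (8 ^ d.+2).+1 = ((8 ^ d.+2).-1).+2 by rewrite prednK// expn_gt0.
have [m [K [K0 few]]] := few_blocks (sparse_all (8 ^ d.+2).-1).
exists m.+1, K; split=> // N; apply: le_trans (few N 0); rewrite ler_nat.
apply: (ler_count_inj (f := id)) => // [|w ws hw]; first exact: saws_uniq.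
rewrite ws /= (leq_ltn_trans _ hw)//.
rewrite leq_mul2l; apply/orP; right; move: ws; rewrite mem_saws -e.
case: w {hw} => [//|x w] /and4P[/eqP/= [sw] _ _ un].
apply: (@leq_trans (nblocks (fun v => has_slot v) m.+1 N w)).
  have : {subset w <= w} by [].
  have : uniq w by case/andP: un.
  elim: N w {un few} sw => //= N IH w sw uw _; rewrite leq_add//.
    by rewrite crowded_max// take_uniq.
  by apply: IH => //; rewrite ?drop_uniq// size_drop sw mulnS addKn.
exact: (@nblocks_slots _ _ _ [:: x]).
Qed.

End Pattern.

(** * Bridges *)

Section Bridges.
Variable d : nat.
Notation pt := 'rV[int]_d.+2.
Notation adj := (@adj d).
Notation lev := (@lev d).
Notation lat := (@lat d).
Notation e0 := (@e0 d).
Notation e1 := (@e1 d).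
Implicit Types (x y z t : pt) (w u v p a b : seq pt).

Definition rho x : pt := \row_j (if j == i0 d then - x 0 j else x 0 j).

Lemma rhoK : involutive rho.
Proof. move=> x; apply/rowP => j; rewrite !mxE. by case: eqP => // ->; rewrite opprK. Qed.
Lemma rho_inj : injective rho. Proof. exact: inv_inj rhoK. Qed.
Lemma lev_rho x : lev (rho x) = - lev x. Proof. by rewrite /lev mxE eqxx. Qed.
Lemma lat_rho x : lat (rho x) = lat x. Proof. by rewrite /lat mxE i01. Qed.
Lemma rho0 : rho 0 = 0.
Proof. by apply/rowP => j; rewrite !mxE; case: ifP; rewrite ?oppr0. Qed.

Lemma adj_rho x y : adj (rho x) (rho y) = adj x y.
Proof.
rewrite !adj_sum !lev_rho !lat_rho; congr (_ == _); congr (_ + (_ + _)).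
  by rewrite -opprD normrN.
by apply: eq_bigr => j /andP[/negPf j0 _]; rewrite !mxE j0.
Qed.

(** The cut is at the last maximum, so that what follows is strictly below it and becomes a
    half-space walk after reflection. *)
Fixpoint msplit x p : seq pt * pt * seq pt :=
  if p is y :: p' then
    let: (a, t, b) := msplit y p' in
    if lev t < lev x then ([::], x, p) else (x :: a, t, b)
  else ([::], x, [::]).

Lemma msplitP x p (s := msplit x p) : x :: p = s.1.1 ++ s.1.2 :: s.2 /\
  {in s.1.1, forall y, lev y <= lev s.1.2} /\ {in s.2, forall y, lev y < lev s.1.2}.
Proof.
rewrite /s {s}; elim: p x => [|y p IH] x /=; first by split.
case: (msplit y p) (IH y) => [[a t] b] /= [e [h1 h2]].
case: ltP => tx /=; rewrite e; split=> //; split=> //.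
  move=> y'; rewrite mem_cat inE => /or3P[/h1 ya|/eqP -> //|/h2 yb].
    exact: le_lt_trans tx.
  exact: lt_trans tx.
by move=> y'; rewrite inE => /orP[/eqP ->|/h1].
Qed.

Definition halfspace w := all (fun y => lev (head 0 w) < lev y) (behead w).
Definition bridge w := halfspace w && all (fun y => lev y <= lev (last 0 w)) w.

Lemma lev_adj x y : adj x y -> lev y <= lev x + 1.
Proof.
rewrite adj_sum; have h : 0 <= `|lat x - lat y| + \sum_(j | (j != i0 d) && (j != i1 d)) `|x 0 j
  - y 0 j|.
  by rewrite addr_ge0// sumr_ge0.
by move: h; move: (_ + \sum_(_ | _) _) (lev x) (lev y) => s l l'; lia.
Qed.

Lemma lev_path x p y : path adj x p -> y \in x :: p -> lev y <= lev x + (size p)%:Z.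
Proof.
elim: p x => [|z p IH] x /=; first by move=> _; rewrite inE => /eqP ->; rewrite addr0.
case/andP => /lev_adj xz /IH h; rewrite inE => /orP[/eqP ->|/h]; first by lia.
by move: (lev x) (lev y) (lev z) xz => *; lia.
Qed.

(** Truncation at length N replaces generating functions by finite sums, between which each
    decomposition yields an inequality. *)
Definition upto N : seq (seq pt) := flatten [seq saws n 0 | n <- iota 0 N.+1].

Lemma mem_upto N w : (w \in upto N) = (0 < size w <= N.+1)%N && issaw (size w).-1 0 w.
Proof.
apply/flattenP/idP => [[_ /mapP[n + ->]]|/andP[/andP[s0 sN] ws]].
  rewrite mem_iota add0n ltnS mem_saws => /= hn /[dup] ws /andP[/eqP sw _].
  by rewrite sw /= ws andbT ltnS.
exists (saws (size w).-1 0); last by rewrite mem_saws.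
by apply/mapP; exists (size w).-1 => //; rewrite mem_iota add0n /=; case: (size w) s0 sN.
Qed.

Lemma upto_uniq N : uniq (upto N).
Proof.
rewrite /upto -[flatten _]/(flatten [seq saws n (0 : pt) | n <- iota 0 N.+1]).
have -> : flatten [seq saws n (0 : pt) | n <- iota 0 N.+1] =
    map snd [seq (n, w) | n <- iota 0 N.+1, w <- saws n (0 : pt)].
  by rewrite map_flatten -map_comp; congr flatten; apply: eq_map => n /=; rewrite -map_comp map_id.
rewrite map_inj_in_uniq; last first.
  move=> [n w] [n' w'] /allpairsPdep[n1 [w1 [_ h1 [-> ->]]]].
  move=> /allpairsPdep[n2 [w2 [_ h2 [-> ->]]]] /= e; congr pair => //.
  move: h1 h2; rewrite !mem_saws e => /andP[/eqP s1 _] /andP[/eqP].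
  by rewrite s1 => -[->].
apply: allpairs_uniq_dep => [||[n w] [n' w'] _ _ [-> ->]] //; first exact: iota_uniq.
by move=> n _; apply: saws_uniq.
Qed.

Definition turn t u := [seq rho (y - t) | y <- u].

Lemma turn_inj t : injective (turn t).
Proof. by apply: inj_map => x y /rho_inj; apply: addIr. Qed.

Lemma issaw_turn n t u : issaw n t u -> issaw n 0 (turn t u).
Proof.
case/and4P => su hd so un; rewrite /issaw size_map su; apply/and4P; split=> //.
- by case: u hd {su so un} => [|y u] //= /eqP ->; rewrite subrr rho0.
- rewrite sorted_map; move: so; rewrite (eq_sorted (e' := relpre (fun y => rho (y - t)) adj))//.
  by move=> x y /=; rewrite adj_rho adjD.
- by rewrite map_inj_uniq// => x y /rho_inj; apply: addIr.
Qed.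

Lemma issaw_size n x w : issaw n x w -> size w = n.+1.
Proof. by case/andP => /eqP. Qed.

Lemma issaw_rev n x w : issaw n x w -> issaw n (last x w) (rev w).
Proof.
case/and4P => sw hd so un; rewrite /issaw size_rev sw rev_uniq un andbT.
rewrite rev_sorted (eq_sorted (e' := adj)) ?so ?andbT//.
  by case/lastP: w {sw hd so un} => [|w y] /=; rewrite ?eqxx// rev_rcons last_rcons eqxx.
by move=> y z; rewrite adjC.
Qed.

Lemma halfspace_turn t u : {in u, forall y, lev y < lev t} -> halfspace (turn t (t :: u)).
Proof.
move=> h; rewrite /halfspace /= subrr rho0 lev0; apply/allP => _ /mapP[y yu ->].
by rewrite lev_rho levD levN oppr_gt0 subr_lt0 h.
Qed.

Lemma last_turn_cons t y u : last 0 (turn t (y :: u)) = rho (last y u - t).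
Proof. by rewrite /= (last_map (fun y => rho (y - t))). Qed.

Section Sums.
Variables (R : realType) (z : R) (N : nat).
Hypothesis z0 : 0 < z.
Let wt w : R := z ^+ (size w).-1.
Let wt0 w : 0 <= wt w. Proof. by rewrite exprn_ge0// ltW. Qed.

Definition low (H : nat) w := halfspace w && all (fun y => lev y <= H%:Z) w.
Definition bridge_of (H : nat) w := bridge w && (lev (last 0 w) == H%:Z).

(** The Hammersley-Welsh step: a half-space walk that reaches level H + 1 is cut at its last maximum
    into a bridge of height H + 1 and, after reflection, a half-space walk of height at most H.
    Heights decrease strictly, so that each one is used at most once. *)
Lemma halfspace_step H : \sum_(w <- upto N | low H.+1 w) wt w <=
  (\sum_(w <- upto N | low H w) wt w) * (1 + \sum_(w <- upto N | bridge_of H.+1 w) wt w).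
Proof.
rewrite (bigID (low H))/= mulrDr mulr1 lerD//.
  rewrite (eq_bigl (low H))// => w; rewrite /low andbAC -andbA andbC.
  case hl : (all _ w) => //=; rewrite andbC; case: halfspace => //=.
  by apply: sub_all hl => y h; apply: le_trans h _; rewrite lez_nat.
rewrite mulrC big_distrlr /=.
have <- : \sum_(p <- [seq (u, v) | u <- [seq w <- upto N | bridge_of H.+1 w],
     v <- [seq w <- upto N | low H w]]) wt p.1 * wt p.2 =
   \sum_(u <- upto N | bridge_of H.+1 u) \sum_(v <- upto N | low H v) wt u * wt v.
  rewrite big_allpairs_dep big_filter; apply: eq_bigr => u _.
  by rewrite big_filter.
rewrite -big_filter.
pose f w := let s := msplit (head 0 w) (behead w) in
  (rcons s.1.1 s.1.2, turn s.1.2 (s.1.2 :: s.2)).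
have fP w : w \in upto N -> low H.+1 w -> ~~ low H w -> exists a t b,
   [/\ w = a ++ t :: b, f w = (rcons a t, turn t (t :: b)), lev t = H.+1%:Z,
    {in a, forall y, lev y <= lev t} & {in b, forall y, lev y < lev t}].
  rewrite mem_upto => /andP[/andP[s0 _] _] /andP[hw lw] nl.
  have wE : w = head 0 w :: behead w by case: (w) s0.
  have := msplitP (head 0 w) (behead w); rewrite /f -wE.
  case: (msplit _ _) => [[a t] b] /= [we [h1 h2]]; exists a, t, b; split=> //.
  apply/eqP; rewrite eq_le; apply/andP; split.
    by apply: (allP lw); rewrite we mem_cat mem_head orbT.
  rewrite leNgt; apply/negP => tH; case/negP: nl; rewrite /low hw /=; apply/allP => y.
  have tH' : lev t <= H by lia.
  by rewrite we mem_cat inE => /or3P[/h1|/eqP ->//|/h2 /ltW] /le_trans; apply.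
apply: (ler_sum_inj (f := f)).
- by rewrite filter_uniq ?upto_uniq.
- move=> w w'; rewrite !mem_filter => /andP[/andP[l1 l2] wu] /andP[/andP[l1' l2'] wu'].
  have [a [t [b [-> -> _ _ _]]]] := fP w wu l1 l2.
  have [a' [t' [b' [-> -> _ _ _]]]] := fP w' wu' l1' l2'.
  case=> /eqP; rewrite eqseq_rcons => /andP[/eqP -> /eqP ->] _ /(inj_map _) -> //.
  by move=> x y /rho_inj; apply: addIr.
- move=> w; rewrite mem_filter => /andP[/andP[l1 l2] wu].
  have [a [t [b [wE fE tH h1 h2]]]] := fP w wu l1 l2.
  move: wu; rewrite mem_upto => /andP[/andP[_ sN] ws].
  have [s1 s2] : issaw (size a) 0 (rcons a t) /\ issaw (size b) t (t :: b).
    apply: (@issaw_cat _ _ _ _ _ _ _ _ erefl).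
    by move: ws; rewrite wE size_cat /= addnS.
  have hw : {in a ++ t :: b, forall y, 0 <= lev y}.
    move: l1; rewrite -wE => /andP[hw _] y yw; have hd : head 0 w = 0 by case/and4P: ws => _ /eqP.
    move: hw yw hd; rewrite /halfspace; case: (w) => //= y0 p /allP h + y00.
    by rewrite inE => /orP[/eqP ->|/h]; rewrite y00 lev0 // => /ltW.
  have hw' : {in behead (a ++ t :: b), forall y, 0 < lev y}.
    move: l1; rewrite -wE => /andP[hw2 _] y yw; have hd : head 0 w = 0 by case/and4P: ws => _ /eqP.
    by move/allP: hw2 => /(_ y yw); rewrite hd lev0.
  move: l1; rewrite /low => /andP[_ lw].
  rewrite fE; apply/allpairsP; exists (rcons a t, turn t (t :: b)); split=> //; 
    [rewrite [_.1]/=|rewrite -[_.2]/(turn t (t :: b))].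
    rewrite mem_filter mem_upto size_rcons /= s1 andbT /bridge_of /bridge last_rcons tH eqxx andbT.
    rewrite andbC; apply/andP; split.
      by move: sN; rewrite wE size_cat /= addnS ltnS => /(leq_trans (leq_addr _ _)).
    apply/andP; split.
      rewrite /halfspace; have -> : head 0 (rcons a t) = 0.
        by case/and4P: s1 => _ /eqP {2}<- _ _; case: (a).
      apply/allP => y yat; rewrite lev0; apply: hw'.
      by move: yat; case: (a) => [|y0 a'] //=; rewrite mem_rcons mem_cat !inE => /orP[->|->];
        rewrite ?orbT.
    by apply/allP => y; rewrite mem_rcons inE -tH => /orP[/eqP ->|/h1].
  rewrite mem_filter mem_upto size_map issaw_turn// andbT.
  rewrite andbC; apply/andP; split.
    by move: sN; rewrite wE size_cat /= => h; apply: leq_trans h; rewrite leq_addl.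
  apply/andP; split; first exact: halfspace_turn.
  apply/allP => _ /mapP[y yb ->]; rewrite lev_rho levD levN tH.
  move: yb; rewrite inE => /orP[/eqP ->|yb]; first by rewrite tH subrr.
  have : 0 < lev y by apply: hw'; case: (a) => [|a0 a'] /=; rewrite ?mem_cat ?inE ?yb ?orbT.
  lia.
- move=> w; rewrite mem_filter => /andP[/andP[l1 l2] wu].
  have [a [t [b [-> -> _ _ _]]]] := fP w wu l1 l2.
  by rewrite /wt /= size_rcons size_map size_cat /= -exprD addnS.
- by move=> [u v] _; rewrite mulr_ge0.
Qed.

Lemma low0_sum : \sum_(w <- upto N | low 0 w) wt w <= 1.
Proof.
rewrite -big_filter -[leRHS](_ : \sum_(w <- [:: [:: (0 : pt)]]) wt w = 1); last first.
  by rewrite big_seq1 /wt expr0.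
apply: sum_subseq_le => //; first by rewrite filter_uniq ?upto_uniq.
move=> w; rewrite mem_filter mem_upto => /andP[/andP[hw lw] /and3P[/andP[s0 _] _ /andP[/eqP hd _]]].
case: w hw lw s0 hd => // x p + + _ /= hx; rewrite /halfspace /= hx lev0 => h1.
case/andP => _ h2; case: p h1 h2 => [|y p] /=; first by rewrite inE.
by case/andP => h3 _ /andP[h4 _]; move: (lt_le_trans h3 h4); rewrite ltxx.
Qed.

(** Each factor 1 + x is at most exp x, and bridges of different heights are different bridges. *)
Lemma low_sum H : \sum_(w <- upto N | low H w) wt w <=
  expR (\sum_(w <- upto N | bridge w) wt w).
Proof.
have h : \sum_(w <- upto N | low H w) wt w <=
    expR (\sum_(i < H) \sum_(w <- upto N | bridge_of i.+1 w) wt w).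
  elim: H => [|H IH]; first by rewrite big_ord0 expR0 low0_sum.
  apply: le_trans (halfspace_step H) _; rewrite big_ord_recr /= expRD.
  by rewrite ler_pM ?expR_ge1Dx// ?addr_ge0// sumr_ge0.
apply: le_trans h _; rewrite ler_expR.
under eq_bigr => i _ do rewrite big_mkcond.
rewrite exchange_big /= [leRHS]big_mkcond /=; apply: ler_sum => w _.
rewrite /bridge_of; case: (bridge w) => /=; last by rewrite big1.
have [[i hi]|h] := pselect (exists i : 'I_H, lev (last 0 w) = i.+1%:Z).
  rewrite (bigD1 i)//= hi eqxx big1 ?addr0// => j ji.
  by rewrite eqz_nat eqSS eq_sym (inj_eq val_inj) (negPf ji).
rewrite big1// => i _; case: eqP => // e; case: h; exists i.
by [].
Qed.

Lemma halfspace_sum : \sum_(w <- upto N | halfspace w) wt w <=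
  expR (\sum_(w <- upto N | bridge w) wt w).
Proof.
apply: le_trans (low_sum N); rewrite big_seq_cond [leRHS]big_seq_cond.
rewrite (eq_bigl (fun w => (w \in upto N) && low N w))// => w.
case wu : (w \in upto N) => //=; rewrite /low.
case: (halfspace w) => //=; apply/esym/allP => y yw; move: wu.
rewrite mem_upto => /andP[/andP[_ sN] /and4P[_ /eqP hd so _]].
case: w hd sN so yw => //= x p -> sN so yw; have := lev_path so yw.
by rewrite lev0 add0r => /le_trans; apply; rewrite lez_nat.
Qed.

End Sums.

(** Before the last maximum its level may be attained several times. The reversed first part is
    therefore started one step above it, which costs the factor z and lengthens the truncation by
    one. *)
Lemma saws_sum (R : realType) (z : R) N : 0 < z ->
  z * \sum_(w <- upto N) z ^+ (size w).-1 <=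
  (\sum_(w <- upto N.+1 | halfspace w) z ^+ (size w).-1) ^+ 2.
Proof.
move=> z0; rewrite expr2 big_distrlr /= mulr_sumr.
have <- : \sum_(p <- [seq (u, v) | u <- [seq w <- upto N.+1 | halfspace w],
     v <- [seq w <- upto N.+1 | halfspace w]]) z ^+ (size p.1).-1 * z ^+ (size p.2).-1 =
   \sum_(u <- upto N.+1 | halfspace u) \sum_(v <- upto N.+1 | halfspace v)
     z ^+ (size u).-1 * z ^+ (size v).-1.
  rewrite big_allpairs_dep big_filter; apply: eq_bigr => u _.
  by rewrite big_filter.
pose f w := let s := msplit (head 0 w) (behead w) in
  (turn (s.1.2 + e0) (s.1.2 + e0 :: rev (rcons s.1.1 s.1.2)), turn s.1.2 (s.1.2 :: s.2)).
have fP w : w \in upto N -> exists a t b,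
   [/\ w = a ++ t :: b, f w = (turn (t + e0) (t + e0 :: rev (rcons a t)), turn t (t :: b)),
    {in a, forall y, lev y <= lev t} & {in b, forall y, lev y < lev t}].
  rewrite mem_upto => /andP[/andP[s0 _] _].
  have wE : w = head 0 w :: behead w by case: (w) s0.
  have := msplitP (head 0 w) (behead w); rewrite /f -wE.
  by case: (msplit _ _) => [[a t] b] /= [we [h1 h2]]; exists a, t, b; split.
have h0 w : w \in upto N -> head 0 w = 0.
  by rewrite mem_upto => /andP[_ /and4P[_ /eqP]].
apply: (ler_sum_inj (f := f)).
- exact: upto_uniq.
- move=> w w' wu wu'.
  have [a [t [b [wE -> _ _]]]] := fP w wu.
  have [a' [t' [b' [wE' -> _ _]]]] := fP w' wu'.
  move=> e; have e1 : turn (t + e0) (t + e0 :: rev (rcons a t)) =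
    turn (t' + e0) (t' + e0 :: rev (rcons a' t')) := congr1 fst e.
  have e2 : turn t (t :: b) = turn t' (t' :: b') := congr1 snd e.
  have hh a1 t1 b1 : head 0 (a1 ++ t1 :: b1) = 0 -> last 0 (rev (rcons a1 t1)) = 0.
    by case: a1 => [|y a1] /= ->; rewrite ?rev_cons ?last_rcons.
  have l1 : last 0 (rev (rcons a t)) = 0 by apply: (hh a t b); rewrite -wE h0.
  have l2 : last 0 (rev (rcons a' t')) = 0 by apply: (hh a' t' b'); rewrite -wE' h0.
  have tt : t = t'.
    have := congr1 (last 0) e1; rewrite !last_turn_cons.
    rewrite !rev_rcons /= in l1 l2 *; rewrite l1 l2 !sub0r => /rho_inj/oppr_inj.
    exact: addIr.
  rewrite -tt in e1 e2 wE'; rewrite wE wE'.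
  case: (turn_inj e1) => /(can_inj revK)/eqP; rewrite eqseq_rcons => /andP[/eqP -> _].
  by case: (turn_inj e2) => ->.
- move=> w wu; have [a [t [b [wE -> h1 h2]]]] := fP w wu.
  move: wu; rewrite mem_upto => /andP[/andP[_ sN] ws].
  have [s1 s2] : issaw (size a) 0 (rcons a t) /\ issaw (size b) t (t :: b).
    apply: (@issaw_cat _ _ _ _ _ _ _ _ erefl).
    by move: ws; rewrite wE size_cat /= addnS.
  have lt : {in rev (rcons a t), forall y, lev y < lev (t + e0)}.
    move=> y; rewrite mem_rev mem_rcons inE !levlatE => /orP[/eqP ->|/h1]; first by lia.
    by move: (lev y) (lev t) => *; lia.
  have s3 : issaw (size a).+1 (t + e0) (t + e0 :: rev (rcons a t)).
    have := issaw_rev s1; rewrite last_rcons => /and4P[/eqP sr /eqP hr sor unr].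
    rewrite /issaw /= sr !eqxx unr andbT /=; apply/andP; split; last first.
      by apply/negP => /lt; rewrite ltxx.
    by move: sor; rewrite rev_rcons /= adjC adj_e0 => ->.
  have {}sN : (size a + (size b).+1 <= N.+1)%N by move: sN; rewrite wE size_cat.
  apply/allpairsP; exists (turn (t + e0) (t + e0 :: rev (rcons a t)), turn t (t :: b)).
  split=> //; [rewrite -[_.1]/(turn (t + e0) (t + e0 :: rev (rcons a t)))|
               rewrite -[_.2]/(turn t (t :: b))].
    rewrite mem_filter mem_upto (issaw_size (issaw_turn s3)) issaw_turn// halfspace_turn//.
    by move: sN; clear; lia.
  rewrite mem_filter mem_upto (issaw_size (issaw_turn s2)) issaw_turn// halfspace_turn//.
  by move: sN; clear; lia.
- move=> w wu; have [a [t [b [-> -> _ _]]]] := fP w wu.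
  rewrite -[_.1]/(turn (t + e0) (t + e0 :: rev (rcons a t))) -[_.2]/(turn t (t :: b)).
  by rewrite /turn !size_map /= size_rev size_rcons size_cat /= -exprS -exprD addnS.
- by move=> [u v] _; rewrite mulr_ge0 ?exprn_ge0 ?ltW.
Qed.

Definition bridges n := count bridge (saws n (0 : pt)).

Lemma sum_upto (R : pzSemiRingType) (P : pred (seq pt)) (z : R) N :
  \sum_(w <- upto N | P w) z ^+ (size w).-1 =
  \sum_(n <- iota 0 N.+1) (count P (saws n (0 : pt)))%:R * z ^+ n.
Proof.
rewrite /upto big_flatten /= -[_ :: _]/[seq saws n (0 : pt) | n <- iota 0 N.+1].
rewrite -[0%N :: _]/(iota 0 N.+1) big_map; apply: eq_bigr => n _.
rewrite natr_countE mulr_suml [LHS]big_seq_cond [RHS]big_seq_cond.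
apply: eq_bigr => w /andP[]; rewrite mem_saws => /issaw_size -> _.
by rewrite mul1r.
Qed.

Variable R : realType.
Let z : R := (mu R d)^-1.

(** Since [mu ^+ n <= c n], the sum of c n mu^(-n) up to N is at least N, whereas a bound B on the
    bridges would keep it below mu exp(B)^2. *)
Lemma bridges_diverge (B : R) : exists N,
  B < \sum_(n <- iota 0 N) (bridges n)%:R * z ^+ n.
Proof.
have m0 := mu_gt0 R d; have z0 : 0 < z by rewrite invr_gt0.
apply: contrapT => h.
have hB N : \sum_(n <- iota 0 N) (bridges n)%:R * z ^+ n <= B.
  by rewrite leNgt; apply/negP => hN; apply: h; exists N.
have hN N : N%:R <= mu R d * expR B ^+ 2.
  rewrite -ler_pdivrMl// -/z; apply: le_trans (_ : z * \sum_(w <- upto N) z ^+ (size w).-1 <= _).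
    rewrite ler_wpM2l ?(ltW z0)// sum_upto.
    apply: le_trans (_ : \sum_(n <- iota 0 N.+1) 1 <= _).
      by rewrite sumr_const_seq size_iota ler_nat.
    apply: ler_sum => n _; rewrite count_predT -[size _]/(c d n) exprVn.
    by rewrite ler_pdivlMr ?exprn_gt0// mul1r mu_exp_le.
  apply: le_trans (saws_sum N z0) _.
  apply: lerXn2r; rewrite ?nnegrE ?expR_ge0//.
    by rewrite sumr_ge0// => w _; rewrite exprn_ge0// ltW.
  apply: le_trans (halfspace_sum N.+1 z0) _.
  by rewrite ler_expR sum_upto hB.
have h2 : 0 <= mu R d * expR B ^+ 2 by rewrite mulr_ge0 ?exprn_ge0 ?expR_ge0 ?ltW.
by have := lt_le_trans (archi_boundP h2) (hN _); rewrite ltxx.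
Qed.

Lemma bridges_leS n : (bridges n <= bridges n.+1)%N.
Proof.
apply: (ler_count_inj (f := fun w => rcons w (last 0 w + e0))).
- exact: saws_uniq.
- by move=> u v _ _ /eqP; rewrite eqseq_rcons => /andP[/eqP].
- move=> w; rewrite !mem_saws /bridge => ws /andP[hw lw].
  have /and4P[/eqP sw /eqP hd so un] := ws.
  case: w sw hd so un hw lw {ws} => [//|x p] /= [sp] -> so un hw /andP[lx lw].
  rewrite /issaw /= size_rcons sp !eqxx /= rcons_path so adj_e0 /=.
  have hlast y : y \in 0 :: p -> lev y < lev (last 0 p + e0).
    rewrite levD lev_e0 inE => /orP[/eqP ->|/(allP lw)].
      by move: lx; move: (lev (last _ _)) (lev _) => *; lia.
    by move: (lev (last _ _)) (lev _) => *; lia.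
  have nin y : y \in 0 :: p -> y != last 0 p + e0.
    by move=> /hlast; apply: contraTneq => ->; rewrite ltxx.
  have -> : (0 \notin rcons p (last 0 p + e0)) && uniq (rcons p (last 0 p + e0)).
    rewrite -[_ && _]/(uniq (rcons (0 :: p) (last 0 p + e0))) rcons_uniq /= un andbT.
    by apply/negP => /nin; rewrite eqxx.
  rewrite /halfspace /= all_rcons last_rcons all_rcons lexx /=.
  rewrite hlast ?mem_head//=; move: hw; rewrite /halfspace /= => ->.
  rewrite (ltW (hlast _ _)) ?mem_head//=.
  by apply/allP => y yp; rewrite ltW// hlast// inE yp orbT.
Qed.

(** A bridge extends by a step up, so that each odd term is at most mu times the even term that
    follows. *)
Lemma even_bridges_diverge (B : R) : exists N,
  B < \sum_(i <- iota 0 N) (bridges i.*2)%:R * z ^+ i.*2.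
Proof.
have m0 := mu_gt0 R d; have z0 : 0 < z by rewrite invr_gt0.
have [N hN] := bridges_diverge ((1 + mu R d) * B).
exists N.+1.
pose g i : R := (bridges i.*2)%:R * z ^+ i.*2.
have g0 i : 0 <= g i by rewrite mulr_ge0// exprn_ge0// ltW.
have sumS (f : nat -> R) M : \sum_(i <- iota 0 M.+1) f i = \sum_(i <- iota 0 M) f i + f M.
  by rewrite -[M.+1]addn1 iotaD big_cat big_seq1 add0n.
have hb M : \sum_(n <- iota 0 M.*2) (bridges n)%:R * z ^+ n <=
    \sum_(i <- iota 0 M) g i + mu R d * \sum_(i <- iota 0 M.+1) g i.
  elim: M => [|M IH].
    by rewrite !big_nil add0r mulr_ge0 ?(ltW m0)// sumr_ge0.
  rewrite doubleS !sumS [mu R d * _]mulrDr.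
  have h : (bridges M.*2.+1)%:R * z ^+ M.*2.+1 <= mu R d * g M.+1.
    have -> : mu R d * g M.+1 = (bridges M.*2.+2)%:R * z ^+ M.*2.+1.
      by rewrite /g doubleS [z ^+ _.+2]exprS mulrCA /z mulVKf// gt_eqF.
    by rewrite ler_wpM2r ?exprn_ge0 ?(ltW z0)// ler_nat bridges_leS.
  rewrite sumS in IH; move: IH h; rewrite -/(g M).
  move: (\sum_(_ <- _) (_ * _)) (\sum_(_ <- _) _) (mu R d) (g M) (g M.+1) => *; lra.
have sg M M' : (M <= M')%N -> \sum_(i <- iota 0 M) g i <= \sum_(i <- iota 0 M') g i.
  move=> /subnKC <-; rewrite iotaD big_cat lerDl; exact: sumr_ge0.
have hN2 : \sum_(n <- iota 0 N) (bridges n)%:R * z ^+ n <=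
    \sum_(n <- iota 0 N.*2) (bridges n)%:R * z ^+ n.
  rewrite -addnn iotaD big_cat lerDl sumr_ge0// => n _.
  by rewrite mulr_ge0// exprn_ge0// ltW.
rewrite -(ltr_pM2l (addr_gt0 ltr01 m0)); apply: lt_le_trans hN _.
apply: le_trans hN2 _; apply: le_trans (hb N) _.
by rewrite mulrDl mul1r lerD2r sg.
Qed.

End Bridges.

(** * Ratios of counts of flip-invariant classes *)

Section Ratio.
Variables (R : realType) (d : nat).
Notation pt := 'rV[int]_d.+2.
Notation mu := (mu R d).
Notation c := (c d).
Implicit Types (w u v : seq pt) (n k i j T : nat).

Variable W : pred (seq pt).
Hypothesis W_flip : forall u z v, aligned z -> uniq (wII u z v) ->
  sorted (@adj d) (wI u z v) -> W (wII u z v) = W (wI u z v).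
Notation X n T j := (nshell W n%N T%N j%N).

Definition kind w := ((nslot1 w + nslot2 w)%N, nslot2 w).

Lemma sum_nshell n (S : seq (nat * nat)) : uniq S ->
  (\sum_(o <- S) X n o.1 o.2 = count (fun w => W w && (kind w \in S)) (saws n (0 : pt)))%N.
Proof.
move=> uS; rewrite -sum1_count [RHS]big_mkcond /=.
under eq_bigr => o _ do rewrite /nshell -sum1_count big_mkcond /=.
rewrite exchange_big /=; apply: eq_bigr => w _.
rewrite /shell; case: (W w) => /=; last by rewrite big1.
rewrite -big_mkcond sum1_count.
rewrite (_ : (if _ then _ else _) = (kind w \in S) :> nat)//; rewrite -count_uniq_mem//;
  apply: eq_count => -[T j] /=.
by rewrite -pair_eqE /= ![_ == T]eq_sym ![_ == j]eq_sym.
Qed.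

(** The ratio (T - j') / (j' + 1) decreases in j', so that its bound at the lowest index j holds
    along the chain. *)
Lemma nshell_down (q : R) n T j i : 0 <= q -> q * (T - j)%N%:R <= j.+1%:R ->
  q ^+ i * (X (n + i.*2)%N T (j + i)%N)%:R <= (X n T j)%:R.
Proof.
move=> q0 h; elim: i => [|i IH]; first by rewrite expr0 mul1r !addn0.
apply: le_trans IH; rewrite exprSr -mulrA ler_wpM2l ?exprn_ge0// doubleS !addnS.
have e := congr1 (fun a => a%:R : R) (nshell_flip W_flip (n + i.*2) T (j + i)).
rewrite /= !natrM in e.
have [T0|T0] := leqP T (j + i).
  move: e; rewrite (eqP T0) mul0r => /esym/eqP; rewrite mulf_eq0 pnatr_eq0 /= => /eqP ->.
  by rewrite mulr0.
have Tp : 0 < (T - (j + i))%N%:R :> R by rewrite ltr0n subn_gt0.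
rewrite -(ler_pM2l Tp) e mulrA ler_wpM2r// mulrC.
apply: le_trans (_ : q * (T - j)%N%:R <= _).
  by rewrite ler_wpM2l// ler_nat leq_sub2l ?leq_addr.
by apply: le_trans h _; rewrite ler_nat ltnS leq_addr.
Qed.

(** Here the smallest ratio occurs at the last flip, at index j + k - 1, and the hypothesis makes it
    at least Q. *)
Lemma nshell_up (Q : R) n T j k : 0 <= Q -> (Q + 1) * (j + k)%N%:R <= T%:R ->
  Q ^+ k * (X n T j)%:R <= (X (n + k.*2)%N T (j + k)%N)%:R.
Proof.
move=> Q0 h.
have {h} h i : (i < k)%N -> Q * (j + i).+1%:R <= (T - (j + i))%N%:R.
  move=> ik; have jT : (j + i <= T)%N.
    rewrite -(ler_nat R); apply: le_trans h; apply: le_trans (_ : 1 * (j + k)%N%:R <= _).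
      by rewrite mul1r ler_nat leq_add2l ltnW.
    by rewrite ler_wpM2r// lerDr.
  rewrite natrB// lerBrDr; apply: le_trans h; rewrite mulrDl mul1r lerD//.
    by rewrite ler_wpM2l// ler_nat -addnS leq_add2l.
  by rewrite ler_nat leq_add2l ltnW.
elim: {-2}k (leqnn k) => [|i IH] ik; first by rewrite expr0 mul1r !addn0.
rewrite exprS -mulrA; apply: le_trans (_ : Q * (X (n + i.*2)%N T (j + i)%N)%:R <= _).
  by rewrite ler_wpM2l// IH// ltnW.
have e := congr1 (fun a => a%:R : R) (nshell_flip W_flip (n + i.*2) T (j + i)).
rewrite /= !natrM in e; rewrite doubleS !addnS.
have jp : 0 < (j + i).+1%:R :> R by [].
rewrite -(ler_pM2l jp) -e mulrA ler_wpM2r// mulrC.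
exact: h.
Qed.

Lemma nslot2_cat w v : (nslot2 w <= nslot2 (w ++ v))%N.
Proof.
rewrite /nslot2 count_cat; apply: leq_trans (leq_addr _ _).
apply: sub_count => z /andP[az h]; apply/andP; split=> //.
exact: infix_catr.
Qed.

(** This passes from multiples of M to all lengths: slots of the second type in an initial part
    remain slots of the whole walk. *)
Lemma few_typical (e : R) : 0 < e -> exists M K n0,
  [/\ (0 < M)%N, (0 < K)%N & forall n, (n0 <= n)%N ->
  (count (fun w => K * nslot2 w < n %/ M)%N (saws n (0 : pt)))%:R <= e * (c n)%:R].
Proof.
move=> e_gt0; have [M [K [M0 K_gt0 few]]] := few_slots R d.
pose D : R := (size (dirs d) ^ M)%N%:R.
have D0 : 0 < D by rewrite ltr0n expn_gt0 dirs_gt0.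
have h34 : 0 <= (3 / 4 : R) < 1 by lra.
have [N0 hN0] := pow_small h34 (divr_gt0 e_gt0 D0).
exists M, K, (N0 * M)%N; split=> // n hn.
have hN : (N0 <= n %/ M)%N by rewrite leq_divRL.
have h34N := hN0 _ hN.
have cr : (c (n %% M))%:R <= D.
  rewrite ler_nat; apply: leq_trans (_ : size (dirs d) ^ (n %% M) <= _)%N; last first.
    by rewrite leq_pexp2l ?dirs_gt0// ltnW// ltn_pmod.
  rewrite -(size_walks _ 0) /c -count_predT count_filter.
  by apply: leq_trans (count_size _ _) _; apply: size_undup.
have h : (count (fun w => K * nslot2 w < n %/ M)%N (saws n (0 : pt)))%:R <=
   (count (fun w => K * nslot2 w < n %/ M)%N (saws (M * (n %/ M)) (0 : pt)))%:R * (c (n %%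
     M))%:R :> R.
  set P := fun w => _.
  have -> : saws n (0 : pt) = saws (M * (n %/ M) + n %% M)%N 0 by rewrite mulnC -divn_eq.
  rewrite !natr_countE.
  rewrite big_mkcond [Z in Z * _]big_mkcond /=.
  apply: (le_trans (@sum_saws_cat _ _ _ (fun u _ => if P u then 1 else 0) _ _ 0 _ _)).
  - by move=> u v; case: ifP.
  - move=> w1 y w2 _ _; rewrite -cat_rcons.
    case: ifP => [Pw|_]; last by case: ifP.
    rewrite /P (leq_ltn_trans _ Pw)// leq_mul2l nslot2_cat orbT//.
  rewrite mulr_suml; apply: ler_sum => u _; rewrite sumr_const_seq size_saws.
  by case: ifP => _; rewrite ?mul0rn ?mul0r ?mul1r.
apply: le_trans h _; apply: le_trans (_ : ((3 / 4) ^+ (n %/ M) * mu ^+ (M * (n %/ M))) * D <= _).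
  by rewrite ler_pM.
have m0 := mu_gt0 R d.
apply: le_trans (_ : (e / D * (c n)%:R) * D <= _); last first.
  by rewrite mulrAC divfK ?gt_eqF.
rewrite ler_wpM2r ?(ltW D0)// ler_pM ?exprn_ge0 ?(ltW m0)//; first by lra.
apply: le_trans (mu_exp_le _ _ n); rewrite ler_weXn2l ?mu_ge1//.
by rewrite mulnC leq_divM.
Qed.

(* Walks whose [nslot2] is too small compared with [nslot1] are rare: flipping k of
   their slots up, with k proportional to the length, would give more walks of
   length N + 2k than [c (N + 2k)]. On the other walks i flips down lose at most
   a factor q each. *)
Lemma class_ratio (q e : R) i : 0 < q -> q * mu ^+ 2 < 1 -> 0 < e ->
  exists n0, forall n, (n0 <= n)%N ->
  q ^+ i * ((count W (saws (n + i.*2) (0 : pt)))%:R - e * (c (n + i.*2))%:R) <=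
  (count W (saws n (0 : pt)))%:R.
Proof.
(* Q lies between mu^2 and 1/q: where flips down may lose more than the factor q, there is room for
   k flips up that gain at least Q each, more than the growth rate allows. *)
move=> q_gt0 qm e_gt0; pose s := q^-1; pose Q := (mu ^+ 2 + s) / 2.
have m0 := mu_gt0 R d; have m2 : 0 < mu ^+ 2 by rewrite exprn_gt0.
have ms : mu ^+ 2 < s by rewrite /s -(ltr_pM2l q_gt0) divff ?gt_eqF.
have mQ : mu ^+ 2 < Q by rewrite /Q; lra.
have Qs : Q < s by rewrite /Q; lra.
have Q0 : 0 < Q by exact: lt_trans mQ.
have Qm : 1 < Q / mu ^+ 2 by rewrite ltr_pdivlMr// mul1r.
(* Of the three factors t, two pay for the bound C (mu t)^(2k) on [c k.*2]; the third leaves t^k,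
   which exceeds every constant. *)
have [t /andP[t1 _] tQ] := small_root 3 Qm.
have [C C0 hC] : exists2 C : R, 0 < C & forall n, (c n)%:R <= C * (mu * t) ^+ n.
  by apply: c_growth; rewrite ltr_pMr.
have e2 : 0 < e / 2 by rewrite divr_gt0.
have [M [K [n1 [M0 K_gt0 few]]]] := few_typical e2.
have [k0 hk0] := pow_unbounded (C / (e / 2)) t1.
have Kp : 0 < K%:R :> R by rewrite ltr0n.
have sQ : 0 < s - Q by rewrite subr_gt0.
(* The margin (s - Q) j is shared equally: L limits k so that the upward flips use at most half of
   it, and [v1] makes the other half cover the offset i. *)
pose L := (Num.bound ((s - Q)^-1 * (2 * K%:R * (Q + 1)))).+1.
have hL : 2 * K%:R * (Q + 1) <= (s - Q) * L%:R.
  rewrite -ler_pdivrMl//; apply/ltW/(lt_le_trans (archi_boundP _)); last first.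
    by rewrite ler_nat.
  by rewrite mulr_ge0 ?invr_ge0 ?(ltW sQ)// mulr_ge0// addr_ge0// ltW.
pose v1 := Num.bound ((s - Q)^-1 * (2 * K%:R * ((s + 1) * i%:R))).
have hv1 : 2 * K%:R * ((s + 1) * i%:R) <= (s - Q) * v1%:R.
  rewrite -ler_pdivrMl//; apply/ltW/archi_boundP.
  rewrite mulr_ge0 ?invr_ge0 ?(ltW sQ)// !mulr_ge0// addr_ge0// ltW//.
  exact: lt_trans Qs.
pose v0 := maxn v1 (maxn (K * i) (k0 * L)).
exists (maxn n1 (v0 * M)) => n hn.
set N := (n + i.*2)%N; have nN : (n <= N)%N by rewrite leq_addr.
have hN1 : (n1 <= N)%N by apply: leq_trans nN; apply: leq_trans hn; rewrite leq_maxl.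
have hv : (v0 <= N %/ M)%N.
  by rewrite leq_divRL//; apply: leq_trans nN; apply: leq_trans hn; rewrite leq_maxr.
move: (few _ hN1) hv; set v := (N %/ M)%N => fewN hv.
have {}hv1 : 2 * K%:R * ((s + 1) * i%:R) <= (s - Q) * v%:R.
  apply: le_trans hv1 _; rewrite ler_wpM2l ?(ltW sQ)// ler_nat.
  exact: leq_trans (leq_maxl _ _) hv.
have vi : (K * i <= v)%N.
  by apply: leq_trans hv; rewrite /v0 leq_max leq_max leqnn orbT.
have vk : (k0 <= v %/ L)%N.
  by rewrite leq_divRL//; apply: leq_trans hv; rewrite /v0 !leq_max leqnn !orbT.
set k := (v %/ L)%N in vk; have Lk : (k * L <= v)%N by exact: leq_divM.
(* The index after i flips down is [o.2 - i], and this is where [nshell_down] needs its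
   hypothesis. *)
pose good (o : nat * nat) := (i <= o.2)%N && (q * (o.1 - (o.2 - i))%N%:R <= (o.2 - i).+1%:R).
pose S := undup [seq kind w | w <- saws N (0 : pt)].
pose G := [seq o <- S | good o]; pose B := [seq o <- S | ~~ good o && (v <= K * o.2)%N].
have uS : uniq S by exact: undup_uniq.
have Wle : (count W (saws N (0 : pt)))%:R <= e / 2 * (c N)%:R +
   (\sum_(o <- B) (X N o.1 o.2)%:R + \sum_(o <- G) (X N o.1 o.2)%:R) :> R.
  rewrite -!natr_sum !sum_nshell ?filter_uniq//.
  apply: le_trans (lerD fewN (lexx _)); rewrite -!natrD ler_nat.
  set PB := fun w => W w && (kind w \in B); set PG := fun w => W w && (kind w \in G).
  set PF := fun w => (K * nslot2 w < v)%N.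
  apply: leq_trans (_ : count (predU PF (predU PB PG)) (saws N (0 : pt)) <= _)%N.
    apply: (ler_count_inj (f := id)) => //; first exact: saws_uniq.
    move=> w ws Ww; rewrite ws /= /PF /PB /PG !mem_filter Ww /=.
    have -> : kind w \in S by rewrite mem_undup map_f.
    by rewrite !andbT ltnNge; case: (v <= _)%N; case: (good _).
  have := count_predUI PF (predU PB PG) (saws N (0 : pt)).
  have := count_predUI PB PG (saws N (0 : pt)).
  by clear; lia.
have Ble : \sum_(o <- B) (X N o.1 o.2)%:R <= e / 2 * (c N)%:R :> R.
  have h o : o \in B -> Q ^+ k * (X N o.1 o.2)%:R <= (X (N + k.*2) o.1 (o.2 + k))%:R.
    case: o => T j; rewrite mem_filter /good /= => /andP[/andP[+ vj] _].
    have ij : (i <= j)%N by rewrite -(leq_pmul2l K_gt0); apply: leq_trans vj.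
    rewrite ij /= -ltNge => h; apply: nshell_up; first exact: ltW.
    have {}h : s * ((j - i)%N%:R + 1) < (T - (j - i))%N%:R.
      by rewrite /s -(ltr_pM2l q_gt0) mulVKf ?gt_eqF// natr1.
    have T0 : (j - i <= T)%N.
      rewrite ltnW// -subn_gt0 -(ltr0n R); apply: le_lt_trans h.
      by rewrite mulr_ge0 ?addr_ge0// (le_trans _ (ltW ms))// ltW.
    rewrite !natrB// in h.
    have {}vj : v%:R <= K%:R * j%:R :> R by rewrite -natrM ler_nat.
    have {}Lk : k%:R * L%:R <= v%:R :> R by rewrite -natrM ler_nat.
    have h1 : K%:R * ((Q + 1) * k%:R) * 2 <= (s - Q) * v%:R.
      apply: le_trans (ler_wpM2l (ltW sQ) Lk).
      rewrite [leLHS](_ : _ = k%:R * (2 * K%:R * (Q + 1))); last by ring.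
      by rewrite [leRHS]mulrCA ler_wpM2l.
    have h2 : (s - Q) * v%:R <= K%:R * ((s - Q) * j%:R).
      by rewrite [leRHS]mulrCA ler_wpM2l// ltW.
    have h3 : (s + 1) * i%:R + (Q + 1) * k%:R <= (s - Q) * j%:R.
      rewrite -(ler_pM2l Kp); apply: le_trans h2; move: h1 hv1; clear.
      move: (i%:R) (k%:R) (K%:R) (v%:R : R) => x1 x2 x3 x4 *; lra.
    move: h h3 ms m2; rewrite natrD; clear; move: (i%:R) (k%:R) (j%:R) (T%:R) (mu ^+ 2) => x1 x2
      x3 x4 *.
    by lra.
  pose B' := [seq (o.1, (o.2 + k)%N) | o <- B].
  have uB' : uniq B'.
    rewrite map_inj_uniq ?filter_uniq// => -[T j] [T' j'] [-> /eqP].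
    by rewrite eqn_add2r => /eqP ->.
  have hB : Q ^+ k * \sum_(o <- B) (X N o.1 o.2)%:R <= (c N)%:R * (C * (mu * t) ^+ k.*2).
    apply: le_trans (_ : (c N)%:R * (c k.*2)%:R <= _); last by rewrite ler_wpM2l.
    rewrite -natrM; apply: le_trans (_ : (c (N + k.*2))%:R <= _); last first.
      by rewrite ler_nat c_submul.
    apply: le_trans (_ : \sum_(o <- B') (X (N + k.*2) o.1 o.2)%:R <= _); last first.
      by rewrite -natr_sum sum_nshell// ler_nat count_size.
    by rewrite big_map mulr_sumr big_seq [leRHS]big_seq; apply: ler_sum => o /h.
  set SB := \sum_(o <- B) _ in hB *.
  have SB0 : 0 <= SB by exact: sumr_ge0.
  have p0 : 0 < (mu * t) ^+ k.*2 by rewrite exprn_gt0// mulr_gt0// (lt_trans _ t1).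
  have {}hB : t ^+ k * SB <= (c N)%:R * C.
    rewrite -(ler_pM2l p0) [leRHS]mulrCA [(_ ^+ _ * C)]mulrC; apply: le_trans hB.
    rewrite mulrA ler_wpM2r// -muln2 mulnC exprM -exprMn lerXn2r ?nnegrE ?(ltW Q0)//.
      by rewrite mulr_ge0 ?exprn_ge0 ?mulr_ge0 ?(ltW m0)// ltW// (lt_trans _ t1).
    rewrite ler_pdivlMr// in tQ; apply: le_trans tQ; rewrite le_eqVlt; apply/orP; left.
    by apply/eqP; ring.
  rewrite -(ler_pM2l C0); have := hk0 _ vk; rewrite ltr_pdivrMr// => /ltW tC.
  apply: le_trans (ler_wpM2r SB0 tC) _.
  by rewrite mulrAC mulrC [leRHS]mulrCA ler_wpM2l ?(ltW e2)// [C * _]mulrC.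
have Gle : q ^+ i * \sum_(o <- G) (X N o.1 o.2)%:R <= (count W (saws n (0 : pt)))%:R.
  pose G' := [seq (o.1, (o.2 - i)%N) | o <- G].
  have uG' : uniq G'.
    rewrite map_inj_in_uniq ?filter_uniq// => -[T j] [T' j'].
    rewrite !mem_filter /good /= => /andP[/andP[ij _] _] /andP[/andP[ij' _] _] [-> jj].
    by rewrite -(subnK ij) jj subnK.
  apply: le_trans (_ : \sum_(o <- G') (X n o.1 o.2)%:R <= _); last first.
    rewrite -natr_sum sum_nshell// ler_nat; apply: sub_count => w /andP[-> //].
  rewrite big_map mulr_sumr big_seq [leRHS]big_seq; apply: ler_sum => -[T j].
  rewrite mem_filter /good /= => /andP[/andP[ij h] _].
  by have := nshell_down n i (ltW q_gt0) h; rewrite subnK.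
apply: le_trans Gle; rewrite ler_wpM2l ?exprn_ge0 ?(ltW q_gt0)//.
by move: Wle Ble; clear; move: (\sum_(_ <- B) _) (\sum_(_ <- G) _) => *; lra.
Qed.
End Ratio.

(** * Cuts and blocks *)

(** The coming injections involve choices of a decomposition; as relations they only have to be
    total and decodable. *)
Lemma ler_count_rel (T : eqType) (U : choiceType) (y0 : U) (s : seq T) (t : seq U)
    (P : pred T) (Q : pred U) (r : T -> U -> Prop) : uniq s ->
  {in s, forall x, P x -> exists y, [/\ y \in t, Q y & r x y]} ->
  (forall x x' y, x \in s -> x' \in s -> r x y -> r x' y -> x = x') ->
  (count P s <= count Q t)%N.
Proof.
move=> us st rI; pose S x := [set y | [/\ y \in t, Q y & r x y]]%classic.
have SP x : x \in s -> P x -> S x (xget y0 (S x)).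
  by move=> xs Px; have [y Sy] := st x xs Px; apply: (xgetI y0 Sy).
apply: (ler_count_inj (f := fun x => xget y0 (S x))) => //.
  move=> x x' /andP[xs Px] /andP[xs' Px'] e.
  have [_ _ r1] := SP _ xs Px; have [_ _ r2] := SP _ xs' Px'.
  by apply: (rI _ _ (xget y0 (S x'))) => //; rewrite -e.
by move=> x xs Px; have [-> ->] := SP x xs Px.
Qed.

Section Marks.
Variable d : nat.
Notation pt := 'rV[int]_d.+2.
Notation adj := (@adj d).
Notation lev := (@lev d).
Implicit Types (x y z t : pt) (w u v p q a b S ds : seq pt) (C : seq pt -> Prop).

(** Levels separate S from the rest of the walk. If S is a single point it is a cut; if S is a
    block, both of its ends are cuts. *)
Definition marked S w a b := [/\ w = a ++ S ++ b,
  {in a, forall y, lev y <= lev (head 0 S)} & {in b, forall y, lev (last 0 S) < lev y}].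

Definition hasmark C w := `[< exists S a b, C S /\ marked S w a b >].

Definition ascending S := (S != [::]) && sorted (fun x y => lev x <= lev y) S.

(** A descent is not contained in an ascending segment. It does not enter or leave it either,
    because points before lie weakly below its start and points after lie strictly above its end. *)
Lemma marked_descent S p x y q a b : ascending S -> lev y < lev x ->
  marked S (p ++ x :: y :: q) a b ->
  (exists r, a = p ++ x :: y :: r /\ q = r ++ S ++ b) \/
  (exists r, b = r ++ x :: y :: q /\ p = a ++ S ++ r).
Proof.
case/andP => S0 So yx [e la hb]; rewrite -cat_rcons in e.
have noS (r : seq pt) : a = rcons p x -> S ++ b = y :: r -> False.
  case: S S0 la {So hb e} => // y' S' _ /= la aE [yE _].
  have := la x; rewrite aE mem_rcons mem_head yE => /(_ isT) h.
  by move: (le_lt_trans h yx); rewrite ltxx.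
case: (cat_split e) => -[r [e1 e2]]; last first.
  case: r e1 e2 => [|y' r]; first by rewrite cats0 => aE /esym/noS; case/(_ aE).
  by rewrite cat_rcons => -> [-> ->]; left; exists r.
case/lastP: r e1 e2 => [|r x'].
  by rewrite cats0 => /esym aE /noS; case/(_ aE).
rewrite -rcons_cat => /rcons_inj[pE <-] e2.
have noB b' : S = rcons r x -> b = y :: b' -> False.
  move=> SE bE; have := hb y; rewrite bE mem_head SE last_rcons => /(_ isT).
  by move=> /(lt_trans yx); rewrite ltxx.
case: (cat_split e2) => -[t [e3 e4]].
  case: t e3 e4 => [|y' t]; first by rewrite cats0 => SE /esym/(noB _ SE).
  move=> SE [yE _]; move: So; rewrite SE cat_rcons sorted_cat_cons -yE /=.
  by rewrite leNgt yx andbF.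
case/lastP: t e3 e4 => [|t x1]; first by rewrite cats0 => /esym SE /(noB _ SE).
rewrite -rcons_cat => /rcons_inj[rE <-]; rewrite cat_rcons => bE.
by right; exists t; rewrite bE pE rE.
Qed.

(** The flipped descent lies entirely before or after the mark, and the two corners that come or go
    have the levels of its ends. *)
Lemma hasmark_flip C u z v : (forall S, C S -> ascending S) ->
  hasmark C (wII u z v) = hasmark C (wI u z v).
Proof.
move=> CA; rewrite /hasmark /wII /wI; apply/asboolP/asboolP => -[S [a [b [CS mS]]]].
  move: mS; rewrite -[square z ++ v]/([:: z] ++ [:: s1 z, s2 z & [:: s3 z & v]]) catA.
  move=> mS; have [_ la hb] := mS.
  have s21 : lev (s2 z) < lev (s1 z) by rewrite !slotE; lia.
  case: (marked_descent (CA _ CS) s21 mS) => -[r [e1 e2]].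
    case: r e1 e2 => [|y r] /= aE => [e|[ye ve]].
      have := la (s1 z); rewrite aE !(mem_cat, inE) !eqxx ?orbT => /(_ isT).
      have /andP[] := CA _ CS; case: S e {mS CS hb la} => //= y S [<- _] _ _.
      by rewrite !slotE; lia.
    exists S, (u ++ [:: z, s3 z & r]), b; split=> //; split=> //.
      by rewrite ve -!catA.
    move=> y' y'a; apply: la; move: y'a; rewrite aE -ye !(mem_cat, inE).
    by do ![case/orP] => ->; rewrite ?orbT.
  case/lastP: r e1 e2 => [|r y] bE.
    rewrite cats0 => e; have := hb (s1 z); rewrite bE mem_head => /(_ isT).
    have := congr1 (last 0) e; rewrite !last_cat /=.
    have /andP[] := CA _ CS; case: (S) => //= y S' _ _ <-.
    by rewrite slotE ltxx.
  rewrite -!rcons_cat cats1 => /rcons_inj[uE yE]; exists S, a, (r ++ [:: z, s3 z & v]);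
    split=> //; split=> //.
    by rewrite uE -!catA.
  move=> y' y'b; apply: hb; move: y'b; rewrite bE yE cat_rcons !(mem_cat, inE).
  by do ![case/orP] => ->; rewrite ?orbT.
have [_ la hb] := mS.
have s30 : lev (s3 z) < lev z by rewrite !slotE; lia.
case: (marked_descent (CA _ CS) s30 mS) => -[r [e1 e2]].
  exists S, (u ++ square z ++ r), b; split=> //; split=> //.
    by rewrite e2 -!catA.
  have hz : lev z <= lev (head 0 S) by apply: la; rewrite e1 !(mem_cat, inE) eqxx ?orbT.
  move=> y; rewrite !(mem_cat, inE) -!orbA.
  case/or4P => [yu|/eqP ->//|/eqP ->|/or3P[/eqP ->|/eqP ->|yr]]; rewrite ?slotE//.
  - by apply: la; rewrite e1 mem_cat yu.
  - by move: hz; clear; lia.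
  - by move: hz; clear; lia.
  - by apply: la; rewrite e1 !(mem_cat, inE) yr !orbT.
exists S, a, (r ++ square z ++ v); split=> //; split=> //.
  by rewrite e2 -!catA.
have hz : lev (last 0 S) < lev (s3 z) by apply: hb; rewrite e1 !(mem_cat, inE) eqxx ?orbT.
move=> y; rewrite !(mem_cat, inE) -!orbA; move: hz; rewrite slotE => hz.
case/or4P => [yu|/eqP ->|/eqP ->|/or3P[/eqP ->|/eqP ->|yr]]; rewrite ?slotE//.
- by apply: hb; rewrite e1 mem_cat yu.
- by move: hz; clear; lia.
- by move: hz; clear; lia.
- by apply: hb; rewrite e1 !(mem_cat, inE) yr !orbT.
Qed.

Lemma first_mark C w : hasmark C w -> exists S a b, [/\ C S, marked S w a b &
  forall S' a' b', C S' -> marked S' w a' b' -> (size a <= size a')%N].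
Proof.
move/asboolP => [S [a [b [CS mS]]]].
pose P i := `[< exists S a b, [/\ C S, marked S w a b & size a = i] >].
have exP : exists i, P i by exists (size a); apply/asboolP; exists S, a, b.
case: (ex_minnP exP) => i /asboolP[S1 [a1 [b1 [C1 m1 s1]]]] h.
exists S1, a1, b1; split=> // S' a' b' C' m'; rewrite s1; apply: h.
by apply/asboolP; exists S', a', b'.
Qed.

(** The parts are stacked by level: a weakly below x, the new middle strictly above x, the
    translated rest strictly above the end of the middle. Hence self-avoidance has to be required of
    the middle only. *)
Lemma splice n x0 a x m b m' (t := last x m' - last x m) :
  issaw (size a + size m + n) x0 (a ++ (x :: m) ++ b) ->
  {in a, forall y, lev y <= lev x} -> {in b, forall y, lev (last x m) < lev y} ->
  path adj x m' -> uniq m' -> {in m', forall y, lev x < lev y} ->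
  {in x :: m', forall y, lev y <= lev (last x m')} ->
  issaw (size a + size m' + n) x0 (a ++ (x :: m') ++ shift t b).
Proof.
case/and4P => sz hd so un la hb pm um hm lm; apply/and4P; split.
- by move: sz; rewrite !size_cat size_map /=; clear; lia.
- by case: (a) hd.
- move: so; rewrite /= !sorted_cat_cons !cat_path pm /= => /and3P[-> _ pb] /=.
  have -> : last x m' = last x m + t by rewrite /t addrC subrK.
  by rewrite -[path _ _ _]/(sorted adj (shift t (last x m :: b))) sorted_shift.
- have hb' : {in shift t b, forall y, lev (last x m') < lev y}.
    move=> y; rewrite mem_shift => /hb; rewrite /t !levlatE.
    by move: (lev y) (lev (last x m)) (lev (last x m')) => *; lia.
  have lx : lev x <= lev (last x m') by apply: lm; rewrite mem_head.
  move: un; rewrite !cat_uniq uniq_shift => /and3P[-> xa /and3P[_ _ ->]].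
  rewrite cons_uniq um !andbT andTb; apply/and3P; split.
  + apply/hasPn => y; rewrite inE mem_cat => /or3P[/eqP ->|ym|yb]; apply/negP => /= ya.
    * by move/hasPn: xa => /(_ x); rewrite inE eqxx /= ya => /(_ isT).
    * by move: (le_lt_trans (la _ ya) (hm _ ym)); rewrite ltxx.
    * by move: (le_lt_trans (le_trans (la _ ya) lx) (hb' _ yb)); rewrite ltxx.
  + by apply/negP => /hm; rewrite ltxx.
  + apply/hasPn => y yb; apply/negP => ym.
    by move: (le_lt_trans (lm _ ym) (hb' _ yb)); rewrite ltxx.
Qed.
End Marks.

(** * Staircases and blocks *)

Section Blocks.
Variable d : nat.
Notation pt := 'rV[int]_d.+2.
Notation adj := (@adj d).
Notation lev := (@lev d).
Notation lat := (@lat d).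
Notation e0 := (@e0 d).
Notation e1 := (@e1 d).
Notation issaw := (@issaw d).
Implicit Types (x y z t : pt) (w u v p q a b S ds : seq pt) (K r : nat).

Definition trail x ds := x :: scanl +%R x ds.
Definition staircase ds := all (mem [:: e0; e1]) ds.
(** The length K + 1 does not depend on r, whereas the latitude of the end does. For r > 0 the
    pattern e0 e1 occurs only at the beginning, which prevents different blocks of a walk from
    overlapping in more than an end point. *)
Definition steps K r := e0 :: nseq r e1 ++ nseq (K - r) e0.
Definition block K S := exists x r, (0 < r <= K)%N /\ S = trail x (steps K r).
Definition cutpoint S := exists x, S = [:: x].

Lemma e01 : e0 != e1.
Proof. by apply/eqP => /(congr1 lev); rewrite !levlatE. Qed.

Lemma staircase_steps K r : staircase (steps K r).
Proof.
by rewrite /staircase /= all_cat !all_nseq !inE !eqxx ?orbT.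
Qed.

Lemma size_steps K r : (r <= K)%N -> size (steps K r) = K.+1.
Proof. by move=> rK; rewrite /= size_cat !size_nseq subnKC. Qed.

Lemma last_scanl x ds : last x (scanl +%R x ds) = x + \sum_(e <- ds) e.
Proof. by elim: ds x => [|e ds IH] x /=; rewrite ?big_nil ?addr0// IH big_cons addrA. Qed.

Lemma last_trail x ds : last 0 (trail x ds) = x + \sum_(e <- ds) e.
Proof. exact: last_scanl. Qed.

Lemma lat_steps K r : lat (\sum_(e <- steps K r) e) = r%:Z.
Proof.
have h y m : \sum_(e <- nseq m y) e = y *+ m by rewrite big_nseq iter_addr_0.
rewrite big_cons big_cat !h !latD lat_e0 add0r /lat !mulmxnE -/(lat e1) -/(lat e0).
by rewrite lat_e0 lat_e1 mul0rn addr0 natz.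
Qed.

Lemma trail_inj x x' ds ds' : trail x ds = trail x' ds' -> x = x' /\ ds = ds'.
Proof.
elim: ds x x' ds' => [|e ds IH] x x' [|e' ds'] //=; first by case.
by case=> <- /addrI <- h; have [_ <-] := IH (x + e) (x + e) ds' (congr1 (cons (x + e)) h).
Qed.

Lemma steps_inj K r r' : steps K r = steps K r' -> r = r'.
Proof.
move=> /(congr1 (fun ds => lat (\sum_(e <- ds) e))); rewrite !lat_steps.
by move/eqP; rewrite eqz_nat => /eqP.
Qed.

Lemma shift_trail t x ds : shift t (trail x ds) = trail (x + t) ds.
Proof.
elim: ds x => // e ds IH x; rewrite -[LHS]/(_ :: shift t (trail (x + e) ds)) IH.
by rewrite -[RHS]/(_ :: trail (x + t + e) ds) addrAC.
Qed.

Lemma trail_split x ds p y q : trail x ds = p ++ y :: q ->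
  exists ds1 ds2, [/\ ds = ds1 ++ ds2, size ds1 = size p & y :: q = trail y ds2].
Proof.
elim: p x ds => [|x' p IH] x ds.
  by move=> /= e; exists [::], ds; split=> //; move: e; rewrite /trail => -[-> <-].
case: ds => [|e ds] /= [_]; first by case: p {IH}.
by move=> /(IH (x + e)) [ds1 [ds2 [-> s1 h]]]; exists (e :: ds1), ds2; rewrite /= s1.
Qed.

Lemma trail_path x ds : staircase ds ->
  path (fun y z => [&& adj y z, lev y <= lev z & lev y + lat y < lev z + lat z])
    x (scanl +%R x ds).
Proof.
elim: ds x => //= e ds IH x /andP[ee /IH ->]; rewrite andbT.
move: ee; rewrite !inE => /orP[] /eqP ->; rewrite ?adj_e0 ?adj_e1 !levlatE /=.
  by clear; lia.
by clear; lia.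
Qed.

Lemma trail_adj x ds : staircase ds -> path adj x (scanl +%R x ds).
Proof. by move=> /(trail_path x); apply: sub_path => y z /and3P[]. Qed.

Lemma trail_lev x ds : staircase ds -> path (fun y z => lev y <= lev z) x (scanl +%R x ds).
Proof. by move=> /(trail_path x); apply: sub_path => y z /and3P[]. Qed.

Lemma trail_uniq x ds : staircase ds -> uniq (trail x ds).
Proof.
move=> /(trail_path x) h; apply: (@sorted_uniq _ (fun y z => lev y + lat y < lev z + lat z)).
- by move=> y z t; apply: lt_trans.
- by move=> y; rewrite ltxx.
- by move: h; apply: sub_path => y z /and3P[].
Qed.

Lemma ascending_trail x ds : staircase ds -> ascending (trail x ds).
Proof. by move=> h; rewrite /ascending /= trail_lev. Qed.

Lemma trail_ge x ds : staircase ds -> {in trail x ds, forall y, lev x <= lev y}.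
Proof.
move=> /(trail_lev x) h y; rewrite inE => /orP[/eqP ->//|ys].
have tr : transitive (fun y z => lev y <= lev z) by move=> a1 a2 a3; apply: le_trans.
by move: h; rewrite (path_sortedE tr) => /andP[/allP/(_ y ys)].
Qed.

Lemma trail_le x ds : staircase ds ->
  {in trail x ds, forall y, lev y <= lev (last 0 (trail x ds))}.
Proof.
elim: ds x => [|e ds IH] x; first by move=> _ y; rewrite inE => /eqP ->.
move=> h; have h' : staircase ds by case/andP: h.
move=> y; rewrite inE => /orP[/eqP ->|]; last exact: (IH (x + e)).
by apply: (trail_ge h); exact: (mem_last x (scanl +%R x (e :: ds))).
Qed.

Lemma steps_gt x K r : {in scanl +%R x (steps K r), forall y, lev x < lev y}.
Proof.
move=> y; rewrite -[_ \in _]/(y \in trail (x + e0) _) => ys.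
have h : staircase (nseq r e1 ++ nseq (K - r) e0).
  by rewrite /staircase all_cat !all_nseq !inE !eqxx ?orbT.
by have := trail_ge h ys; rewrite !levlatE; move: (lev x) (lev y) => *; lia.
Qed.

Lemma ascending_block K S : block K S -> ascending S.
Proof. by case=> x [r [_ ->]]; apply/ascending_trail/staircase_steps. Qed.

Lemma ascending_cutpoint S : cutpoint S -> ascending S.
Proof. by case=> x ->. Qed.

Lemma runs_e01 r m ds1 ds2 : nseq r e1 ++ nseq m e0 <> ds1 ++ e0 :: e1 :: ds2.
Proof.
pose R y z := (y == e1) || (z == e0).
have h0 k : sorted R (nseq k e0).
  by case: k => //= k; elim: k => //= k ->; rewrite /R eqxx orbT.
have h : sorted R (nseq r e1 ++ nseq m e0).
  elim: r => //= r IH; have h1 ds : sorted R ds -> path R e1 ds.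
    by case: ds => //= y ds ->; rewrite /R eqxx.
  exact: h1.
move=> e; move: h; rewrite e sorted_cat_cons /= /R (negPf e01) eq_sym (negPf e01).
by rewrite !andbF.
Qed.

(** The earlier block cannot pass x. If it ended at x + e0, the lateral step that follows because r
    > 0 would not rise above its end; if it went further, it would contain e0 e1 after its first
    step. *)
Lemma block_before K w x r a b x' r' a' b' : (0 < r)%N ->
  marked (trail x (steps K r)) w a b -> marked (trail x' (steps K r')) w a' b' ->
  (size a' < size a)%N -> exists p, rcons a x = a' ++ trail x' (steps K r') ++ p.
Proof.
move=> r0 [-> la hb] [e la' hb'] sa.
case: (cat_split e) => -[p [aE]]; last first.
  by move=> _; move: sa; rewrite aE size_cat -ltn_subRL subnn.
case: p aE => [|y p] aE; first by move: sa; rewrite aE cats0 ltnn.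
rewrite -[trail x _ ++ b]/(x :: (x + e0) :: scanl +%R (x + e0) (nseq r e1 ++ nseq (K - r) e0) ++ b).
rewrite -[(y :: p) ++ _ :: _]cat_rcons => /cat_split[] [q [e1' e2']]; last first.
  by exists q; rewrite aE rcons_cat e1'.
case: r r0 {e la hb} e2' => // r _.
rewrite -[scanl _ _ _ ++ b]/(x + e0 + e1 ::
  scanl +%R (x + e0 + e1) (nseq r e1 ++ nseq (K - r.+1) e0) ++ b).
case: q e1' => [|z q] SE.
  by move=> _; exists [::]; rewrite SE !cats0 aE rcons_cat.
case=> xz; rewrite -xz in SE * => {z xz}.
case: q SE => [|z q] SE.
  rewrite cat0s => bE; have := hb' (x + e0 + e1); rewrite -bE mem_head => /(_ isT).
  by rewrite SE last_cat /= !levlatE addr0 ltxx.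
case=> zE _; exfalso; rewrite -zE cat_rcons in SE.
have [ds1 [ds2 [e s1 e2]]] := trail_split SE.
case: ds1 e s1 => // e' ds1 [_ e] _.
case: ds2 e e2 => [|f1 ds2] e //= [/addrI f1E]; rewrite -f1E in e *.
case: ds2 e => [|f2 ds2] e //= [/addrI f2E]; rewrite -f2E in e * => _.
exact: runs_e01 e.
Qed.

(** An earlier block ends at x at the latest, and a change of r alters only what lies above x. The
    first block thus remains first under such a change. *)
Lemma block_stable K w w' x r r' a b b' S p q : (0 < r)%N ->
  marked (trail x (steps K r)) w a b -> marked (trail x (steps K r')) w' a b' ->
  block K S -> marked S w p q -> (size p < size a)%N -> exists q', marked S w' p q'.
Proof.
move=> r0 m1 m2 [y [s [_ SE]]] m3 sp; rewrite SE in m3 *.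
have [u ax] := block_before r0 m1 m3 sp.
have [wE _ _] := m1; have [w'E _ hb'] := m2; have [wE' lp hq] := m3.
have qE : q = u ++ scanl +%R x (steps K r) ++ b.
  move: wE'; rewrite wE /trail cat_cons -cat_rcons ax -!catA => /eqP.
  by rewrite -/(trail y _) !eqseq_cat// !eqxx => /eqP.
exists (u ++ scanl +%R x (steps K r') ++ b'); split=> //.
  by rewrite w'E /trail cat_cons -cat_rcons ax -!catA.
have lx : lev (last 0 (trail y (steps K s))) <= lev x.
  have := congr1 (last 0) ax; rewrite last_rcons !last_cat => ->.
  case: u {ax} qE => [|z u] qE //=; apply/ltW/hq.
  by rewrite qE mem_cat mem_last.
move=> z; rewrite !mem_cat => /or3P[zu|zs|zb].
- by apply: hq; rewrite qE mem_cat zu.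
- by apply: le_lt_trans lx _; apply: steps_gt zs.
- apply: le_lt_trans lx _; apply: le_lt_trans (hb' _ zb).
  by apply: trail_le; [exact: staircase_steps|exact: mem_head].
Qed.

Lemma last_splice a x m b m' (t := last x m' - last x m) :
  last 0 (a ++ (x :: m') ++ shift t b) = last 0 (a ++ (x :: m) ++ b) + t.
Proof.
rewrite !last_cat /=.
have -> : last x m' = last x m + t by rewrite /t addrC subrK.
exact: last_shift.
Qed.

(* Replacing the parameter r of the first block by any r' <= K moves the endpoint
   laterally by r' - r and leaves the place of the first block unchanged, so the
   original walk can be read off from the new one and l. *)
Lemma block_count K n (l : int) :
  
  (K * count (fun w => hasmark (block K) w && (lat (last 0%R w) == l)) (saws n 0%R) <= c d n)%N.
Proof.
set P := fun w => _.
have -> : (K * count P (saws n 0%R))%N =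
    count (fun o => P o.1) [seq (w, r) | w <- saws n (0 : pt), r <- iota 1 K].
  rewrite (count_pairs _ _ (fun w _ => P w)) -sum1_count big_distrr big_mkcond /=.
  apply: eq_bigr => w _; case: (P w); last by rewrite count_pred0.
  by rewrite count_predT size_iota muln1.
rewrite -[c d n]count_predT.
pose R (o : seq pt * nat) w' := let: (w, r') := o in exists x r a b, [/\ (0 < r <= K)%N,
  marked (trail x (steps K r)) w a b,
  forall S' a' b', block K S' -> marked S' w a' b' -> (size a <= size a')%N,
  marked (trail x (steps K r')) w' a
    (shift (last 0 (trail x (steps K r')) - last 0 (trail x (steps K r))) b) &
  lat (last 0 w) = l].
apply: (ler_count_rel (r := R) [::]).
- by rewrite allpairs_uniq ?saws_uniq ?iota_uniq// => -[u i] [v j].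
- move=> _ /allpairsP[[w r'] /= [+ + ->]] /=; rewrite mem_saws mem_iota add1n ltnS.
  move=> ws r'K /andP[/first_mark[S [a [b [[x [r [rK SE]]] m h]]]] /eqP ll].
  rewrite SE in m.
  exists (a ++ trail x (steps K r') ++
     shift (last 0 (trail x (steps K r')) - last 0 (trail x (steps K r))) b).
  have [wE la hb] := m; split=> //.
    have /andP[_ rK1] := rK; have /andP[_ rK2] := r'K.
    have := @splice d (size b) 0 a x (scanl +%R x (steps K r)) b (scanl +%R x (steps K r')).
    rewrite !size_scanl !size_steps// => h'.
    have sn : (size a + K.+1 + size b)%N = n.
      case/andP: ws => /eqP; rewrite wE !size_cat /= size_scanl size_cat !size_nseq.
      by move: rK1; clear; lia.
    rewrite mem_saws sn in h' *; apply: h' => //.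
    - by rewrite -/(trail x _) -wE.
    - exact: trail_adj (staircase_steps _ _).
    - by have := trail_uniq x (staircase_steps K r'); rewrite cons_uniq => /andP[].
    - exact: steps_gt.
    - exact: trail_le (staircase_steps _ _).
  exists x, r, a, b; split=> //; split=> // y; rewrite mem_shift => /hb /=.
  by rewrite !levlatE; move: (lev y) (lev (last _ _)) (lev (last _ _)) => *; lia.
- move=> [w r1] [v r2] w' wi vi [x [r [a [b [/andP[r0 rK] m h m' ll]]]]].
  move=> [y [s [a2 [b2 [/andP[s0 sK] m2 h2 m2' ll2]]]]].
  move: wi vi => /allpairsP[[w0 r0'] /= [_ + [wE0 rE0]]].
  rewrite -rE0 mem_iota add1n ltnS => r1K {w0 r0' wE0 rE0}.
  move=> /allpairsP[[w0 r0'] /= [_ + [wE0 rE0]]].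
  rewrite -rE0 mem_iota add1n ltnS => r2K {w0 r0' wE0 rE0}.
  have [r10 r1K'] := andP r1K; have [r20 r2K'] := andP r2K.
  (* If the recorded places differed, [block_stable] would carry the block at the earlier place into
     the other original walk, before its first block. *)
  have sa : size a = size a2.
    case: (ltngtP (size a) (size a2)) => // lt; exfalso; last first.
      have [|q' mq] := block_stable r10 m' m _ m2' lt; first by exists y, r2.
      have hS : block K (trail y (steps K r2)) by exists y, r2.
      by move: (h _ _ _ hS mq); rewrite leqNgt lt.
    have [|q' mq] := block_stable r20 m2' m2 _ m' lt; first by exists x, r1.
    have hS : block K (trail x (steps K r1)) by exists x, r1.
    by move: (h2 _ _ _ hS mq); rewrite leqNgt lt.
  case: m m' m2 m2' => wE _ _ [w'E _ _] [vE _ _] [w'E2 _ _].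
  (* Both originals end at latitude l. As the new blocks coincide, r1 = r2, and comparing the two
     displacements gives r = s. *)
  have lw' : lat (last 0 w') = l + (r1%:Z - r%:Z).
    have -> : last 0 w' = last 0 w + (last 0 (trail x (steps K r1)) - last 0 (trail x (steps K r))).
      by rewrite w'E wE; exact: (last_splice a x (scanl +%R x (steps K r)) b).
    by rewrite !last_trail !levlatE ll !lat_steps; clear; lia.
  have lw2 : lat (last 0 w') = l + (r2%:Z - s%:Z).
    have -> : last 0 w' = last 0 v + (last 0 (trail y (steps K r2)) - last 0 (trail y (steps K s))).
      by rewrite w'E2 vE; exact: (last_splice a2 y (scanl +%R y (steps K s)) b2).
    by rewrite !last_trail !levlatE ll2 !lat_steps; clear; lia.
  move: w'E2; rewrite w'E => /eqP; rewrite eqseq_cat// => /andP[/eqP aE].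
  rewrite eqseq_cat; last by rewrite /= !size_scanl !size_cat !size_nseq !subnKC.
  move=> /andP[/eqP /trail_inj[xy /steps_inj r12] /eqP].
  have rs : r = s by move: lw2; rewrite lw' r12; clear; lia.
  rewrite -xy -r12 -rs => /(can_inj (shiftK _)) bE.
  by rewrite wE vE aE xy rs bE r12.
Qed.
End Blocks.

(** * Insertion at the first cut and unfolding at the last maximum *)

Section Insertion.
Variable d : nat.
Notation pt := 'rV[int]_d.+2.
Notation adj := (@adj d).
Notation lev := (@lev d).
Notation lat := (@lat d).
Notation e0 := (@e0 d).
Notation e1 := (@e1 d).
Notation issaw := (@issaw d).
Implicit Types (x y z t : pt) (w u v p q a b S ds : seq pt) (K r : nat).

Definition cut_only K w := hasmark (@cutpoint d) w && ~~ hasmark (@block d K) w.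

(** The inserted block has r = K, so that its first step is its only step up and no other block can
    start inside it. A later block of the new walk therefore lies in the translated end of w, where
    w would already have had it. *)
Lemma block_after K x z w w' a b a1 S a2 b2 (t := last 0 (trail z (steps d K K)) - x) :
  marked [:: x] w a b -> marked (trail z (steps d K K)) w' a1 (shift t b) ->
  marked S w' a2 b2 -> block K S -> (size a1 < size a2)%N -> hasmark (@block d K) w.
Proof.
move=> [wE la hb] [w'E _ _] [w'E2 la2 hb2] [y [r [rK SE]]] sa.
set z' := last 0 (trail z (steps d K K)).
have zE : trail z (steps d K K) = rcons (belast z (scanl +%R z (steps d K K))) z'.
  by rewrite -lastI.
move: w'E2; rewrite w'E => /cat_split[] [p [pE e]].
  by move: sa; rewrite pE size_cat -ltn_subRL subnn.
have p0 : (0 < size p)%N by move: sa; rewrite pE size_cat -ltn_subLR// subnn.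
move: e; rewrite {1}zE cat_rcons; set T := belast _ _ in zE *.
have main h0 : z' :: shift t b = h0 ++ S ++ b2 -> {in h0, forall y', lev y' <= lev y} ->
    hasmark (@block d K) w.
  move=> e hr.
  have xb : x :: b = shift (- t) h0 ++ shift (- t) S ++ shift (- t) b2.
    by rewrite -!map_cat -e /= -/(shift t b) -/(shift (- t) _) shiftK /t opprB addrCA subrr addr0.
  apply/asboolP; exists (shift (- t) S), (a ++ shift (- t) h0), (shift (- t) b2).
  rewrite SE shift_trail in xb *; split; first by exists (y - t), r.
  have hy : lev x <= lev (y - t).
    have : y - t \in x :: b by rewrite xb !mem_cat mem_head orbT.
    by rewrite inE => /orP[/eqP <-//|/hb /ltW].
  split; first by rewrite wE -[[:: x] ++ b]/(x :: b) xb -!catA.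
    move=> y'; rewrite mem_cat => /orP[/la /le_trans|]; first by apply.
    rewrite mem_shift opprK => /hr; rewrite /= !levlatE.
    by move: (lev y') (lev y) (lev t) => *; lia.
  move=> y'; rewrite mem_shift opprK => /hb2; rewrite SE !last_trail !levlatE.
  by move: (lev y') (lev y) (lev t) (lev _) => *; lia.
have hp : {in p, forall y', lev y' <= lev y}.
  by move=> y' y'p; have := la2 y'; rewrite pE mem_cat y'p orbT SE => /(_ isT).
case/cat_split => -[h0 [e1' e2']]; last first.
  by apply: (main h0) => // y' y'r; apply: hp; rewrite e1' mem_cat y'r orbT.
case: h0 e1' e2' => [|y0 h0] TE.
  by move=> /esym e; apply: (main [::]).
rewrite SE -[trail y _ ++ b2]/(y :: y + e0 :: scanl +%R (y + e0) (nseq r e1 ++ nseq (K - r) e0)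
  ++ b2).
case=> yy0 h; exfalso.
have [q qE] : exists q, rcons T z' = p ++ y :: y + e0 :: q.
  case: h0 TE h => [|y1 h0] TE [-> _]; first by exists [::]; rewrite TE yy0 -cats1 -catA.
  by exists (rcons h0 z'); rewrite TE yy0 rcons_cat.
rewrite -zE in qE; have [ds1 [ds2 [dE s1 h2]]] := trail_split qE.
case: ds2 dE h2 => [|f ds2] dE //= [/addrI fE _].
case: ds1 dE s1 => [|f1 ds1]; first by move=> _ s1; rewrite -s1 in p0.
case=> _; rewrite subnn cats0 -fE => dE _.
have : e0 \in nseq K e1 by rewrite dE mem_cat mem_head orbT.
by rewrite mem_nseq (negPf (@e01 d)) andbF.
Qed.

Definition marker K x v := trail (x + last 0 v) (steps d K K).

Definition inserted K x w v w' a b := let t := last 0 (marker K x v) - x in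
 [/\ marked [:: x] w a b,
   forall S' a' b', cutpoint S' -> marked S' w a' b' -> (size a <= size a')%N,
   marked [:: x] w' a (behead (shift x v ++ behead (marker K x v) ++ shift t b)),
   marked (marker K x v) w' (a ++ belast x (behead (shift x v))) (shift t b) &
   cut_only K w].

(* At the first cut of a walk without blocks insert a bridge followed by a block.
   The inserted block becomes the last one and the first cut stays the first, so
   even the length of the bridge can be recovered from the result. *)
Lemma insert_count K m I n : K.+1 = m.*2 -> ((I + m).*2 <= n)%N ->
  (\sum_(i <- iota 0 I) bridges d i.*2 * count (cut_only K) (saws (n - (i + m).*2) 0%R)
    <= c d n)%N.
Proof.
move=> Km In; set W := cut_only K.
pose s := [seq (i, o) | i <- iota 0 I, o <-
  [seq (w, v) | w <- saws (n - (i + m).*2) (0 : pt), v <- saws i.*2 (0 : pt)]].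
have -> : (\sum_(i <- iota 0 I) bridges d i.*2 * count W (saws (n - (i + m).*2) 0%R))%N =
    count (fun o => W o.2.1 && bridge o.2.2) s.
  rewrite (count_pairs _ _ (fun _ o => W o.1 && bridge o.2)); apply: eq_bigr => i _.
  rewrite (count_pairs _ _ (fun w v => W w && bridge v)) -sum1_count big_distrr big_mkcond /=.
  apply: eq_bigr => w _; case: (W w); last by rewrite count_pred0.
  by rewrite muln1.
have sP i w v : (i, (w, v)) \in s -> [/\ (i < I)%N, issaw (n - (i + m).*2) 0 w & issaw i.*2 0 v].
  case/allpairsPdep => i' [_ [+ /allpairsP[[w' v'] /= [+ + ->]] [-> -> ->]]].
  by rewrite mem_iota !mem_saws add0n.
rewrite -[c d n]count_predT.
pose R (o : nat * (seq pt * seq pt)) w' := exists x a b, inserted K x o.2.1 o.2.2 w' a b.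
apply: (ler_count_rel (r := R) [::]).
- apply: allpairs_uniq_dep; first exact: iota_uniq.
    by move=> i _; rewrite allpairs_uniq ?saws_uniq// => -[? ?] [].
  by move=> [i o] [j o'] _ _ [-> ->].
- move=> [i [w v]] /sP [iI ws vs] /= /andP[Ww /andP[bv1 bv2]].
  have /andP[/first_mark[_ [a [b [[x ->] mw h]]]] _] := Ww.
  have /and4P[sv /eqP v0 pv uv] := vs.
  case: v sv v0 pv uv vs bv1 bv2 => //= v0 v sv v00 pv uv vs bv1 bv2.
  rewrite v00 in pv uv vs bv1 bv2 * => {v0 v00}; rewrite /halfspace /= lev0 in bv1.
  have {}bv2 : all (fun y => lev y <= lev (last 0 v)) (0 :: v) := bv2.
  set z := x + last 0 v; set stp := steps d K K.
  have zE : last x (shift x v) = z by rewrite -{1}[x]add0r last_shift addrC.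
  have [wE la hb] := mw.
  have vx : {in shift x v, forall y, lev x < lev y}.
    move=> y; rewrite mem_shift => /(allP bv1); rewrite !levlatE.
    by move: (lev x) (lev y) => *; lia.
  have vz : {in x :: shift x v, forall y, lev y <= lev z}.
    move=> y; rewrite -{1}[x]add0r -[_ :: _]/(shift x (0 :: v)) mem_shift => /(allP bv2).
    by rewrite /z !levlatE; move: (lev x) (lev y) (lev _) => *; lia.
  have zgt : {in scanl +%R z stp, forall y, lev z < lev y} by exact: steps_gt.
  have trle : {in trail z stp, forall y, lev y <= lev (last 0 (trail z stp))}.
    exact: trail_le (staircase_steps _ _ _).
  set t := last 0 (trail z stp) - x.
  have hb' : {in shift t b, forall y, lev (last 0 (trail z stp)) < lev y}.
    move=> y; rewrite mem_shift => /hb; rewrite -[last 0 [:: x]]/x /t !levlatE.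
    by move: (lev x) (lev y) (lev (last _ _)) => *; lia.
  pose m' := shift x v ++ scanl +%R z stp.
  have lm' : last x m' = last 0 (trail z stp) by rewrite last_cat zE.
  exists (a ++ (x :: m') ++ shift t b).
  have xm' : {in m', forall y, lev x < lev y}.
    move=> y; rewrite mem_cat => /orP[/vx//|/zgt]; apply: le_lt_trans.
    by apply: vz; rewrite mem_head.
  have lez : lev z <= lev (last 0 (trail z stp)) by apply: trle; rewrite mem_head.
  split=> //.
    have := @splice d (size b) 0 a x [::] b m'; rewrite /= lm' -/t => h'.
    have sn : (size a + 0 + size b = n - (i + m).*2)%N.
      by case/andP: ws => /eqP; rewrite wE !size_cat /=; clear; lia.
    have sn' : (size a + size m' + size b)%N = n.
      rewrite size_cat size_map size_scanl size_steps// Km.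
      by case/eqP: sv => ->; move: sn In iI; clear; lia.
    rewrite mem_saws -sn'; apply: h' => //.
    - by rewrite sn -[_ ++ _ :: _]/(a ++ [:: x] ++ b) -wE.
    - rewrite cat_path zE (trail_adj _ (staircase_steps _ _ _)) andbT.
      by rewrite -[path _ _ _]/(sorted adj (x :: shift x v)) -{1}[x]add0r -[_ :: _]/(shift x (0
        :: v)) sorted_shift.
    - have [uv1 uv2] := andP uv.
      rewrite cat_uniq uniq_shift uv2 andTb.
      have := trail_uniq z (staircase_steps d K K); rewrite cons_uniq => /andP[_ ->].
      rewrite andbT; apply/hasPn => y /zgt yz; apply/negP => yv.
      by have := vz y; rewrite inE yv orbT leNgt yz => /(_ isT).
    - move=> y; rewrite inE mem_cat => /orP[/eqP ->|/orP[yv|ys]].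
      + exact: le_trans (vz _ (mem_head _ _)) lez.
      + by apply: le_trans lez; apply: vz; rewrite inE yv orbT.
      + by apply: trle; rewrite inE ys orbT.
  exists x, a, b; rewrite -[_.2.1]/w -[_.2.2]/(0 :: v).
  rewrite /inserted /marker -[last 0 (0 :: v)]/(last 0 v) -/z -/stp -/t.
  rewrite -[shift x (0 :: v)]/(0 + x :: shift x v) add0r; split=> //.
  + rewrite -[behead _]/(shift x v ++ scanl +%R z stp ++ shift t b); split=> //.
      by rewrite -[(x :: m') ++ _]/([:: x] ++ m' ++ _) -catA.
    move=> y; rewrite !mem_cat => /or3P[/vx//|ys|/hb' h'].
      by apply: xm'; rewrite mem_cat ys orbT.
    by apply: le_lt_trans h'; apply: le_trans lez; apply: vz; rewrite mem_head.
  + rewrite -[behead _]/(shift x v); split.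
    * rewrite -[x :: m']/((x :: shift x v) ++ scanl +%R z stp) lastI zE -!catA.
      by rewrite cat_rcons.
    * move=> y; rewrite mem_cat => /orP[/la h'|yv] /=.
        by apply: le_trans h' _; apply: vz; rewrite mem_head.
      by apply: vz; rewrite lastI mem_rcons inE yv orbT.
    * exact: hb'.
- move=> [i [w v]] [j [w1 v1]] w' /sP[_ ws vs] /sP[_ ws1 vs1].
  move=> [x [a [b [mw h mx mt /andP[_ nb]]]]] [x1 [a1 [b1 [mw1 h1 mx1 mt1 /andP[_ nb1]]]]].
  rewrite -[(i, (w, v)).2.1]/w -[(i, (w, v)).2.2]/v in mw h mx mt nb.
  rewrite -[(j, (w1, v1)).2.1]/w1 -[(j, (w1, v1)).2.2]/v1 in mw1 h1 mx1 mt1 nb1.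
  (* Up to x3 the walks u and w' agree, and the rest of u lies above x3, hence above x2: an earlier
     cut of w' is a cut of u. *)
  have early x2 a2 x3 a3 b3 q2 q3 u : marked [:: x3] u a3 b3 ->
      marked [:: x2] w' a2 q2 -> marked [:: x3] w' a3 q3 -> (size a2 < size a3)%N ->
      exists b2, marked [:: x2] u a2 b2.
    move=> [-> _ hb3] [-> la2 hq2] [/cat_split[] [p [pE e]] _ _] sa.
      by move: sa; rewrite pE size_cat -ltn_subRL subnn.
    case: p pE e => [|x4 p] pE; first by move: sa; rewrite pE cats0 ltnn.
    case=> xE q2E; rewrite -xE in pE; exists (p ++ x3 :: b3); split=> //.
      by rewrite pE -catA.
    have h3 : lev x2 < lev x3 by apply: hq2; rewrite q2E mem_cat mem_head orbT.
    move=> y; rewrite mem_cat inE => /or3P[yp|/eqP ->//|/hb3].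
      by apply: hq2; rewrite q2E mem_cat yp.
    exact: lt_trans.
  have sa : size a = size a1.
    case: (ltngtP (size a) (size a1)) => // lt; exfalso.
      have [b2 m2] := early _ _ _ _ _ _ _ _ mw1 mx mx1 lt.
      by move: (h1 _ _ _ (ex_intro _ x erefl) m2); rewrite leqNgt lt.
    have [b2 m2] := early _ _ _ _ _ _ _ _ mw mx1 mx lt.
    by move: (h _ _ _ (ex_intro _ x1 erefl) m2); rewrite leqNgt lt.
  have [aE xE] : a = a1 /\ x = x1.
    have [e1 _ _] := mx; have [e2 _ _] := mx1.
    move: e2; rewrite e1 => /eqP; rewrite eqseq_cat// => /andP[/eqP -> /eqP].
    by case.
  have Kb y : block K (trail y (steps d K K)) by exists y, K; rewrite leqnn andbT; split=> //;
    move: Km; clear; lia.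
  (* If the inserted blocks stood at different places, the later one would come from a block of the
     walk belonging to the earlier one, and that walk has none. *)
  have sb : size v = size v1.
    have /andP[/eqP sv _] := vs; have /andP[/eqP sv1 _] := vs1.
    case: (ltngtP (size v) (size v1)) => // lt; exfalso.
      case/negP: nb; apply: (block_after mw mt mt1 (Kb _)).
      rewrite !size_cat !size_belast !size_behead !size_map -aE ltn_add2l.
      by move: lt; rewrite sv sv1.
    case/negP: nb1; apply: (block_after mw1 mt1 mt (Kb _)).
    rewrite !size_cat !size_belast !size_behead !size_map -aE ltn_add2l.
    by move: lt; rewrite sv sv1.
  have ij : i = j.
    by move: sb; case/andP: vs => /eqP ->; case/andP: vs1 => /eqP -> _ _ [/double_inj].
  have [e1 _ _] := mt; have [e2 _ _] := mt1.
  move: e2; rewrite e1 -!catA -aE => /eqP; rewrite eqseq_cat// eqxx andTb.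
  rewrite eqseq_cat; last by rewrite !size_belast !size_behead !size_map sb.
  move=> /andP[/eqP vE]; rewrite eqseq_cat; last first.
    by rewrite /= !size_scanl.
  move=> /andP[/eqP tE /eqP bE].
  have [zE _] := trail_inj tE.
  have vv : v = v1.
    have sh u k : issaw k 0 u -> shift x u = rcons (belast x (behead (shift x u))) (x + last 0 u).
      case/and4P; case: u => [|u0 u] //= _ /eqP -> _ _; rewrite add0r lastI; congr rcons.
      by rewrite -{1}[x]add0r last_shift addrC.
    apply: (can_inj (shiftK x)); rewrite (sh _ _ vs) (sh _ _ vs1).
    by rewrite vE zE xE.
  rewrite -ij -vv; congr (_, (_, _)).
  have [wE _ _] := mw; have [wE1 _ _] := mw1.
  rewrite wE wE1 aE xE; congr (_ ++ _ ++ _).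
  by move: bE; rewrite -vv -xE => /(can_inj (shiftK _)).
Qed.

Definition unfold z u := shift z (turn z u).

Lemma last_unfold z u : last z (unfold z u) = rho (last z u - z) + z.
Proof.
have e : last (rho (z - z)) (turn z u) = rho (last z u - z) := last_map _ _ _.
have := last_shift z 0 (turn z u); rewrite add0r => ->.
by rewrite -e subrr rho0.
Qed.

(* If z is the last point of maximal level, reflecting what follows z makes z a
   cut; the reflected walk ends at level 2 lev z - lev x, which reveals lev z. *)
Lemma unfold_count n x :
  (count (fun w => last 0%R w == x) (saws n 0%R) <=
   count (fun w => hasmark (@cutpoint d) w && (lat (last 0%R w) == lat x)) (saws n 0%R))%N.
Proof.
pose R w w' := exists a z b, [/\ w = a ++ z :: b, {in a, forall y, lev y <= lev z},
  {in unfold z b, forall y, lev z < lev y}, w' = a ++ z :: unfold z b & last 0 w = x].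
apply: (ler_count_rel (r := R) [::]); first exact: saws_uniq.
- move=> w; rewrite mem_saws => ws /eqP wx.
  have := msplitP (head 0 w) (behead w).
  have -> : head 0 w :: behead w = w by case/andP: ws; case: (w).
  case: (msplit _ _) => [[a z] b] [wE [la hb]].
  have hu : {in unfold z b, forall y, lev z < lev y}.
    move=> y; rewrite mem_shift => /mapP[y' /hb y'b yE].
    rewrite -[y](subrK z) yE !levlatE lev_rho !levlatE; move: y'b.
    by move: (lev y') (lev z) => *; lia.
  have [s1 s2] : issaw (size a) 0 (rcons a z) /\ issaw (size b) z (z :: b).
    apply: (@issaw_cat _ _ _ _ _ _ _ _ erefl).
    by case/andP: (ws) => /eqP; rewrite {1}wE size_cat /= addnS => -[->]; rewrite -wE.
  have s3 : issaw (size b) z (z :: unfold z b).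
    have := issaw_turn s2; rewrite -(issaw_shift _ z) add0r.
    by rewrite /turn /= subrr rho0 add0r.
  have lw : lat (last 0 (a ++ z :: unfold z b)) = lat x.
    rewrite last_cat -[last _ _]/(last z (unfold z b)) last_unfold -wx wE last_cat /=.
    by rewrite !levlatE lat_rho !levlatE subrK.
  exists (a ++ z :: unfold z b); split.
  + rewrite mem_saws -cat_rcons; case/and4P: s1 => _ hd so1 un1;
    case/and4P: s3 => /= sz _ so3 /andP[zn un3].
    apply/and4P; split.
    * case/andP: ws => /eqP; rewrite wE !size_cat size_rcons /= => <- _.
      by rewrite !size_map; apply/eqP; lia.
    * by case: (a) hd.
    * by rewrite cat_rcons sorted_cat_cons so1.
    * rewrite cat_uniq un1 un3 andbT; apply/hasPn => y /hu yz; apply/negP => /=.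
      rewrite mem_rcons inE => /orP[/eqP yE|/la]; first by rewrite yE ltxx in yz.
      by rewrite leNgt yz.
  + rewrite lw eqxx andbT; apply/asboolP; exists [:: z], a, (unfold z b); split; first by exists z.
    by split.
  + by exists a, z, b.
- move=> w1 w2 w' _ _ [a [z [b [wE la hu w'E wx]]]] [a2 [z2 [b2 [wE2 la2 hu2 w'E2 wx2]]]].
  have lw a' z' b' w : w = a' ++ z' :: b' -> w' = a' ++ z' :: unfold z' b' -> last 0 w = x ->
      lev (last 0 w') = lev z' * 2 - lev x.
    move=> -> -> ; rewrite !last_cat /= last_unfold => ->; rewrite !levlatE lev_rho !levlatE.
    by move: (lev x) (lev z') => *; lia.
  have zz : lev z = lev z2.
    have := lw _ _ _ _ wE w'E wx; rewrite (lw _ _ _ _ wE2 w'E2 wx2).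
    by move: (lev z) (lev z2) => *; lia.
  (* Once the level of z is known, its position is too: the points of w' at or below this level are
     those up to z. *)
  have cnt a' z' b' : w' = a' ++ z' :: unfold z' b' -> {in a', forall y, lev y <= lev z'} ->
      {in unfold z' b', forall y, lev z' < lev y} -> count (fun y => lev y <= lev z') w' = (size
        a').+1.
    move=> -> la' hu'; rewrite count_cat /= lexx.
    rewrite (eq_in_count (a2 := predT)) ?count_predT; last by move=> y /la'.
    rewrite (eq_in_count (a2 := pred0)) ?count_pred0 ?addn1//.
    by move=> y /hu'; rewrite ltNge => /negPf.
  have sa : size a = size a2.
    have := cnt _ _ _ w'E la hu; rewrite zz (cnt _ _ _ w'E2 la2 hu2).
    by case.
  move: w'E2; rewrite w'E => /eqP; rewrite eqseq_cat// => /andP[/eqP aE /eqP[zE]].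
  rewrite -zE => /(can_inj (shiftK _)) /turn_inj bE.
  by rewrite wE wE2 aE zE bE.
Qed.
End Insertion.

(** * Endpoint probabilities *)

Section EndpointProbability.
Variables (R : realType) (d : nat).
Notation pt := 'rV[int]_d.+2.
Notation mu := (mu R d).
Notation c := (c d).

Lemma cut_only_small K m (e : R) : K.+1 = m.*2 -> 0 < e -> exists n0, forall n, (n0 <= n)%N ->
  (count (@cut_only d K) (saws n (0 : pt)))%:R <= e * (c n)%:R.
Proof.
move=> Km e_gt0; set W := @cut_only d K.
have W_flip u z v : aligned z -> uniq (wII u z v) -> sorted (@adj d) (wI u z v) ->
    W (wII u z v) = W (wI u z v).
  move=> _ _ _; rewrite /W /cut_only !hasmark_flip//; first exact: ascending_block.
  exact: ascending_cutpoint.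
have m0 := mu_gt0 R d; have e2 : 0 < e / 2 by rewrite divr_gt0.
have M0 : 0 < mu ^+ m.*2 by rewrite exprn_gt0.
(* The power of mu accounts for the length K + 1 = 2m of the inserted block, the first 2 for the
   loss s^(I+m) <= 2, and 2 / e for the excess that may remain. *)
have [I hI] := @even_bridges_diverge d R (2 * (2 / e) * mu ^+ m.*2).
have h12 : 1 < (2 : R) by lra.
have [s /andP[s1 _] hs] := small_root (I + m) h12.
have s0 : 0 < s by exact: lt_trans s1.
pose q := (mu ^+ 2 * s)^-1.
have q0 : 0 < q by rewrite invr_gt0 mulr_gt0 ?exprn_gt0.
have q1 : q * mu ^+ 2 < 1.
  by rewrite /q invfM mulrAC mulVf ?mul1r ?invf_lt1// gt_eqF ?exprn_gt0.
(* [class_ratio] has a threshold for each i; the i below I are finitely many and admit a common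
   one. *)
have [n0 hn0] : exists n0, forall i, (i < I)%N -> forall n, (n0 <= n)%N ->
    q ^+ (i + m) * ((count W (saws (n + (i + m).*2) (0 : pt)))%:R - e / 2 * (c (n + (i + m).*2))%:R)
    <= (count W (saws n (0 : pt)))%:R.
  elim: (I) => [|J [n1 h1]]; first by exists 0%N.
  have [n2 h2] := class_ratio W_flip (J + m) q0 q1 e2.
  exists (maxn n1 n2) => i; rewrite ltnS leq_eqVlt => iJ n; rewrite geq_max => /andP[hn1 hn2].
  by move: iJ => /orP[/eqP ->|/h1]; [apply: h2|apply].
exists (n0 + (I + m).*2)%N => n hn.
set w := (count W (saws n (0 : pt)))%:R : R.
have [|D0] := leP w (e / 2 * (c n)%:R).
  by move/le_trans; apply; rewrite ler_wpM2r//; lra.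
suff h : 2 / e * (w - e / 2 * (c n)%:R) <= (c n)%:R.
  have : w - e / 2 * (c n)%:R <= e / 2 * (c n)%:R.
    rewrite -(ler_pM2l (_ : 0 < 2 / e)) ?divr_gt0//; apply: le_trans h _.
    rewrite mulrA le_eqVlt; apply/orP; left; apply/eqP; field; exact: lt0r_neq0.
  by lra.
have In : ((I + m).*2 <= n)%N by apply: leq_trans hn; rewrite leq_addl.
have := @insert_count d K m I n Km In; rewrite -(ler_nat R) natr_sum; apply: le_trans.
apply: le_trans (_ : \sum_(i <- iota 0 I) (bridges d i.*2)%:R * (q ^+ (i + m) * (w - e / 2 * (c
  n)%:R)) <= _).
  under eq_bigr => i _ do rewrite mulrA.
  rewrite -mulr_suml ler_wpM2r ?subr_ge0 ?(ltW D0)//.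
  apply: le_trans (_ : \sum_(i <- iota 0 I) ((bridges d i.*2)%:R * (mu^-1) ^+ i.*2) * (2 * mu ^+
    m.*2)^-1 <= _).
    rewrite -mulr_suml ler_pdivlMr ?mulr_gt0//.
    by rewrite mulrA [2 / e * 2]mulrC ltW.
  rewrite big_seq [leRHS]big_seq; apply: ler_sum => i; rewrite mem_iota add0n /= => iI.
  rewrite -mulrA ler_wpM2l// invfM mulrCA -exprVn -exprD -doubleD.
  have -> : q ^+ (i + m) = (s ^+ (i + m))^-1 * mu^-1 ^+ (i + m).*2.
    by rewrite /q invfM exprMn !exprVn mulrC -exprM -muln2 [(_ * 2)%N]mulnC.
  rewrite ler_wpM2r ?exprn_ge0 ?invr_ge0 ?(ltW m0)// lef_pV2 ?posrE ?exprn_gt0//.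
  apply: le_trans hs; rewrite ler_weXn2l ?(ltW s1)// leq_add2r ltnW//.
rewrite big_seq [leRHS]big_seq; apply: ler_sum => i; rewrite mem_iota add0n /= => iI.
rewrite natrM ler_wpM2l//.
have le2 : ((i + m).*2 <= (I + m).*2)%N by rewrite leq_double leq_add2r ltnW.
have := hn0 i iI (n - (i + m).*2)%N; rewrite subnK ?(leq_trans le2)//; apply.
by rewrite leq_subRL ?(leq_trans le2)// addnC (leq_trans _ hn)// leq_add2l.
Qed.

Lemma end_small (e : R) : 0 < e -> exists n0, forall n x, (n0 <= n)%N ->
  (count (fun w => last 0%R w == x) (saws n (0 : pt)))%:R <= e * (c n)%:R.
Proof.
move=> e_gt0; have e2 : 0 < e / 2 by rewrite divr_gt0.
(* K is odd, so that blocks have even length, and K >= 2 / e makes the bound c n / K at most e/2 c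
   n. *)
pose m := (Num.bound (2 / e)).+1; pose K := m.*2.-1.
have Km : K.+1 = m.*2 by [].
have [n0 hn0] := cut_only_small Km e2; exists n0 => n x hn.
have hK : 2 / e <= K%:R.
  apply/ltW/(lt_le_trans (archi_boundP _)); first by rewrite divr_ge0// ltW.
  by rewrite ler_nat /K /m; clear; lia.
have K_gt0 : 0 < K%:R :> R by apply: lt_le_trans hK; rewrite divr_gt0.
have := hn0 n hn; have := @block_count d K n (lat x); have := @unfold_count d n x.
set A := count _ _; set B := count _ _; set C := count _ _; set D := count _ _ => AB KC hD.
have BDC : (B <= D + C)%N.
  rewrite -count_predUI; apply: leq_trans (leq_addr _ _).
  apply: sub_count => w /= /andP[h1 h2]; rewrite /cut_only h1 h2 andbT /=.
  by case: (hasmark _ w).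
apply: le_trans (_ : (D + C)%:R <= _); first by rewrite ler_nat (leq_trans AB).
have hC : C%:R <= e / 2 * (c n)%:R.
  rewrite -(ler_pM2l K_gt0) -natrM; apply: le_trans (_ : (c n)%:R <= _).
    by rewrite ler_nat.
  rewrite mulrA ler_peMl//.
  have e1 : 2 / e * (e / 2) = 1 by field; exact: lt0r_neq0.
  by rewrite -[leLHS]e1 ler_wpM2r// ltW.
by rewrite natrD; lra.
Qed.

(** * Walks as functions and walks as lists *)

Definition path_of n (g : Zd_map d.+2 n) : seq pt := [seq g i | i <- enum 'I_n.+1].

Lemma nth_path_of n (g : Zd_map d.+2 n) (i : 'I_n.+1) : nth 0 (path_of g) i = g i.
Proof. by rewrite (nth_map ord0) ?size_enum_ord// nth_ord_enum. Qed.

Lemma path_of_SAW n (g : Zd_map d.+2 n) : issaw n 0 (path_of g) <-> SAW d.+2 n g.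
Proof.
have sz : size (path_of g) = n.+1 by rewrite size_map size_enum_ord.
have h0 : head 0 (path_of g) = g ord0 by rewrite -nth0 -(nth_path_of g ord0).
split.
  case/and4P => _ /eqP hd /(sortedP 0) so un; split; last by rewrite -h0.
  split; last by apply/injectiveP.
  move=> i j ij; have := so i; rewrite sz -ij ltn_ord => /(_ isT).
  by rewrite !nth_path_of => /eqP.
case=> -[wa gi] g0; apply/and4P; split; rewrite ?sz ?h0 ?g0//.
  apply/(sortedP 0) => i; rewrite sz => hi.
  have hi' := ltnW hi; have := wa (Ordinal hi') (Ordinal hi) erefl.
  by rewrite -!nth_path_of => /eqP.
by apply/injectiveP.
Qed.

Lemma card_SAW n (A : set (Zd_map d.+2 n)) (P : pred (seq pt)) :
  (forall g, A g <-> P (path_of g)) ->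
  size (finmap.enum_fset (fset_set (SAW d.+2 n `&` A)%classic)) = count P (saws n (0 : pt)).
Proof.
move=> AP; rewrite -size_filter -(size_map (@path_of n)).
have fA : finite_set (SAW d.+2 n `&` A)%classic by apply/finite_setIl/finite_SAW.
have inj : injective (@path_of n).
  by move=> g h gh; apply/ffunP => i; rewrite -!nth_path_of gh.
apply/perm_size/uniq_perm; first by rewrite map_inj_uniq ?finmap.fset_uniq.
  by rewrite filter_uniq ?saws_uniq.
move=> w; rewrite mem_filter mem_saws; apply/mapP/andP.
  move=> [g]; rewrite in_fset_set// in_setE => -[/path_of_SAW sg /AP Ag] ->.
  by [].
move=> [Pw ws]; have /andP[/eqP sw _] := ws.
have wE : w = path_of [ffun i : 'I_n.+1 => nth 0 w i].
  apply: (@eq_from_nth _ 0); first by rewrite size_map size_enum_ord.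
  move=> i; rewrite sw => hi.
  by rewrite -[i]/(nat_of_ord (Ordinal hi)) nth_path_of ffunE.
exists [ffun i : 'I_n.+1 => nth 0 w i] => //.
rewrite in_fset_set// in_setE; split; first by apply/path_of_SAW; rewrite -wE.
by apply/AP; rewrite -wE.
Qed.

Lemma P_SAW_end n (x : pt) :
  P_SAW R [set g : Zd_map d.+2 n | g ord_max = x]%classic =
  (count (fun w => last 0 w == x) (saws n (0 : pt)))%:R / (c n)%:R.
Proof.
have sc : size (finmap.enum_fset (fset_set (SAW d.+2 n))) = c n.
  by rewrite -[SAW d.+2 n]setIT (@card_SAW n setT (fun=> true))// count_predT.
rewrite /P_SAW -[X in _ / X%:R = _]/(size _) sc; congr (_%:R / _).
apply: card_SAW => g.
rewrite -nth_last size_map size_enum_ord -[n in nth _ _ n]/(nat_of_ord (@ord_max n)).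
by rewrite nth_path_of; split=> [->|/eqP].
Qed.
End EndpointProbability.

Unset Implicit Arguments.
Local Open Scope classical_set_scope.
Local Open Scope ring_scope.

Theorem theorem1p2 (R : realType) (d : nat) (hd : (2 <= d)%N) :
  (fun n : nat =>
     sup [set P_SAW R [set g : Zd_map d n | g ord_max = x] | x in [set: Zd d]])
    @ \oo --> (0 : R).
Proof.
case: d hd => [|[|d]]// _; apply/cvgrPdist_le => e e_gt0.
have [n0 hn0] := @end_small R d e e_gt0.
near=> n; have hn : (n0 <= n)%N by near: n; exists n0.
set S := [set _ | _ in _].
have S0 : S (P_SAW R [set g : Zd_map d.+2 n | g ord_max = 0]) by exists 0.
(* The threshold of [end_small] does not depend on x, which makes the estimate uniform over the
   endpoints. *)
have ub : ubound S e.
  move=> _ [x _ <-]; rewrite P_SAW_end ler_pdivrMr ?ltr0n ?c_gt0//.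
  exact: hn0.
rewrite sub0r normrN ger0_norm; first by apply: ge_sup => //;
  exists (P_SAW R [set g : Zd_map d.+2 n | g ord_max = 0]).
apply: le_trans (ub_le_sup _ S0); first by rewrite P_SAW_end divr_ge0.
by exists e.
Unshelve. all: by end_near. Qed.
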